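(* Let $\mathcal S\subset\mathbb H^1$ be an oriented $C^2$ surface with characteristic set $\Sigma_{\mathcal S}$, and let $\mathcal X=aX_1+bX_2+kT$ with $a,b,k\in C^2_0(\mathcal S\setminus\Sigma_{\mathcal S})$. The second variation of the $H$-perimeter along the deformation $\mathcal S^\lambda=\mathcal S+\lambda\mathcal X$ is $$\begin{aligned}\mathcal V^H_{II}(\mathcal S;\mathcal X)=\int_{\mathcal S}\Big\{&2(\bar qZa-\bar pZb)(Tk-\bar\omega Yk)\\&+(Ta-\bar\omega Ya)\big[-2\bar qZk-\bar q(a\bar p+b\bar q)-\bar p(a\bar q-b\bar p)\big]\\&+(Tb-\bar\omega Yb)\big[2\bar pZk+\bar p(a\bar p+b\bar q)-\bar q(a\bar q-b\bar p)\big]\\&+2(a\bar q-b\bar p)(\bar qZa-\bar pZb)\bar\omega\\&+(Za+\bar p\,\bar\omega Zk)^2+(Zb+\bar q\,\bar\omega Zk)^2+(a^2+b^2)\bar\omega^2\\&+2\bar\omega(aZa+bZb)+2\bar\omega^2(a\bar p+b\bar q)Zk\\&-\big(\bar qZa-\bar pZb+(a\bar q-b\bar p)\bar\omega\big)^2\Big\}\,d\sigma_H .\end{aligned}$$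
   Context: $\mathbb H^1=\mathbb R^3$ with group law $(x,y,t)(x',y',t')=(x+x',y+y',t+t'+\frac12(xy'-x'y))$ and left-invariant fields $X_1=\partial_x-\frac y2\partial_t$, $X_2=\partial_y+\frac x2\partial_t$, $T=\partial_t$; $\langle\cdot,\cdot\rangle$ is the Riemannian metric making $\{X_1,X_2,T\}$ orthonormal. For an oriented $C^2$ surface $\mathcal S$, $\boldsymbol N$ is a non-unit Riemannian normal, $p=\langle\boldsymbol N,X_1\rangle$, $q=\langle\boldsymbol N,X_2\rangle$, $\omega=\langle\boldsymbol N,T\rangle$, $W=\sqrt{p^2+q^2}$, $\Sigma_{\mathcal S}=\{W=0\}$; on $\mathcal S\setminus\Sigma_{\mathcal S}$: $\bar p=p/W$, $\bar q=q/W$, $\bar\omega=\omega/W$. $d\sigma_H=\frac{W}{|\boldsymbol N|}d\sigma$, $\sigma$ the Riemannian surface measure. $Y=\bar pX_1+\bar qX_2$ (horizontal Gauss map $\nu^H$ as a derivation) and $Z=\bar qX_1-\bar pX_2$. For functions $f$ on $\mathcal S$, the expressions $Zf$ and $Tf-\bar\omega Yf$ are computed with any $C^1$ extension of $f$ (they are independent of it since $Z$ and $T-\bar\omega Y$ are tangent to $\mathcal S$). Deformation: $\mathcal S^\lambda=\{g+\lambda\mathcal X(g):g\in\mathcal S\}$ for small $\lambda\in\mathbb R$, where $\mathcal X(g)$ is regarded as the vector $(a,b,k+\frac{bx-ay}{2})\in\mathbb R^3$ at $g=(x,y,t)$, and $+$ is addition in $\mathbb R^3$. $P_H(\mathcal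 S^\lambda)=\sigma_H(\mathcal S^\lambda)$ (if this is infinite, only the image of a relatively compact open subset of $\mathcal S$ containing the support of $\mathcal X$ is counted), and $\mathcal V^H_{II}(\mathcal S;\mathcal X)=\frac{d^2}{d\lambda^2}P_H(\mathcal S^\lambda)\big|_{\lambda=0}$. *)

(* Defs.v *)
From HB Require Import structures.
From mathcomp Require Import all_boot all_order all_algebra.
From mathcomp Require Import all_classical all_reals all_analysis.
From mathcomp Require Import ring.

Set Implicit Arguments.
Unset Strict Implicit.
Unset Printing Implicit Defensive.

Import Order.TTheory GRing.Theory Num.Theory.
Import numFieldNormedType.Exports.

Local Open Scope classical_set_scope.
Local Open Scope ring_scope.

(** A point [(x, y, t)], and also a tangent vector given by its Cartesian
    components. *)
Notation heis R := (R * R * R)%type.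

Definition X1 {R : realType} (g : heis R) : heis R := (1, 0, - (g.1.2 / 2)).
Definition X2 {R : realType} (g : heis R) : heis R := (0, 1, g.1.1 / 2).
Definition T {R : realType} (g : heis R) : heis R := (0, 0, 1).

(** [v = v.1.1 X1 + v.1.2 X2 + vert g v T] at [g]. *)
Definition vert {R : realType} (g v : heis R) : R :=
  v.2 + (g.1.2 * v.1.1 - g.1.1 * v.1.2) / 2.

Definition inner {R : realType} (g v w : heis R) : R :=
  v.1.1 * w.1.1 + v.1.2 * w.1.2 + vert g v * vert g w.

Definition rnorm {R : realType} (g v : heis R) : R := Num.sqrt (inner g v v).

Lemma frame_expansion (R : realType) (g v : heis R) :
  v = v.1.1 *: X1 g + v.1.2 *: X2 g + vert g v *: T g.
Proof.
case: v => -[v1 v2] v3; case: g => -[x y] t; rewrite /vert /X1 /X2 /T /=.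
by congr (_, _, _); rewrite /= /GRing.scale /=; field.
Qed.

Lemma frame_orthonormal (R : realType) (g : heis R) :
  [/\ inner g (X1 g) (X1 g) = 1, inner g (X2 g) (X2 g) = 1
    & inner g (T g) (T g) = 1] /\
  [/\ inner g (X1 g) (X2 g) = 0, inner g (X1 g) (T g) = 0
    & inner g (X2 g) (T g) = 0].
Proof.
have v1 : vert g (X1 g) = 0.
  by rewrite /vert /X1 /= mulr1 mulr0 subr0 addNr.
have v2 : vert g (X2 g) = 0.
  by rewrite /vert /X2 /= mulr1 mulr0 sub0r mulNr subrr.
have v3 : vert g (T g) = 1 by rewrite /vert /T /= !mulr0 subr0 mul0r addr0.
by rewrite /inner v1 v2 v3 /= !(mulr0, mul0r, mulr1, addr0, add0r).
Qed.

(** Class [C^k] on an open set [U] of a finite-dimensional space. *)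
Fixpoint Ck {R : realType} {V W : normedModType R} (k : nat) (U : set V)
    (f : V -> W) : Prop :=
  if k is k'.+1 then
    (forall x, U x -> differentiable f x) /\
    (forall v : V, Ck k' U ('D_v f))
  else forall x, U x -> {for x, continuous f}.

Definition du {R : realType} (th : R * R -> heis R) (u : R * R) : heis R :=
  'D_((1, 0) : R * R) th u.
Definition dv {R : realType} (th : R * R -> heis R) (u : R * R) : heis R :=
  'D_((0, 1) : R * R) th u.

(** Square root of the determinant of the metric induced on the [(u,v)]-domain. *)
Definition area_element {R : realType} (th : R * R -> heis R) (u : R * R) : R :=
  Num.sqrt (inner (th u) (du th u) (du th u) * inner (th u) (dv th u) (dv th u)
            - inner (th u) (du th u) (dv th u) ^+ 2).

(** Regular [C^2] local parametrization of [S], homeomorphic onto a relatively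
    open subset of [S].  The last clause contains both the relative openness of
    the image and the continuity of the inverse. *)
Definition chart {R : realType} (S : set (heis R)) (U : set (R * R))
    (th : R * R -> heis R) : Prop :=
  [/\ open U,
      Ck 2 U th,
      set_inj U th,
      (forall u, U u -> forall r s : R,
         r *: du th u + s *: dv th u = 0 -> r = 0 /\ s = 0)
    & forall V, open V -> V `<=` U ->
        exists2 O, open O & th @` V = S `&` O].

Definition C2_surface {R : realType} (S : set (heis R)) : Prop :=
  forall g, S g -> exists U th, chart S U th /\ (th @` U) g.

(** [N] is a continuous nowhere vanishing, not necessarily unit, Riemannian
    normal field along [S]; it fixes the orientation of [S]. *)
Definition normal_field {R : realType} (S : set (heis R))
    (N : heis R -> heis R) : Prop :=
  [/\ {within S, continuous N},
      (forall g, S g -> N g <> 0)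
    & forall U th, chart S U th -> forall u, U u ->
        inner (th u) (N (th u)) (du th u) = 0 /\
        inner (th u) (N (th u)) (dv th u) = 0].

(** The Borel measure on [R^3], concentrated on [S], whose expression in every
    chart is [area_element du dv].  This determines it, since [S] is covered by
    countably many charts. *)
Definition riemannian_surface_measure {R : realType} (S : set (heis R))
    (sigma : {measure set (heis R) -> \bar R}) : Prop :=
  sigma (~` S) = 0%E /\
  forall U th, chart S U th -> forall A, measurable A ->
    sigma (A `&` th @` U) =
    (\int[(@lebesgue_measure R \x @lebesgue_measure R)%E]_(u in
        U `&` th @^-1` A) (area_element th u)%:E)%E.

Definition nX1 {R : realType} (N : heis R -> heis R) (g : heis R) : R :=
  inner g (N g) (X1 g).
Definition nX2 {R : realType} (N : heis R -> heis R) (g : heis R) : R :=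
  inner g (N g) (X2 g).
Definition nT {R : realType} (N : heis R -> heis R) (g : heis R) : R :=
  inner g (N g) (T g).
Definition W {R : realType} (N : heis R -> heis R) (g : heis R) : R :=
  Num.sqrt (nX1 N g ^+ 2 + nX2 N g ^+ 2).

Definition pbar {R : realType} (N : heis R -> heis R) (g : heis R) : R :=
  nX1 N g / W N g.
Definition qbar {R : realType} (N : heis R -> heis R) (g : heis R) : R :=
  nX2 N g / W N g.
Definition wbar {R : realType} (N : heis R -> heis R) (g : heis R) : R :=
  nT N g / W N g.

Definition Y {R : realType} (N : heis R -> heis R) (g : heis R) : heis R :=
  pbar N g *: X1 g + qbar N g *: X2 g.
Definition Z {R : realType} (N : heis R -> heis R) (g : heis R) : heis R :=
  qbar N g *: X1 g - pbar N g *: X2 g.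

(** A vector field acting as a derivation. *)
Definition along {R : realType} (V : heis R -> heis R) (f : heis R -> R)
    (g : heis R) : R := 'D_(V g) f g.

Definition char_set {R : realType} (S : set (heis R))
    (N : heis R -> heis R) : set (heis R) := [set g | S g /\ W N g = 0].

(** [d sigma_H = W / |N| d sigma] *)
Definition integral_H {R : realType}
    (sigma : {measure set (heis R) -> \bar R}) (N : heis R -> heis R)
    (A : set (heis R)) (f : heis R -> R) : \bar R :=
  (\int[sigma]_(g in A) (f g * (W N g / rnorm g (N g)))%:E)%E.

Definition sigma_H {R : realType}
    (sigma : {measure set (heis R) -> \bar R}) (N : heis R -> heis R)
    (A : set (heis R)) : \bar R := integral_H sigma N A (fun=> 1).

(** A function on [S] is represented by a function on [R^3] of which only the
    values on [S] matter. *)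
Definition support_on {R : realType} {V : zmodType} (S : set (heis R))
    (f : heis R -> V) : set (heis R) := closure [set g | S g /\ f g <> 0].

(** [f] is of class [C^2] on [S], with compact support contained in [S `\` E]. *)
Definition C2_0 {R : realType} (S E : set (heis R)) (f : heis R -> R) : Prop :=
  [/\ (forall U th, chart S U th -> Ck 2 U (f \o th)),
      compact (support_on S f)
    & support_on S f `<=` S `\` E].

Definition C1_extension {R : realType} (S : set (heis R))
    (f F : heis R -> R) : Prop :=
  (exists O, [/\ open O, S `<=` O & Ck 1 O F]) /\
  (forall g, S g -> F g = f g).

Definition vfield {R : realType} (a b k : heis R -> R) (g : heis R) : heis R :=
  a g *: X1 g + b g *: X2 g + k g *: T g.

Lemma vfieldE (R : realType) (a b k : heis R -> R) (x y t : R) :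
  let g := (x, y, t) in
  vfield a b k g = (a g, b g, k g + (b g * x - a g * y) / 2).
Proof.
rewrite /vfield /X1 /X2 /T /=.
by congr (_, _, _); rewrite /= /GRing.scale /=; field.
Qed.

Definition deform {R : realType} (X : heis R -> heis R) (l : R)
    (A : set (heis R)) : set (heis R) := [set g + l *: X g | g in A].

Definition rel_compact_open {R : realType} (S S0 : set (heis R)) : Prop :=
  [/\ exists2 O, open O & S0 = S `&` O,
      compact (closure S0) & closure S0 `<=` S].

(** [l |-> P_H (S^l)], where [sigma l] and [N l] are the surface measure and a
    normal field of [S^l]; if [S^l] has infinite H-perimeter, only the image of
    [S0] is counted. *)
Definition perimeter {R : realType}
    (sigma : R -> {measure set (heis R) -> \bar R})
    (N : R -> heis R -> heis R) (S S0 : set (heis R)) (X : heis R -> heis R)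
    (l : R) : R :=
  let P := sigma_H (sigma l) (N l) in
  fine (if (P (deform X l S) < +oo)%E then P (deform X l S)
        else P (deform X l S0)).

(* Main.v *)
Require Import Defs.
From mathcomp Require Import all_boot all_order all_algebra.
From mathcomp Require Import all_classical all_reals all_analysis.
From mathcomp Require Import measurable_realfun ring lra.

(* In a chart th the H-perimeter density is sqrt (A^2 + B^2), where (A, B) is
   the horizontal part of the cross product of the coordinate tangent vectors
   of th. Under g |-> g + l X(g) the functions A and B become polynomials of
   degree at most 3 in l, and A^2 + B^2 is bounded away from 0 for small l on
   the compact support of X, which avoids the characteristic set; so the
   perimeter of each piece of the support is differentiated twice under the
   integral sign, while the perimeter of the complement of the support does not
   depend on l. As id + l X is expansive up to a constant on the support and the
   identity off it, charts of S are transported to charts of the deformed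
   surface. The coefficients of the two polynomials are alternating bilinear in
   the tangent vectors, hence can be computed in the frame Z, T - wbar Y; the
   resulting density is the stated integrand modulo pbar^2 + qbar^2 = 1. *)

Set Implicit Arguments.
Unset Strict Implicit.
Unset Printing Implicit Defensive.

Import Order.TTheory GRing.Theory Num.Theory.
Import numFieldNormedType.Exports.

Local Open Scope classical_set_scope.
Local Open Scope ring_scope.

(** * Borel sets of the plane and of the Heisenberg group *)

(** The measures [sigmad l] and normals [Nd l] for different [l] have no relation to each other, so
    nothing is differentiated on the deformed surfaces. In a chart, [W / |N|] times the area element
    does not depend on the normal chosen, and a transported chart keeps its parameter domain; the
    perimeter thus becomes an integral over a set of parameters that does not move. As [S] has no
    global parametrization, it is cut into countably many disjoint Borel pieces, each inside the
    chart image of a compact set of parameters, and only finitely many pieces meet the support. In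
    the frame [Z], [T - wbar Y] the density at time 0 is |d|, with d the determinant of the
    coordinate tangent vectors. The polynomial under the root is d^2 Q up to order 2, with Q_0 = 1,
    so its root has second derivative |d| (Q_2 - Q_1^2 / 4) at 0. The C^1 extensions of [a], [b],
    [k] serve twice: they give Lipschitz bounds in the norm of R^3, valid across charts, and they
    give a meaning to the derivatives along [Z], [T] and [Y]. *)

Definition countable_basis (T : topologicalType) (I : countType)
    (B : I -> set T) :=
  (forall i, open (B i)) /\
  (forall x V, nbhs x V -> exists2 i, B i x & B i `<=` V).

Definition rat_itv (R : realType) (q : rat * rat) : set R :=
  `](ratr q.1 : R), (ratr q.2 : R)[%classic.

Lemma countable_basis_real (R : realType) : countable_basis (@rat_itv R).
Proof.
split=> [q|x V /nbhs_ballP[e /= e0 xeV]]; first exact: interval_open.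
have [p pI] := rat_in_itvoo (x := x - e) (y := x) ltac:(by rewrite ltrBlDr ltrDl).
have [q qI] := rat_in_itvoo (x := x) (y := x + e) ltac:(by rewrite ltrDl).
move: pI qI; rewrite !in_itv/= => /andP[p1 p2] /andP[q1 q2].
exists (p, q); first by rewrite /rat_itv /= in_itv/= p2 q1.
move=> y; rewrite /rat_itv /= in_itv/= => /andP[py yq]; apply: xeV.
rewrite /ball/= ltr_distlC.
by rewrite (lt_trans p1 py) (lt_trans yq q2).
Qed.

Lemma open_setX (T1 T2 : topologicalType) (A : set T1) (B : set T2) :
  open A -> open B -> open (A `*` B).
Proof.
rewrite !openE => oA oB [x y] [/= Ax By].
by exists (A, B) => //; split; [exact: oA|exact: oB].
Qed.

Lemma countable_basis_prod (T1 T2 : topologicalType) (I1 I2 : countType)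
    (B1 : I1 -> set T1) (B2 : I2 -> set T2) :
  countable_basis B1 -> countable_basis B2 ->
  countable_basis (fun i : I1 * I2 => B1 i.1 `*` B2 i.2).
Proof.
move=> [oB1 bB1] [oB2 bB2]; split=> [i|[x y] V]; first exact: open_setX.
move=> -[[V1 V2] /= [V1x V2y] VV].
have [i U1x U1V] := bB1 _ _ V1x; have [j U2x U2V] := bB2 _ _ V2y.
exists (i, j) => // -[a b] [/= a1 b2].
by apply: VV; split; [exact: U1V|exact: U2V].
Qed.

Lemma open_bigcup_basis (T : topologicalType) (I : countType)
    (B : I -> set T) (O : set T) : countable_basis B -> open O ->
  O = \bigcup_(i in [set i | B i `<=` O]) B i.
Proof.
move=> [oB bB] oO; apply/seteqP; split=> [x Ox|x [i iO /iO]//].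
have [i ix iO] := bB _ _ (open_nbhs_nbhs (conj oO Ox)).
by exists i.
Qed.

(** For each basic set contained in some [O x] with [x] in [S], one such [x] is chosen, and the
    basic sets with a choice already cover [S]. The values in [option] leave room for basic sets
    without a choice and for an empty [S]. *)
Lemma lindelof (T : topologicalType) (I : countType) (B : I -> set T)
    (S : set T) (O : T -> set T) : countable_basis B ->
  (forall x, S x -> open (O x) /\ O x x) ->
  exists c : nat -> option T, (forall n x, c n = Some x -> S x) /\
    forall y, S y -> exists n x, c n = Some x /\ O x y.
Proof.
move=> [oB bB] OS.
pose good b x := S x /\ B b `<=` O x.
have [f fP] : exists f : I -> option T, forall b,
    (forall x, f b = Some x -> good b x) /\
    ((exists x, good b x) -> exists x, f b = Some x).
  exists (fun b => if pselect (exists x, good b x) is left h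
    then Some (projT1 (cid h)) else None) => b.
  case: pselect => [h|nh]; last by split.
  by split=> [x [<-]|_]; [exact: projT2 (cid h)|exists (projT1 (cid h))].
exists (fun n => obind f (unpickle n)); split=> [n x|y Sy].
  by case: (unpickle n) => //= i /(proj1 (fP i))[].
have [oy yy] := OS _ Sy.
have [i iy iO] := bB _ _ (open_nbhs_nbhs (conj oy yy)).
have [f1 /(_ (ex_intro _ y (conj Sy iO)))[x fx]] := fP i.
exists (pickle i), x; rewrite pickleK; split=> //.
by have [_] := f1 _ fx; exact.
Qed.

Lemma measurable_bigcup_basis d (T : measurableType d) (I : countType)
    (B : I -> set T) (D : set I) :
  (forall i, measurable (B i)) -> measurable (\bigcup_(i in D) B i).
Proof.
move=> mB; rewrite bigcup_mkcond; apply: countable_bigcupT_measurable => // i.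
by case: ifPn.
Qed.

Definition basis2 (R : realType) (i : (rat * rat) * (rat * rat)) : set (R * R) :=
  @rat_itv R i.1 `*` @rat_itv R i.2.

Definition basis3 (R : realType) (i : (rat * rat) * (rat * rat) * (rat * rat)) :
  set (heis R) := @basis2 R i.1 `*` @rat_itv R i.2.

Lemma countable_basis2 (R : realType) : countable_basis (@basis2 R).
Proof. by apply: countable_basis_prod; exact: countable_basis_real. Qed.

Lemma countable_basis3 (R : realType) : countable_basis (@basis3 R).
Proof.
by apply: countable_basis_prod; [exact: countable_basis2|exact: countable_basis_real].
Qed.

(** The product sigma-algebra contains the rational rectangles, and countably many of them make up
    any open set. *)
Lemma open_measurable2 (R : realType) (O : set (R * R)) : open O -> measurable O.
Proof.
move=> /(open_bigcup_basis (countable_basis2 R)) ->.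
by apply: measurable_bigcup_basis => i; apply: measurableX; exact: measurable_itv.
Qed.

Lemma open_measurable3 (R : realType) (O : set (heis R)) : open O -> measurable O.
Proof.
move=> /(open_bigcup_basis (countable_basis3 R)) ->.
apply: measurable_bigcup_basis => i; apply: measurableX; last exact: measurable_itv.
by apply: measurableX; exact: measurable_itv.
Qed.

Lemma compact_measurable3 (R : realType) (K : set (heis R)) :
  compact K -> measurable K.
Proof.
move=> /compact_closed cK; rewrite -(setCK K); apply: measurableC.
by apply: open_measurable3; apply: closed_openC; apply: cK; exact: norm_hausdorff.
Qed.

(** * Calculus of the classes C^k *)

Lemma near_eq_differentiable (R : realType) (V W : normedModType R)
    (f g : V -> W) (x : V) :
  (\forall y \near x, f y = g y) -> differentiable f x -> differentiable g x.
Proof.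
move=> fg df.
(* The difference [h] vanishes near [x], hence has differential zero there, and [g = h + f]. *)
pose h : V -> W := g - f.
have h0 : \forall y \near (0 : V), h (y + x) = 0.
  have : \forall y \near x, h y = 0.
    by apply: filterS fg => y; rewrite /h !fctE => ->; rewrite subrr.
  rewrite (near_shift 0 x) => hx.
  by apply: filterS hx => y /=; rewrite subr0.
have E : h \o shift x = cst (h x) + (\0 : {linear V -> W}) +o_ (0 : V) id.
  apply/eqaddoP => e e0; apply: filterS h0 => y hy.
  rewrite !fctE /= hy (_ : h x = 0); last first.
    by have := nbhs_singleton fg; rewrite /h !fctE => ->; rewrite subrr.
  by rewrite addr0 subr0 normr0 mulr_ge0// ltW.
have c0 : continuous (\0 : V -> W) by move=> y; exact: cvg_cst.
have dh : 'd h x = (\0 : {linear V -> W}) :> (V -> W) by exact: diff_unique.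
have -> : g = h + f by rewrite /h subrK.
apply: differentiableD => //.
by apply/diff_locallyP; rewrite dh.
Qed.

Section Ck_theory.
Variables (R : realType) (V : normedModType R).
Implicit Types (U : set V) (W : normedModType R).

Lemma CkW U W k (f : V -> W) : Ck k.+1 U f -> Ck k U f.
Proof.
elim: k f => [|k IH] f [df Df]; first by move=> x Ux; exact/differentiable_continuous/df.
by split=> // v; exact: IH.
Qed.

Lemma Ck_subset U U' W k (f : V -> W) : U' `<=` U -> Ck k U f -> Ck k U' f.
Proof.
move=> U'U; elim: k f => [|k IH] f /=; first by move=> cf x /U'U; exact: cf.
by move=> [df Df]; split=> [x /U'U|v]; [exact: df|exact: IH].
Qed.

(** Openness of [U] turns equality on [U] into equality near each of its points, so directional
    derivatives agree as well. The closure properties below use it to replace the derivative of a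
    sum, product or composite by an expression that the induction hypothesis covers. *)
Lemma Ck_eq U W k (f g : V -> W) : open U -> (forall x, U x -> f x = g x) ->
  Ck k U f -> Ck k U g.
Proof.
move=> oU; elim: k f g => [|k IH] f g fg.
  move=> cf x Ux; have fgx : \forall y \near x, f y = g y.
    by apply: filterS (open_nbhs_nbhs (conj oU Ux)) => y /fg.
  rewrite /prop_for /continuous_at -(fg _ Ux).
  exact: cvg_trans (near_eq_cvg fgx) (cf x Ux).
have fgx x : U x -> \forall y \near x, f y = g y.
  by move=> Ux; apply: filterS (open_nbhs_nbhs (conj oU Ux)) => y /fg.
move=> [df Df]; split=> [x Ux|v].
  exact: near_eq_differentiable (fgx _ Ux) (df x Ux).
by apply: IH (Df v) => x Ux; apply: near_eq_derive; exact: fgx.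
Qed.

Lemma Ck_linear U W W' k (L : {linear W -> W'}) (f : V -> W) :
  open U -> continuous L -> Ck k U f -> Ck k U (L \o f).
Proof.
move=> oU cL; have dL y : differentiable L y by exact: linear_differentiable.
elim: k f => [|k IH] f.
  by move=> cf x Ux; apply: continuous_comp; [exact: cf|exact: cL].
move=> [df Df]; split=> [x Ux|v].
  by apply: differentiable_comp; [exact: df|exact: dL].
apply: Ck_eq (IH _ (Df v)) => // x Ux /=.
have dfx := df _ Ux.
rewrite !deriveE//; last exact: differentiable_comp.
by rewrite (diff_comp dfx (dL _)) /= diff_lin.
Qed.

Lemma Ck_pair U W W' k (f : V -> W) (g : V -> W') :
  open U -> Ck k U f -> Ck k U g -> Ck k U (fun x => (f x, g x)).
Proof.
move=> oU; elim: k f g => [|k IH] f g.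
  by move=> cf cg x Ux; apply: cvg_pair; [exact: cf|exact: cg].
move=> [df Df] [dg Dg]; split=> [x Ux|v].
  by apply: differentiable_pair; [exact: df|exact: dg].
apply: Ck_eq (IH _ _ (Df v) (Dg v)) => // x Ux /=.
have dfx := df _ Ux; have dgx := dg _ Ux.
rewrite !deriveE//; last exact: differentiable_pair.
by rewrite diff_pair.
Qed.

Lemma CkD U W k (f g : V -> W) :
  open U -> Ck k U f -> Ck k U g -> Ck k U (f \+ g).
Proof.
move=> oU; elim: k f g => [|k IH] f g.
  by move=> cf cg x Ux; apply: cvgD; [exact: cf|exact: cg].
move=> [df Df] [dg Dg]; split=> [x Ux|v].
  by apply: differentiableD; [exact: df|exact: dg].
apply: Ck_eq (IH _ _ (Df v) (Dg v)) => // x Ux /=.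
by rewrite deriveD//; apply: diff_derivable; [exact: df|exact: dg].
Qed.

Lemma Ck_cst U W k (c : W) : Ck k U (cst c : V -> W).
Proof.
elim: k c => [|k IH] c; first by move=> x Ux; exact: cvg_cst.
split=> [x Ux|v]; first exact: differentiable_cst.
by rewrite (_ : 'D_v _ = cst 0)//; apply/funext => x; rewrite derive_cst.
Qed.

Lemma CkM U k (f g : V -> R) :
  open U -> Ck k U f -> Ck k U g -> Ck k U (f \* g).
Proof.
move=> oU; elim: k f g => [|k IH] f g.
  by move=> cf cg x Ux; apply: cvgM; [exact: cf|exact: cg].
move=> Cf Cg; have [df Df] := Cf; have [dg Dg] := Cg; split=> [x Ux|v].
  by apply: differentiableM; [exact: df|exact: dg].
have CfDg := IH _ _ (CkW Cf) (Dg v); have CgDf := IH _ _ (CkW Cg) (Df v).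
apply: Ck_eq (CkD oU CfDg CgDf) => // x Ux /=.
by rewrite deriveM//; apply: diff_derivable; [exact: df|exact: dg].
Qed.

End Ck_theory.

(** * Lipschitz estimates on the Heisenberg group with the norm of R^3 *)

Lemma heis_decomp (R : realType) (w : heis R) :
  w = w.1.1 *: ((1, 0, 0) : heis R) + w.1.2 *: ((0, 1, 0) : heis R)
    + w.2 *: ((0, 0, 1) : heis R).
Proof.
case: w => -[a b] c; congr (_, _, _); rewrite /= /GRing.scale /=; ring.
Qed.

Lemma norm_heis (R : realType) (w : heis R) :
  `|w| = Num.max (Num.max `|w.1.1| `|w.1.2|) `|w.2|.
Proof. by rewrite prod_normE/= prod_normE. Qed.

Lemma norm_heis_le (R : realType) (w : heis R) :
  [/\ `|w.1.1| <= `|w|, `|w.1.2| <= `|w| & `|w.2| <= `|w|].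
Proof. by rewrite norm_heis !le_max !lexx !orbT. Qed.

Lemma ball_segment (R : realType) (V : normedModType R) (g x y : V) r t :
  0 <= t <= 1 -> ball g r x -> ball g r y -> ball g r (x + t *: (y - x)).
Proof.
move=> /andP[t0 t1]; rewrite -!ball_normE /ball_ /= => gx gy.
have -> : g - (x + t *: (y - x)) = (1 - t) *: (g - x) + t *: (g - y).
  have -> : y - x = (g - x) - (g - y) by rewrite opprB [RHS]addrC addrA subrK.
  by rewrite scalerBl scale1r scalerBr opprD opprB addrA [RHS]addrAC addrA.
rewrite (le_lt_trans (ler_normD _ _))// !normrZ ger0_norm ?subr_ge0// (ger0_norm t0).
move: gx gy; set A := `|_|; set B := `|_| => gx gy.
have [->|tn0] := eqVneq t 0; first by rewrite subr0 mul1r mul0r addr0.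
have : t * B < t * r by rewrite ltr_pM2l// lt_neqAle eq_sym tn0.
have : (1 - t) * A <= (1 - t) * r by rewrite ler_wpM2l ?subr_ge0// ltW.
lra.
Qed.

(** The differential is expanded along the three coordinate vectors, and each coordinate of [w] is
    at most its max norm; hence the factor 3. *)
Lemma derive_heis_bound (R : realType) (F : heis R -> R) (y w : heis R) (M : R) :
  differentiable F y ->
  `|'D_((1, 0, 0) : heis R) F y| <= M -> `|'D_((0, 1, 0) : heis R) F y| <= M ->
  `|'D_((0, 0, 1) : heis R) F y| <= M -> `|'D_w F y| <= 3 * M * `|w|.
Proof.
move=> dF; rewrite !deriveE//= [in 'd F y w](heis_decomp w) !linearD !linearZ/=.
move: ('d _ _ _) ('d _ _ _) ('d _ _ _) => a b c cM bM aM.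
have [w1 w2 w3] := norm_heis_le w.
have H (u v : R) : `|u| <= `|w| -> `|v| <= M -> `|u * v| <= `|w| * M.
  by move=> uw vM; rewrite normrM ler_pM.
have := H _ _ w1 cM; have := H _ _ w2 bM; have := H _ _ w3 aM.
rewrite /GRing.scale/=.
have := ler_normD (w.1.1 * c) (w.1.2 * b).
have := ler_normD (w.1.1 * c + w.1.2 * b) (w.2 * a).
lra.
Qed.

Lemma exists_max3 (R : realType) (x y z : R) :
  exists M, [/\ x <= M, y <= M & z <= M].
Proof.
by exists (Num.max (Num.max x y) z); rewrite !le_max !lexx !orbT.
Qed.

(** Continuity bounds the three partial derivatives near [g], hence every directional derivative.
    The mean value theorem then applies along segments, which stay in the ball by convexity. *)
Lemma Ck1_lipschitz_near (R : realType) (O : set (heis R)) (F : heis R -> R) g :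
  open O -> Ck 1 O F -> O g -> exists r C : R, [/\ 0 < r, 0 <= C &
    forall h1 h2, ball g r h1 -> ball g r h2 -> `|F h1 - F h2| <= C * `|h1 - h2|].
Proof.
move=> oO [dF DF] Og.
pose D e y := 'D_e F y.
have bnd (e : heis R) : \forall y \near g, `|D e y| <= `|D e g| + 1.
  have /cvgr_norm_le := DF e g Og; apply.
  by rewrite ltrDl.
have [M [M1 M2 M3]] := exists_max3 (`|D (1, 0, 0) g| + 1) (`|D (0, 1, 0) g| + 1)
  (`|D (0, 0, 1) g| + 1).
have [r r0 rP] : exists2 r : R, 0 < r & forall y, ball g r y ->
    O y /\ forall w, `|'D_w F y| <= 3 * M * `|w|.
  have : \forall y \near g, O y /\ forall w, `|'D_w F y| <= 3 * M * `|w|.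
    have nO : nbhs g O by exact: open_nbhs_nbhs.
    apply: filterS (filterI nO (filterI (bnd (1, 0, 0))
      (filterI (bnd (0, 1, 0)) (bnd (0, 0, 1))))) => y [Oy [B1 [B2 B3]]].
    split=> // w; apply: derive_heis_bound; first exact: dF.
    - exact: le_trans B1 M1.
    - exact: le_trans B2 M2.
    - exact: le_trans B3 M3.
  by move=> /nbhs_ballP[r /= r0 rP]; exists r.
exists r, (3 * M); split=> //.
  by rewrite mulr_ge0// (le_trans _ M1)// addr_ge0.
move=> h1 h2 b1 b2; rewrite distrC (distrC h1).
pose f t := F (h1 + t *: (h2 - h1)).
have dfP (t : R) : 0 <= t <= 1 -> is_derive t 1 f ('D_(h2 - h1) F (h1 + t *: (h2 - h1))).
  move=> t01; have [Oy _] := rP _ (ball_segment t01 b1 b2).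
  have dFy := dF _ Oy.
  have E : (fun h : R => h^-1 *: (f (h *: 1 + t) - f t)) =
      (fun h => h^-1 *: (F (h *: (h2 - h1) + (h1 + t *: (h2 - h1))) -
        F (h1 + t *: (h2 - h1)))).
    apply/funext => h; rewrite /f; congr (_ *: (F _ - _)).
    by rewrite scaler1 scalerDl addrCA.
  split; first by rewrite /derivable E; exact: diff_derivable.
  by rewrite /derive E.
have [c c01] : exists2 c, c \in `]0, 1[ &
    f 1 - f 0 = ('D_(h2 - h1) F (h1 + c *: (h2 - h1))) * (1 - 0).
  apply: (@MVT _ f (fun t => 'D_(h2 - h1) F (h1 + t *: (h2 - h1)))) => //.
    by move=> x /subset_itv_oo_cc; rewrite in_itv/= => x01; exact: dfP.
  apply: derivable_within_continuous => x; rewrite in_itv/= => x01.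
  by have [] := dfP x x01.
rewrite subr0 mulr1 /f scale1r scale0r addr0 (addrC h1) subrK => ->.
have c01' : 0 <= c <= 1 by move: c01; rewrite in_itv/= => /andP[/ltW -> /ltW ->].
by have [_] := rP _ (ball_segment c01' b1 b2); exact.
Qed.

(** If one point is in [K], a close second point falls under the local Lipschitz bound, and for a
    distant one a global bound on [f] is compared with the distance; if neither is in [K], both
    values vanish. Compactness of [K] makes the constants uniform. *)
Lemma lipschitz_compact_support (R : realType) (V : normedModType R)
    (S K : set V) (f : V -> R) :
  compact K -> K `<=` S -> (forall g, S g -> ~ K g -> f g = 0) ->
  (forall g, K g -> exists r C : R, [/\ 0 < r, 0 <= C & forall h1 h2,
     S h1 -> S h2 -> ball g r h1 -> ball g r h2 ->
     `|f h1 - f h2| <= C * `|h1 - h2|]) ->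
  \forall C \near +oo,
    forall h1 h2, S h1 -> S h2 -> `|f h1 - f h2| <= C * `|h1 - h2|.
Proof.
move=> cK KS f0 lipf.
have /compact_near_coveringP/near_covering_withinP nK := cK.
have [M M0 fM] : exists2 M, 0 < M & forall g, S g -> `|f g| <= M.
  have : \forall M \near (+oo : set_system R), K `<=` (fun g => `|f g| <= M).
    apply: nK => g Kg; have [r [C [r0 C0 lip]]] := lipf g Kg.
    near=> g' M => /= Kg'.
    have bg' : ball g r g' by near: g'; exact: nbhsx_ballx.
    have := lip g' g (KS _ Kg') (KS _ Kg) bg' (ballxx _ r0).
    move: bg'; rewrite -ball_normE/= distrC => bg'.
    have MM : `|f g| + C * r <= M.
      by near: M; apply: nbhs_pinfty_ge; rewrite num_real.
    have : C * `|g' - g| <= C * r by rewrite ler_wpM2l// ltW.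
    have : `|f g'| <= `|f g' - f g| + `|f g| by rewrite -{1}(subrK (f g) (f g')) ler_normD.
    lra.
  move=> /pinfty_ex_gt0[M M0 KM]; exists M => // g Sg.
  have [Kg|nKg] := pselect (K g); first exact: KM.
  by rewrite f0// normr0 ltW.
have H : \forall C \near (+oo : set_system R), K `<=` (fun g =>
    forall h, S h -> `|f g - f h| <= C * `|g - h|).
  apply: nK => g Kg; have [r [C [r0 C0 lip]]] := lipf g Kg.
  near=> g' C' => /= Kg' h Sh.
  have Sg' := KS _ Kg'.
  have bg' : ball g (r / 2) g' by near: g'; apply: nbhsx_ballx; rewrite divr_gt0.
  have CC' : C <= C' by near: C'; apply: nbhs_pinfty_ge; rewrite num_real.
  have CM : 2 * M / (r / 2) <= C' by near: C'; apply: nbhs_pinfty_ge; rewrite num_real.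
  have [hg'|hg'] := ltP `|g' - h| (r / 2).
    apply: (@le_trans _ _ (C * `|g' - h|)); last by rewrite ler_wpM2r.
    apply: lip => //; first by apply: le_ball bg'; rewrite ler_pdivrMr// ler_pMr// ler1n.
    by rewrite [r]splitr; apply: ball_triangle bg' _; rewrite -ball_normE.
  apply: (@le_trans _ _ (2 * M)).
    rewrite (le_trans (ler_normB _ _))//.
    by have := fM _ Sg'; have := fM _ Sh; lra.
  move: CM; rewrite ler_pdivrMr ?divr_gt0// => CM; rewrite (le_trans CM)//.
  by rewrite ler_wpM2l// (le_trans C0).
near=> C => h1 h2 Sh1 Sh2.
have HC : K `<=` (fun g => forall h, S h -> `|f g - f h| <= C * `|g - h|) by near: C.
have [K1|nK1] := pselect (K h1); first exact: HC.
have [K2|nK2] := pselect (K h2); first by rewrite distrC (distrC h1); exact: HC.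
have C0 : 0 <= C by near: C; apply: nbhs_pinfty_ge; rewrite num_real.
by rewrite f0// f0// subrr normr0 mulr_ge0.
Unshelve. all: by end_near. Qed.

(** * Charts under expansive maps *)

Lemma deriveDZ (R : realType) (V W : normedModType R) (f : V -> W) (x v w : V) (r s : R) :
  differentiable f x -> 'D_(r *: v + s *: w) f x = r *: 'D_v f x + s *: 'D_w f x.
Proof. by move=> df; rewrite !deriveE// linearD !linearZ. Qed.

Lemma dudv (R : realType) (th : R * R -> heis R) (u : R * R) (w : R * R) :
  differentiable th u -> 'D_w th u = w.1 *: du th u + w.2 *: dv th u.
Proof.
have E : w = w.1 *: ((1, 0) : R * R) + w.2 *: ((0, 1) : R * R).
  case: w => r s; congr (_, _); rewrite /= /GRing.scale /=; ring.
by move=> dth; rewrite {1}E (deriveDZ _ _ _ _ dth).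
Qed.

Lemma derive_expansive (R : realType) (V W W' : normedModType R) (U : set V)
    (f : V -> W) (g : V -> W') (u v : V) (C : R) :
  open U -> U u -> derivable f u v -> derivable g u v ->
  (forall u1 u2, U u1 -> U u2 -> `|f u1 - f u2| <= C * `|g u1 - g u2|) ->
  `|'D_v f u| <= C * `|'D_v g u|.
Proof.
move=> oU Uu df dg fg.
pose q (W : normedModType R) (f : V -> W) h := `|h^-1 *: (f (h *: v + u) - f u)|.
have cf : q W f h @[h --> (0 : R)^'] --> `|'D_v f u| by exact: cvg_norm.
have cg : C * q W' g h @[h --> (0 : R)^'] --> C * `|'D_v g u|.
  by apply: cvgMr; exact: cvg_norm.
apply: (ler_cvg_to cf cg).
have : \forall h \near (0 : R), U (h *: v + u).
  have c0 : h *: v + u @[h --> (0 : R)] --> (0 : R) *: v + u.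
    apply: cvgD; last exact: cvg_cst.
    by apply: cvgZr_tmp; exact: cvg_id.
  apply: c0; rewrite scale0r add0r; exact: open_nbhs_nbhs.
move=> /nbhs_dnbhs; apply: filterS => h Uh.
rewrite /q !normrZ mulrCA ler_wpM2l//; exact: fg.
Qed.

Lemma chart_sub (R : realType) (S : set (heis R)) U U' th :
  open U' -> U' `<=` U -> chart S U th -> chart S U' th.
Proof.
move=> oU' U'U [oU Cth inj ind homeo]; split; first exact: oU'.
- exact: Ck_subset Cth.
- by move=> u v /set_mem/U'U/mem_set Uu /set_mem/U'U/mem_set Uv; exact: inj.
- by move=> u /U'U; exact: ind.
- by move=> V oV VU'; apply: homeo => //; exact: subset_trans U'U.
Qed.

(** Expansivity makes [phi] injective, bounds each directional derivative of [th] by twice that of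
    [phi \o th], so that independence of the tangent vectors survives, and makes the inverse of
    [phi] Lipschitz, which yields relative openness. *)
Lemma chart_expansive (R : realType) (S : set (heis R)) (phi : heis R -> heis R) U th :
  (forall h1 h2, S h1 -> S h2 -> `|h1 - h2| <= 2 * `|phi h1 - phi h2|) ->
  chart S U th -> Ck 2 U (phi \o th) -> chart (phi @` S) U (phi \o th).
Proof.
move=> ex [oU Cth inj ind homeo] Cphi.
have thS u : U u -> S (th u).
  by move=> Uu; have [Q _ UQ] := homeo _ oU (@subset_refl _ U);
    have [] : (S `&` Q) (th u) by rewrite -UQ; exists u.
have dth u : U u -> differentiable th u by case: Cth => + _; exact.
have dphi u : U u -> differentiable (phi \o th) u by case: Cphi => + _; exact.
have phi_inj h1 h2 : S h1 -> S h2 -> phi h1 = phi h2 -> h1 = h2.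
  move=> S1 S2 E; have := (ex _ _ S1 S2).
  by rewrite E subrr normr0 mulr0 normr_le0 subr_eq0 => /eqP.
split; [exact: oU|exact: Cphi| | |].
- move=> u v Uu Vv /= E; apply: inj; [exact: Uu|exact: Vv|].
  by apply: phi_inj E; apply: thS; exact: set_mem.
- move=> u Uu r s E; apply: (ind u Uu).
  have D1 : 'D_(r, s) (phi \o th) u = 0 by rewrite (dudv _ (dphi _ Uu)).
  rewrite -[LHS](dudv (r, s) (dth _ Uu)); apply/normr0_eq0/le_anti.
  rewrite normr_ge0 andbT.
  have := derive_expansive (f := th) (g := phi \o th) (v := (r, s)) (C := 2) oU Uu
    (diff_derivable (v := (r, s)) (dth _ Uu)) (diff_derivable (v := (r, s)) (dphi _ Uu)).
  by rewrite D1 normr0 mulr0; apply => u1 u2 U1 U2; apply: ex; exact: thS.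
- move=> V oV VU; have [Q oQ VQ] := homeo V oV VU.
  pose good (g : heis R) (r : R) := [/\ S g, 0 < r & ball g r `<=` Q].
  (* If [phi g] is within [r / 2] of [phi g'], then [g] is within [r] of [g']; so halved balls
     around the image points catch no other points of the image surface. *)
  exists (\bigcup_(p in [set p : heis R * R | good p.1 p.2]) ball (phi p.1) (p.2 / 2)).
    by apply: bigcup_open => p [_ p0 _]; exact: ball_open.
  apply/seteqP; split=> [_ [v Vv <-]|_ [[g Sg <-] [[g' r] /= [Sg' r0 gQ] bg]]].
    have [Sv Qv] : (S `&` Q) (th v) by rewrite -VQ; exists v.
    split; first by exists (th v).
    have /nbhs_ballP[r /= r0 rQ] := open_nbhs_nbhs (conj oQ Qv).
    by exists (th v, r) => //=; apply: ballxx; rewrite divr_gt0.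
  have : (th @` V) g.
    rewrite VQ; split=> //; apply: gQ; move: bg; rewrite -!ball_normE/= => bg.
    by rewrite (le_lt_trans (ex _ _ Sg' Sg))// mulrC -ltr_pdivlMr.
  by move=> [v Vv <-]; exists v.
Qed.

(** * The deformation g + l X(g) *)

Section deformation.
Variable R : realType.
Implicit Types (S K : set (heis R)) (a b k : heis R -> R).

Definition flow (X : heis R -> heis R) (l : R) (g : heis R) : heis R :=
  g + l *: X g.

(** The Cartesian [t]-component of [vfield a b k], since the deformation adds vectors in R^3. *)
Definition vfield3 a b k (g : heis R) : R := k g + (b g * g.1.1 - a g * g.1.2) / 2.

Lemma flowE a b k l g : flow (vfield a b k) l g =
  (g.1.1 + l * a g, g.1.2 + l * b g, g.2 + l * vfield3 a b k g).
Proof. by case: g => -[x y] t; rewrite /flow vfieldE. Qed.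

Lemma Ck_fst (W W1 W2 : normedModType R) (U : set W) n (f : W -> W1 * W2) :
  open U -> Ck n U f -> Ck n U (fun u => (f u).1).
Proof.
move=> oU; apply: (Ck_linear (L := fst)) => //.
by move=> x; exact: cvg_fst.
Qed.

Lemma Ck_snd (W W1 W2 : normedModType R) (U : set W) n (f : W -> W1 * W2) :
  open U -> Ck n U f -> Ck n U (fun u => (f u).2).
Proof.
move=> oU; apply: (Ck_linear (L := snd)) => //.
by move=> x; exact: cvg_snd.
Qed.

Lemma Ck_fst1 (W : normedModType R) (U : set W) n (th : W -> heis R) :
  open U -> Ck n U th -> Ck n U (fun u => (th u).1.1).
Proof. by move=> oU Cth; apply: Ck_fst => //; exact: Ck_fst. Qed.

Lemma Ck_snd1 (W : normedModType R) (U : set W) n (th : W -> heis R) :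
  open U -> Ck n U th -> Ck n U (fun u => (th u).1.2).
Proof. by move=> oU Cth; apply: Ck_snd => //; exact: Ck_fst. Qed.

Lemma Ck_snd2 (W : normedModType R) (U : set W) n (th : W -> heis R) :
  open U -> Ck n U th -> Ck n U (fun u => (th u).2).
Proof. exact: Ck_snd. Qed.

Lemma CkZ (W : normedModType R) (U : set W) n (c : R) (f : W -> R) :
  open U -> Ck n U f -> Ck n U (fun u => c * f u).
Proof. by move=> oU; apply: CkM => //; exact: Ck_cst. Qed.

Lemma Ck_vfield3 (W : normedModType R) (U : set W) n (th : W -> heis R) a b k :
  open U -> Ck n U th -> Ck n U (a \o th) -> Ck n U (b \o th) ->
  Ck n U (k \o th) -> Ck n U (vfield3 a b k \o th).
Proof.
move=> oU Cth Ca Cb Ck.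
have C1 := CkM oU Cb (Ck_fst1 oU Cth).
have C2 := CkZ (-1) oU (CkM oU Ca (Ck_snd1 oU Cth)).
apply: Ck_eq (CkD oU Ck (CkZ (2^-1) oU (CkD oU C1 C2))) => // x Ux.
by rewrite /vfield3/=; ring.
Qed.

Lemma Ck_flow (W : normedModType R) (U : set W) n (th : W -> heis R) a b k l :
  open U -> Ck n U th -> Ck n U (a \o th) -> Ck n U (b \o th) ->
  Ck n U (k \o th) -> Ck n U (flow (vfield a b k) l \o th).
Proof.
move=> oU Cth Ca Cb Ck.
have C1 := CkD oU (Ck_fst1 oU Cth) (CkZ l oU Ca).
have C2 := CkD oU (Ck_snd1 oU Cth) (CkZ l oU Cb).
have C3 := CkD oU (Ck_snd2 oU Cth) (CkZ l oU (Ck_vfield3 oU Cth Ca Cb Ck)).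
apply: Ck_eq (Ck_pair oU (Ck_pair oU C1 C2) C3) => // x Ux.
by rewrite /= flowE.
Qed.

Lemma C1_vfield3 S a b k a' b' k' : C1_extension S a a' -> C1_extension S b b' ->
  C1_extension S k k' -> C1_extension S (vfield3 a b k) (vfield3 a' b' k').
Proof.
move=> [[A [oA SA CA]] Ea] [[B [oB SB CB]] Eb] [[C [oC SC CC]] Ek]; split.
  have oO : open (A `&` (B `&` C)) by apply: openI => //; exact: openI.
  exists (A `&` (B `&` C)); split => // [g Sg|].
    by split; [exact: SA|split; [exact: SB|exact: SC]].
  have Cid : Ck 1 (A `&` (B `&` C)) (id : heis R -> heis R).
    split=> [x _|v]; first by apply: ex_diff.
    rewrite (_ : 'D_v id = cst v); first exact: (@Ck_cst _ _ _ _ 0).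
    by apply/funext => x; rewrite derive_id.
  have Ca : Ck 1 (A `&` (B `&` C)) (a' \o id) by apply: Ck_subset CA => x [].
  have Cb : Ck 1 (A `&` (B `&` C)) (b' \o id) by apply: Ck_subset CB => x [_ []].
  have Cc : Ck 1 (A `&` (B `&` C)) (k' \o id) by apply: Ck_subset CC => x [_ []].
  exact: (Ck_vfield3 oO Cid Ca Cb Cc).
by move=> g Sg; rewrite /vfield3 Ea// Eb// Ek.
Qed.

Lemma C1_extension_lipschitz S K f f' :
  C1_extension S f f' -> compact K -> K `<=` S ->
  (forall g, S g -> ~ K g -> f g = 0) ->
  \forall C \near +oo, forall h1 h2, S h1 -> S h2 ->
    `|f h1 - f h2| <= C * `|h1 - h2|.
Proof.
move=> [[Q [oO SO CO]] Ef] cK KS f0; apply: (lipschitz_compact_support cK KS f0).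
move=> g Kg; have [r [C [r0 C0 H]]] := Ck1_lipschitz_near oO CO (SO _ (KS _ Kg)).
by exists r, C; split=> // h1 h2 S1 S2 b1 b2; rewrite -!Ef//; exact: H.
Qed.

(** The field is Lipschitz on [S] with some constant [C]. Once [|l| * C] is at most 1/2, the
    deformation changes the difference of two points by at most half its norm, whence the factor
    2. *)
Lemma flow_expansive S K a b k a' b' k' :
  C1_extension S a a' -> C1_extension S b b' -> C1_extension S k k' ->
  compact K -> K `<=` S ->
  (forall g, S g -> ~ K g -> [/\ a g = 0, b g = 0 & k g = 0]) ->
  \forall l \near (0 : R), forall h1 h2, S h1 -> S h2 ->
    `|h1 - h2| <= 2 * `|flow (vfield a b k) l h1 - flow (vfield a b k) l h2|.
Proof.
move=> ea eb ek cK KS abk0.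
have La := C1_extension_lipschitz ea cK KS (fun g Sg nK => let: And3 h _ _ := abk0 g Sg nK in h).
have Lb := C1_extension_lipschitz eb cK KS (fun g Sg nK => let: And3 _ h _ := abk0 g Sg nK in h).
have /(_ _)Lc := C1_extension_lipschitz (C1_vfield3 ea eb ek) cK KS.
have {}Lc := Lc ltac:(by move=> g Sg nK; rewrite /vfield3;
  have [-> -> ->] := abk0 g Sg nK; rewrite !mul0r subr0 mul0r addr0).
have [C [C0 HC]] : exists C : R, 0 < C /\ forall h1 h2, S h1 -> S h2 ->
    `|vfield a b k h1 - vfield a b k h2| <= C * `|h1 - h2|.
  have : \forall C \near +oo, forall h1 h2, S h1 -> S h2 ->
    `|vfield a b k h1 - vfield a b k h2| <= C * `|h1 - h2|.
    near=> C => h1 h2 S1 S2.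
    have vE g : vfield a b k g = (a g, b g, vfield3 a b k g).
      by case: g => -[x y] t; rewrite vfieldE.
    rewrite !vE norm_heis/= !ge_max -andbA; apply/and3P; split.
    - by move: h1 h2 S1 S2; near: C.
    - by move: h1 h2 S1 S2; near: C.
    - by move: h1 h2 S1 S2; near: C.
  by move=> /pinfty_ex_gt0[C C0 HC]; exists C.
have e0 : 0 < 2^-1 / C by rewrite divr_gt0// invr_gt0.
near=> l => h1 h2 S1 S2.
have lC : `|l| * C <= 2^-1.
  by rewrite -ler_pdivlMr//; near: l; exact: (@nbhs0_le _ R^o).
rewrite /flow opprD addrACA -scalerBr.
have := HC _ _ S1 S2; set X := _ - vfield _ _ _ _ => HX.
have H1 : `|h1 - h2| <= `|h1 - h2 + l *: X| + `|l *: X|.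
  by rewrite -{1}(addrK (l *: X) (h1 - h2)) ler_normB.
have H2 : `|l *: X| <= 2^-1 * `|h1 - h2|.
  rewrite normrZ (le_trans (ler_wpM2l _ HX))// mulrA.
  by rewrite ler_wpM2r.
lra.
Unshelve. all: by end_near. Qed.

End deformation.

(** * Integration through a parametrization *)

Section ge0_integral_transfer.
Local Open Scope ereal_scope.
Context d1 d2 (X : measurableType d1) (Y : measurableType d2) (R : realType).
Variables (mu : {measure set X -> \bar R}) (nu : {measure set Y -> \bar R}).
Variables (D : set X) (E : set Y) (phi : X -> Y) (w : X -> R).
Hypothesis mD : measurable D.
Hypothesis mE : measurable E.
Hypothesis mphi : measurable_fun D phi.
Hypothesis phiDE : phi @` D `<=` E.
Hypothesis mw : measurable_fun D w.
Hypothesis w0 : forall x, D x -> (0 <= w x)%R.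
Hypothesis muE : forall B, measurable B ->
  nu (E `&` B) = \int[mu]_(x in D `&` phi @^-1` B) (w x)%:E.

Import HBNNSimple.

(** By [muE], [nu] on [E] is the image under [phi] of the measure with density [w]. This is the
    formula for indicators; it extends to simple functions by linearity and to [f] by monotone
    convergence. *)
Lemma ge0_integral_transfer (f : Y -> \bar R) :
  measurable_fun E f -> (forall y, E y -> 0 <= f y) ->
  \int[nu]_(y in E) f y = \int[mu]_(x in D) (f (phi x) * (w x)%:E).
Proof.
move=> mf f0.
have DE x : D x -> E (phi x) by move=> Dx; apply: phiDE; exists x.
pose f_ := nnsfun_approx mE mf.
have mfphi n : measurable_fun D (f_ n \o phi) by apply: measurableT_comp.
transitivity (limn (fun n => \int[nu]_(x in E) (f_ n x)%:E)).
  rewrite -monotone_convergence//.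
  - apply: eq_integral => y /[!inE] yD; apply/esym/cvg_lim => //.
    exact: cvg_nnsfun_approx.
  - by move=> n; apply/measurable_EFinP; exact: measurable_funTS.
  - by move=> n y _; rewrite lee_fin.
  - by move=> y _ m n mn; rewrite lee_fin; exact/lefP/nd_nnsfun_approx.
rewrite [X in limn X](_ : _ =
    (fun n => \int[mu]_(x in D) ((f_ n (phi x))%:E * (w x)%:E))).
  have m1 n : measurable_fun D (fun x => (f_ n (phi x))%:E * (w x)%:E).
    apply: emeasurable_funM; first exact/measurable_EFinP/mfphi.
    exact/measurable_EFinP.
  have p1 n x : D x -> 0 <= (f_ n (phi x))%:E * (w x)%:E.
    by move=> Dx; rewrite mule_ge0 ?lee_fin ?w0.
  have nd x : D x ->
      nondecreasing_seq (fun n => (f_ n (phi x))%:E * (w x)%:E).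
    move=> Dx m n mn; apply: lee_wpmul2r; rewrite lee_fin ?w0//.
    exact/lefP/nd_nnsfun_approx.
  rewrite -(monotone_convergence mu mD m1 p1 nd).
  apply: eq_integral => x /[!inE] Dx /=; apply/cvg_lim => //.
  apply: cvgeZr => //.
  by apply: cvg_nnsfun_approx => //; exact: DE.
apply/funext => n.
transitivity (\sum_(k \in range (f_ n))
    \int[mu]_(x in D) ((k * \1_(f_ n @^-1` [set k]) (phi x))%:E * (w x)%:E)).
  under eq_integral do rewrite fimfunE -fsumEFin//.
  rewrite ge0_integral_fsum//; last 2 first.
  - move=> y; apply/measurable_EFinP; exact: measurable_funM.
  - by move=> y x _; rewrite nnfun_muleindic_ge0.
  apply: eq_fsbigr => r /[!inE] rf.
  rewrite integralZl_indic_nnsfun// integral_indic// setIC muE//.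
  rewrite integral_mkcondr.
  transitivity (\int[mu]_(x in D) (r%:E * ((\1_(f_ n @^-1` [set r]) (phi x))%:E * (w x)%:E))).
    rewrite ge0_integralZl_EFin//.
    - congr (_ * _); apply: eq_integral => x xD; rewrite patchE indicE.
      rewrite (_ : (x \in phi @^-1` (f_ n @^-1` [set r])) =
        (phi x \in f_ n @^-1` [set r])); last by apply/idP/idP => /[!inE].
      by case: ifPn => _; rewrite (mul1e, mul0e).
    - by move=> x Dx; rewrite mule_ge0 ?lee_fin ?w0.
    - apply: emeasurable_funM; apply/measurable_EFinP => //.
      by apply: measurableT_comp => //; exact: measurable_indic.
    - by case: rf => y _ <-; rewrite fun_ge0.
  by apply: eq_integral => x _; rewrite EFinM muleA.
rewrite -ge0_integral_fsum//.
- apply: eq_integral => x _; rewrite (fimfunE (f_ n) (phi x)) -fsumEFin//.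
  rewrite ge0_mule_fsuml// => k; exact: nnfun_muleindic_ge0.
- move=> r; apply: emeasurable_funM; apply/measurable_EFinP => //.
  apply: measurable_funM => //.
  by apply: measurableT_comp => //; exact: measurable_indic.
- by move=> r x Dx; rewrite mule_ge0 ?nnfun_muleindic_ge0// lee_fin w0.
Qed.

End ge0_integral_transfer.

(** * Measurability in charts *)

Lemma open_compact_nbhs2 (R : realType) (U : set (R * R)) (u : R * R) :
  open U -> U u -> exists B Q, [/\ open B, B u, compact Q, B `<=` Q & Q `<=` U].
Proof.
move=> oU Uu; have /nbhs_ballP[r /= r0 rU] := open_nbhs_nbhs (conj oU Uu).
have r20 : 0 < r / 2 by rewrite divr_gt0.
exists (ball u (r / 2)),
  (`[u.1 - r / 2, u.1 + r / 2]%classic `*` `[u.2 - r / 2, u.2 + r / 2]%classic).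
split.
- exact: ball_open.
- exact: ballxx.
- by apply: compact_setX; exact: segment_compact.
- move=> v; rewrite -ball_normE/= prod_normE gt_max => /andP[v1 v2].
  by split; rewrite /= in_itv/= -ler_distlC ltW.
- move=> v [] /=; rewrite !in_itv/= -!ler_distlC => v1 v2; apply: rU.
  rewrite -ball_normE/= prod_normE gt_max.
  by rewrite (le_lt_trans v1) ?(le_lt_trans v2)// ltr_pdivrMr// ltr_pMr// ltr1n.
Qed.

(** This serves to show that chart images of open sets are Borel: a chart maps each compact set to a
    compact set. *)
Lemma open_sigma_compact2 (R : realType) (U : set (R * R)) : open U ->
  exists Q : nat -> set (R * R), (forall n, compact (Q n)) /\ U = \bigcup_n Q n.
Proof.
move=> oU.
have /choice[BQ BQP] : forall u : R * R, exists bq : set (R * R) * set (R * R),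
    U u -> [/\ open bq.1, bq.1 u, compact bq.2, bq.1 `<=` bq.2 & bq.2 `<=` U].
  move=> u; have [Uu|nUu] := pselect (U u); last by exists (set0, set0).
  by have [B [Q H]] := open_compact_nbhs2 oU Uu; exists (B, Q).
have [] := @lindelof _ _ _ U (fun u => (BQ u).1) (@countable_basis2 R).
  by move=> u /BQP[].
move=> c [cU Uc].
exists (fun n => if c n is Some u then (BQ u).2 else set0); split.
  move=> n; case E : (c n) => [u|]; last exact: compact0.
  by have /BQP[] := cU _ _ E.
apply/seteqP; split=> [u /Uc[n [v [cv vu]]]|u [n _]].
  by exists n => //; rewrite cv; have /BQP[_ _ _ + _] := cU _ _ cv; exact.
by case E : (c n) => [v|//]; have /BQP[_ _ _ _ +] := cU _ _ E; exact.
Qed.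

Lemma continuous_measurable2 (R : realType) (U : set (R * R)) (f : R * R -> R) :
  open U -> (forall u, U u -> {for u, continuous f}) -> measurable_fun U f.
Proof.
move=> oU cf; move=> mU; apply: (measurability _ (RGenOpens.measurableE R)) => //.
move=> _ [_ [a [b ->] <-]]; apply: open_measurable2.
rewrite openE => u [Uu fu].
apply: filterI; first exact: open_nbhs_nbhs.
apply: cf => //.
by apply: open_nbhs_nbhs; split => //; exact: interval_open.
Qed.

Section chart_measurable.
Variables (R : realType) (S : set (heis R)) (U : set (R * R)) (th : R * R -> heis R).
Hypothesis hc : chart S U th.

Lemma chart_open : open U. Proof. by case: hc. Qed.

Lemma chart_differentiable u : U u -> differentiable th u.
Proof. by case: hc => _ [+ _] _ _ _; exact. Qed.

Lemma chart_continuous u : U u -> {for u, continuous th}.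
Proof. by move=> Uu; apply: differentiable_continuous; exact: chart_differentiable. Qed.

Lemma chart_in u : U u -> S (th u).
Proof.
move=> Uu; case: hc => oU _ _ _ /(_ _ oU (@subset_refl _ U))[Q _ UQ].
by have [] : (S `&` Q) (th u) by rewrite -UQ; exists u.
Qed.

Lemma chart_inj u v : U u -> U v -> th u = th v -> u = v.
Proof. by case: hc => _ _ inj _ _ Uu Uv; apply: inj; exact: mem_set. Qed.

Lemma chart_image_compact Q : Q `<=` U -> compact Q -> compact (th @` Q).
Proof.
move=> QU cQ; apply: continuous_compact => //.
apply: continuous_in_subspaceT => u /set_mem Qu.
by apply: chart_continuous; exact: QU.
Qed.

Lemma chart_image_measurable V : open V -> V `<=` U -> measurable (th @` V).
Proof.
move=> oV VU; have [Q [cQ VQ]] := open_sigma_compact2 oV.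
rewrite VQ image_bigcup; apply: bigcupT_measurable => n.
apply: compact_measurable3; apply: chart_image_compact => //.
by move=> u Qu; apply: VU; rewrite VQ; exists n.
Qed.

(** [f] is controlled through [f \o th]: within the chart image, the preimage of an open interval is
    the image of an open set of parameters, hence Borel. *)
Lemma chart_measurable_fun (f : heis R -> R) :
  (forall u, U u -> {for u, continuous (f \o th)}) -> measurable_fun (th @` U) f.
Proof.
move=> cf; move=> mU; apply: (measurability _ (RGenOpens.measurableE R)) => //.
move=> _ [_ [a [b ->] <-]].
rewrite (_ : _ `&` _ = th @` (U `&` (f \o th) @^-1` `]a, b[%classic)); last first.
  apply/seteqP; split=> [_ [[u Uu <-] fu]|_ [u [Uu fu] <-]]; first by exists u.
  by split=> //; exists u.
apply: chart_image_measurable => [|u []//].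
rewrite openE => u [Uu fu].
apply: filterI; first by apply: open_nbhs_nbhs; split=> //; exact: chart_open.
apply: cf => //.
by apply: open_nbhs_nbhs; split => //; exact: interval_open.
Qed.

Lemma chart_measurable : measurable_fun U th.
Proof.
have oU := chart_open; have mU := open_measurable2 oU.
have CU : Ck 0 U th by exact: chart_continuous.
have m1 := continuous_measurable2 oU (Ck_fst1 oU CU).
have m2 := continuous_measurable2 oU (Ck_snd1 oU CU).
have m3 := continuous_measurable2 oU (Ck_snd2 oU CU).
move: m1 m2 m3 => /(measurable_restrictT _ mU)m1 /(measurable_restrictT _ mU)m2.
move=> /(measurable_restrictT _ mU)m3.
have := measurable_fun_pair (measurable_fun_pair m1 m2) m3.
move=> /(measurable_funS measurableT (@subsetT _ U)); apply: eq_measurable_fun.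
by move=> u uU; rewrite !patchE uU; case: (th u) => -[].
Qed.

Lemma chart_preimage_measurable A : measurable A -> measurable (U `&` th @^-1` A).
Proof. by apply: chart_measurable; apply: open_measurable2; exact: chart_open. Qed.

End chart_measurable.

(** * Measurable atlas of a surface *)

Section surface.
Variables (R : realType) (S : set (heis R)).

Lemma chart_set0 : chart S set0 (cst 0 : R * R -> heis R).
Proof.
split; [exact: open0|by split=> [u []|v]; split=> [u []|w u []]|by move=> u v /set_mem|by []|].
move=> V _; rewrite subset0 => ->; exists set0; first exact: open0.
by rewrite image_set0 setI0.
Qed.

(** Each index pairs an open set of R^3 with a compact set of parameters whose image contains the
    part of [S] in it. Openness gives finite subcovers of the support; compactness gives bounds on
    the density and finite Lebesgue measure. *)
Record atlas := Atlas {
  adom : nat -> set (R * R);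
  apar : nat -> R * R -> heis R;
  aopen : nat -> set (heis R);
  acomp : nat -> set (R * R);
  achart : forall n, chart S (adom n) (apar n);
  aopenP : forall n, open (aopen n);
  acompP : forall n, compact (acomp n);
  acomp_sub : forall n, acomp n `<=` adom n;
  aopen_sub : forall n, S `&` aopen n `<=` apar n @` acomp n;
  acover : S `<=` \bigcup_n aopen n }.

(** Around each parameter there is an open set inside a compact subset of the chart domain. The
    chart maps the former to a relatively open set of [S], and countably many of these suffice by
    [lindelof]. *)
Lemma C2_surface_atlas : C2_surface S -> inhabited atlas.
Proof.
move=> hS.
pose good (g : heis R) (x : (set (R * R) * (R * R -> heis R)) * (set (heis R) * set (R * R))) :=
  [/\ chart S x.1.1 x.1.2, open x.2.1, compact x.2.2, x.2.2 `<=` x.1.1 &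
   S `&` x.2.1 `<=` x.1.2 @` x.2.2].
have /choice[f fP] : forall g : heis R, exists x, good g x /\ (S g -> x.2.1 g).
  move=> g; have [Sg|nSg] := pselect (S g); last first.
    exists (set0, cst 0, (set0, set0)); split=> [|//]; split;
      [exact: chart_set0|exact: open0|exact: compact0|by []|by rewrite /= setI0].
  have [U [th [cth [u Uu <-]]]] := hS g Sg.
  have [B [Q [oB Bu cQ BQ QU]]] := open_compact_nbhs2 (chart_open cth) Uu.
  have [_ _ _ _ /(_ B oB (subset_trans BQ QU))[P oP BP]] := cth.
  exists (U, th, (P, Q)); split; first split => //=.
    by rewrite -BP; exact: image_subset.
  by move=> _ /=; have [] : (S `&` P) (th u) by rewrite -BP; exists u.
have [] := @lindelof _ _ _ S (fun g => (f g).2.1) (@countable_basis3 R).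
  by move=> g Sg; have [[]] := fP g; move=> _ + _ _ _ /(_ Sg).
move=> c [cS Sc].
(* Indices to which no point is assigned get the empty chart. *)
pose x n := if c n is Some g then f g else (set0, cst 0, (set0, set0)).
have gx n : good 0 (x n).
  rewrite /x; case: (c n) => [g|]; first by have [[]] := fP g.
  by split; [exact: chart_set0|exact: open0|exact: compact0| |rewrite /= setI0].
apply: inhabits; apply: (@Atlas (fun n => (x n).1.1) (fun n => (x n).1.2)
  (fun n => (x n).2.1) (fun n => (x n).2.2)).
- by move=> n; have [] := gx n.
- by move=> n; have [] := gx n.
- by move=> n; have [] := gx n.
- by move=> n; have [] := gx n.
- by move=> n; have [] := gx n.
- by move=> g /Sc[n [h [ch hg]]]; exists n => //; rewrite /x ch.
Qed.

Lemma C2_surface_measurable : C2_surface S -> measurable S.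
Proof.
move=> /C2_surface_atlas[A].
rewrite (_ : S = \bigcup_n (apar A n @` adom A n)).
  apply: bigcupT_measurable => n; apply: (chart_image_measurable (achart A n)) => //.
  exact: chart_open (achart A n).
apply/seteqP; split=> [g Sg|_ [n _ [u Uu <-]]].
  have [n _ gn] := acover A Sg; exists n => //.
  have [u Qu <-] := aopen_sub (conj Sg gn).
  by exists u => //; exact: acomp_sub Qu.
exact: (chart_in (achart A n)).
Qed.

(** Disjointness turns an integral over [S] into a series, and each term lives in a single chart. *)
Definition piece (A : atlas) n : set (heis R) := S `&` seqDU (aopen A) n.

Lemma measurable_piece A n : C2_surface S -> measurable (piece A n).
Proof.
move=> hS; apply: measurableI; first exact: C2_surface_measurable.
apply: measurableD; first by apply: open_measurable3; exact: aopenP.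
by apply: bigsetU_measurable => i _; apply: open_measurable3; exact: aopenP.
Qed.

Lemma bigcup_piece A : \bigcup_n piece A n = S.
Proof.
rewrite /piece -setI_bigcupr -seqDU_bigcup_eq; apply/setIidl; exact: acover.
Qed.

Lemma trivIset_piece A : trivIset setT (piece A).
Proof. by apply: trivIset_setIl; exact: trivIset_seqDU. Qed.

Lemma piece_sub A n : piece A n `<=` apar A n @` acomp A n.
Proof. by move=> g [Sg [gn _]]; exact: aopen_sub. Qed.

(** Finitely many of the open sets cover [K], and a piece of larger index has all of these
    removed. *)
Lemma piece_compact A K : compact K -> K `<=` S ->
  exists n0, forall n, (n0 <= n)%N -> K `&` piece A n = set0.
Proof.
move=> cK KS; have /compact_near_coveringP/(_ nat \oo
  (fun n g => exists2 m, (m < n)%N & aopen A m g) _) := cK.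
case=> [g Kg|n0 _ Kn0].
  have [m _ gm] := acover A (KS _ Kg).
  exists (aopen A m, [set n | (m < n)%N]) => /=.
    by split; [apply: open_nbhs_nbhs; split=> //; exact: aopenP|exists m.+1].
  by move=> [h n] /= [hm mn]; exists m.
exists n0 => n n0n; apply/seteqP; split=> // g [Kg [Sg [gn ngn]]].
apply: ngn; have [m mn0 gm] := Kn0 _ (leqnn n0) _ Kg.
by rewrite -bigcup_mkord; exists m => //=; exact: leq_trans n0n.
Qed.

End surface.

(** * The H-perimeter density in a chart *)

Section jacobian.
Variable R : realType.

Definition horA (th : R * R -> heis R) (u : R * R) : R :=
  (du th u).1.2 * vert (th u) (dv th u) - vert (th u) (du th u) * (dv th u).1.2.
Definition horB (th : R * R -> heis R) (u : R * R) : R :=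
  vert (th u) (du th u) * (dv th u).1.1 - (du th u).1.1 * vert (th u) (dv th u).
Definition hor (th : R * R -> heis R) (u : R * R) : R :=
  Num.sqrt (horA th u ^+ 2 + horB th u ^+ 2).

Lemma nX1E (N : heis R -> heis R) g : nX1 N g = (N g).1.1.
Proof. by rewrite /nX1 /inner /X1 /vert/=; field. Qed.
Lemma nX2E (N : heis R -> heis R) g : nX2 N g = (N g).1.2.
Proof. by rewrite /nX2 /inner /X2 /vert/=; field. Qed.
Lemma nTE (N : heis R -> heis R) g : nT N g = vert g (N g).
Proof. by rewrite /nT /inner /T /vert/=; field. Qed.

Lemma inner_gt0 (g v : heis R) : v <> 0 -> 0 < inner g v v.
Proof.
move=> v0; have i0 : 0 <= inner g v v.
  by rewrite /inner -!expr2 !addr_ge0// sqr_ge0.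
rewrite lt_neqAle i0 andbT; apply/eqP => /esym/eqP; rewrite /inner -!expr2.
rewrite paddr_eq0 ?addr_ge0 ?sqr_ge0// paddr_eq0 ?sqr_ge0// !sqrf_eq0.
move=> /andP[/andP[/eqP a /eqP b]]; rewrite /vert a b !mulr0 subr0 mul0r addr0.
move=> /eqP c; apply: v0; move: v a b c {i0} => -[[x y] z] /= -> -> -> //.
Qed.

(** The vector n is parallel to the cross product c of v and w, which is used without division as
    [n1 * c3 = n3 * c1] and [n2 * c3 = n3 * c2]. The Gram determinant of v and w is |c|^2 by the
    identity of Lagrange. *)
Lemma cross_product_parallel (n1 n2 n3 v1 v2 v3 w1 w2 w3 : R) :
  n1 * v1 + n2 * v2 + n3 * v3 = 0 -> n1 * w1 + n2 * w2 + n3 * w3 = 0 ->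
  (n1 ^+ 2 + n2 ^+ 2) *
    ((v1 * v1 + v2 * v2 + v3 * v3) * (w1 * w1 + w2 * w2 + w3 * w3) -
     (v1 * w1 + v2 * w2 + v3 * w3) ^+ 2) =
  (n1 * n1 + n2 * n2 + n3 * n3) *
    ((v2 * w3 - v3 * w2) ^+ 2 + (v3 * w1 - v1 * w3) ^+ 2).
Proof.
move=> Hv Hw.
set c1 := v2 * w3 - v3 * w2; set c2 := v3 * w1 - v1 * w3.
pose c3 := v1 * w2 - v2 * w1.
have E1 : n1 * c3 = n3 * c1.
  apply/eqP; rewrite -subr_eq0; apply/eqP.
  transitivity (w2 * (n1 * v1 + n2 * v2 + n3 * v3) - v2 * (n1 * w1 + n2 * w2 + n3 * w3)).
    by rewrite /c3 /c1; ring.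
  by rewrite Hv Hw !mulr0 subrr.
have E2 : n2 * c3 = n3 * c2.
  apply/eqP; rewrite -subr_eq0; apply/eqP.
  transitivity (v1 * (n1 * w1 + n2 * w2 + n3 * w3) - w1 * (n1 * v1 + n2 * v2 + n3 * v3)).
    by rewrite /c3 /c2; ring.
  by rewrite Hv Hw !mulr0 subrr.
transitivity ((n1 ^+ 2 + n2 ^+ 2) * (c1 ^+ 2 + c2 ^+ 2) + ((n1 * c3) ^+ 2 + (n2 * c3) ^+ 2)).
  by rewrite /c1 /c2 /c3; ring.
by rewrite E1 E2; ring.
Qed.

(** The left side does not change when [N] is rescaled, so [N] may be thought of as the cross
    product of the coordinate tangent vectors, whose length is the area element. From here on the
    arbitrary normals of the deformed surfaces disappear from the formulas. *)
Lemma hor_density (N : heis R -> heis R) (th : R * R -> heis R) (u : R * R) :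
  N (th u) <> 0 -> inner (th u) (N (th u)) (du th u) = 0 ->
  inner (th u) (N (th u)) (dv th u) = 0 ->
  W N (th u) / rnorm (th u) (N (th u)) * area_element th u = hor th u.
Proof.
move=> N0 Nu Nv; rewrite /W nX1E nX2E /rnorm /area_element /hor.
have i0 := inner_gt0 (th u) N0.
rewrite -sqrtrV ?ltW// -!sqrtrM ?addr_ge0 ?sqr_ge0// ?mulr_ge0 ?addr_ge0 ?sqr_ge0 ?invr_ge0 ?ltW//.
congr Num.sqrt.
rewrite -mulrA mulrCA; apply: (canLR (mulKf _)); first exact: lt0r_neq0.
have E := cross_product_parallel Nu Nv.
rewrite /horA /horB /inner.
exact E.
Qed.

End jacobian.

Section measurability.
Variable R : realType.

Lemma Ck0_sqrt (U : set (R * R)) (f : R * R -> R) :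
  Ck 0 U f -> Ck 0 U (fun u => Num.sqrt (f u)).
Proof.
by move=> cf u Uu; apply: continuous_comp; [exact: cf|exact: sqrt_continuous].
Qed.

Lemma CkX2 (U : set (R * R)) n (f : R * R -> R) : open U ->
  Ck n U f -> Ck n U (fun u => f u ^+ 2).
Proof. by move=> oU Cf; apply: (Ck_eq oU _ (CkM oU Cf Cf)) => u Uu; rewrite expr2. Qed.

Lemma CkB (U : set (R * R)) n (f g : R * R -> R) : open U ->
  Ck n U f -> Ck n U g -> Ck n U (fun u => f u - g u).
Proof.
move=> oU Cf Cg; apply: (Ck_eq oU _ (CkD oU Cf (CkZ (-1) oU Cg))) => u Uu /=.
by rewrite mulN1r.
Qed.

Lemma Ck_vert (U : set (R * R)) n (th v : R * R -> heis R) : open U ->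
  Ck n U th -> Ck n U v -> Ck n U (fun u => vert (th u) (v u)).
Proof.
move=> oU Ct Cv.
have C1 := CkM oU (Ck_snd1 oU Ct) (Ck_fst1 oU Cv).
have C2 := CkM oU (Ck_fst1 oU Ct) (Ck_snd1 oU Cv).
apply: (Ck_eq oU _ (CkD oU (Ck_snd2 oU Cv) (CkZ 2^-1 oU (CkB oU C1 C2)))) => u Uu /=.
by rewrite mulrC.
Qed.

Lemma Ck_inner (U : set (R * R)) n (th v w : R * R -> heis R) : open U ->
  Ck n U th -> Ck n U v -> Ck n U w -> Ck n U (fun u => inner (th u) (v u) (w u)).
Proof.
move=> oU Ct Cv Cw.
have C1 := CkM oU (Ck_fst1 oU Cv) (Ck_fst1 oU Cw).
have C2 := CkM oU (Ck_snd1 oU Cv) (Ck_snd1 oU Cw).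
have C3 := CkM oU (Ck_vert oU Ct Cv) (Ck_vert oU Ct Cw).
exact: (CkD oU (CkD oU C1 C2) C3).
Qed.

Lemma Ck_du n (U : set (R * R)) (th : R * R -> heis R) : Ck n.+1 U th -> Ck n U (du th).
Proof. by case=> _ /(_ (1, 0)). Qed.

Lemma Ck_dv n (U : set (R * R)) (th : R * R -> heis R) : Ck n.+1 U th -> Ck n U (dv th).
Proof. by case=> _ /(_ (0, 1)). Qed.

Lemma Ck_horA n (U : set (R * R)) (th : R * R -> heis R) : open U ->
  Ck n.+1 U th -> Ck n U (horA th).
Proof.
move=> oU Cth; have Ct := CkW Cth; have Cu := Ck_du Cth; have Cv := Ck_dv Cth.
exact: (CkB oU (CkM oU (Ck_snd1 oU Cu) (Ck_vert oU Ct Cv))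
  (CkM oU (Ck_vert oU Ct Cu) (Ck_snd1 oU Cv))).
Qed.

Lemma Ck_horB n (U : set (R * R)) (th : R * R -> heis R) : open U ->
  Ck n.+1 U th -> Ck n U (horB th).
Proof.
move=> oU Cth; have Ct := CkW Cth; have Cu := Ck_du Cth; have Cv := Ck_dv Cth.
exact: (CkB oU (CkM oU (Ck_vert oU Ct Cu) (Ck_fst1 oU Cv))
  (CkM oU (Ck_fst1 oU Cu) (Ck_vert oU Ct Cv))).
Qed.

Lemma Ck0_hor (U : set (R * R)) (th : R * R -> heis R) : open U ->
  Ck 1 U th -> Ck 0 U (hor th).
Proof.
move=> oU Cth; apply: Ck0_sqrt.
exact: (CkD oU (CkX2 oU (Ck_horA oU Cth)) (CkX2 oU (Ck_horB oU Cth))).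
Qed.

Lemma Ck0_area_element (U : set (R * R)) (th : R * R -> heis R) : open U ->
  Ck 1 U th -> Ck 0 U (area_element th).
Proof.
move=> oU Cth; apply: Ck0_sqrt.
have Ct := CkW Cth; have Cu := Ck_du Cth; have Cv := Ck_dv Cth.
exact: (CkB oU (CkM oU (Ck_inner oU Ct Cu Cu) (Ck_inner oU Ct Cv Cv))
  (CkX2 oU (Ck_inner oU Ct Cu Cv))).
Qed.

End measurability.

(** * The measure sigma_H in a chart *)

Section normal_density.
Variables (R : realType) (S : set (heis R)) (N : heis R -> heis R).
Hypothesis hN : normal_field S N.

Definition hdensity (M : heis R -> heis R) (g : heis R) : R := W M g / rnorm g (M g).

Lemma hdensity_ge0 (M : heis R -> heis R) g : 0 <= hdensity M g.
Proof. by rewrite divr_ge0// sqrtr_ge0. Qed.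

Lemma normal_field_chart U th : chart S U th -> Ck 0 U (N \o th).
Proof.
move=> hc u Uu; case: hN => /subspace_continuousP cN _ _.
have Su := chart_in hc Uu.
move=> V /(cN _ Su) /= H.
have /= := chart_continuous hc Uu H.
apply: filterS2 (open_nbhs_nbhs (conj (chart_open hc) Uu)) => v Uv; apply.
exact: (chart_in hc).
Qed.

Lemma hdensity_chart U th : chart S U th -> Ck 0 U (hdensity N \o th).
Proof.
move=> hc; have oU := chart_open hc; have CN := normal_field_chart hc.
have Ct : Ck 0 U th by exact: (chart_continuous hc).
have CW : Ck 0 U (W N \o th).
  apply: (@Ck0_sqrt _ _ (fun u => nX1 N (th u) ^+ 2 + nX2 N (th u) ^+ 2)).
  apply: (Ck_eq oU _ (CkD oU (CkX2 oU (Ck_fst1 oU CN)) (CkX2 oU (Ck_snd1 oU CN)))) => u Uu /=.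
  by rewrite nX1E nX2E.
have Cr : Ck 0 U (fun u => rnorm (th u) (N (th u))).
  by apply: Ck0_sqrt; exact: (Ck_inner oU Ct CN CN).
have CV : Ck 0 U (fun u => (rnorm (th u) (N (th u)))^-1).
  move=> u Uu; apply: cvgV; last exact: Cr.
  rewrite sqrtr_eq0 -ltNge; apply: inner_gt0; case: hN => _ + _; apply.
  exact: (chart_in hc).
exact: (CkM oU CW CV).
Qed.

Lemma hdensity_chart_measurable U th : chart S U th ->
  measurable_fun (th @` U) (hdensity N).
Proof. by move=> hc; apply: (chart_measurable_fun hc); exact: hdensity_chart. Qed.

Lemma hdensity_measurable : C2_surface S -> measurable_fun S (hdensity N).
Proof.
move=> hS; have [A] := C2_surface_atlas hS.
rewrite -(bigcup_piece A); apply/measurable_fun_bigcup => n.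
  exact: measurable_piece.
apply: (@measurable_funS _ _ _ _ (apar A n @` adom A n)).
- apply: (chart_image_measurable (achart A n)) => //.
  exact: chart_open (achart A n).
- by move=> g /piece_sub[u Qu <-]; exists u => //; exact: acomp_sub Qu.
- exact: hdensity_chart_measurable (achart A n).
Qed.

Variable sigma : {measure set (heis R) -> \bar R}.
Hypothesis hsigma : riemannian_surface_measure S sigma.

(** The defining property of the surface measure is the hypothesis of [ge0_integral_transfer] with
    the area element as weight; [hor_density] then absorbs the normal. *)
Lemma chart_integral_H U th (B : set (heis R)) (f : heis R -> R) :
  chart S U th -> measurable B -> B `<=` th @` U ->
  measurable_fun B f -> (forall g, B g -> 0 <= f g) ->
  integral_H sigma N B f =
  (\int[(@lebesgue_measure R \x @lebesgue_measure R)%E]_(u in U `&` th @^-1` B)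
    (f (th u) * hor th u)%:E)%E.
Proof.
move=> hc mB BU mf f0; rewrite /integral_H.
have oU := chart_open hc.
have mU : measurable (th @` U) by exact: (chart_image_measurable hc).
have mD := chart_preimage_measurable hc mB.
have mh : measurable_fun B (hdensity N).
  exact: measurable_funS mU BU (hdensity_chart_measurable hc).
rewrite (@ge0_integral_transfer _ _ _ _ _
  (@lebesgue_measure R \x @lebesgue_measure R)%E sigma
  (U `&` th @^-1` B) B th (area_element th)) //.
- apply: eq_integral => u /[!inE] -[Uu Bu]; rewrite -EFinM; congr _%:E.
  rewrite -mulrA; congr (_ * _).
  case: hN => _ N0 /(_ U th hc u Uu)[Nu Nv].
  by apply: hor_density => //; apply: N0; exact: (chart_in hc).
- apply: measurable_funS (chart_measurable hc) => //; first exact: open_measurable2.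
- by move=> _ [u [Uu Bu] <-].
- apply: measurable_funS (continuous_measurable2 oU _) => //.
    exact: open_measurable2.
  case: hc => _ Cth _ _ _.
  exact: (Ck0_area_element oU (CkW Cth)).
- by move=> u _; exact: sqrtr_ge0.
- move=> C mC; rewrite setIC.
  have -> : C `&` B = (C `&` B) `&` th @` U.
    by rewrite -setIA; congr (_ `&` _); apply/esym/setIidl.
  case: hsigma => _ /(_ U th hc (C `&` B) (measurableI _ _ mC mB)) ->.
  by rewrite preimage_setI -setIA (setIC (th @^-1` B)).
- by apply/measurable_EFinP; exact: measurable_funM.
- by move=> g Bg; rewrite lee_fin mulr_ge0 ?f0//; exact: hdensity_ge0.
Qed.

End normal_density.

(** * Images of a surface under an expansive map *)

Section image_surface.
Variables (R : realType) (S : set (heis R)) (phi : heis R -> heis R).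
Hypothesis hS : C2_surface S.
Hypothesis ex_phi :
  forall h1 h2, S h1 -> S h2 -> `|h1 - h2| <= 2 * `|phi h1 - phi h2|.
Hypothesis C2_phi : forall U th, chart S U th -> Ck 2 U (phi \o th).

Lemma phi_inj h1 h2 : S h1 -> S h2 -> phi h1 = phi h2 -> h1 = h2.
Proof.
move=> S1 S2 E; have := ex_phi S1 S2.
by rewrite E subrr normr0 mulr0 normr_le0 subr_eq0 => /eqP.
Qed.

Lemma image_chart U th : chart S U th -> chart (phi @` S) U (phi \o th).
Proof. by move=> hc; apply: chart_expansive => //; exact: C2_phi. Qed.

Lemma image_C2_surface : C2_surface (phi @` S).
Proof.
move=> _ [g Sg <-]; have [U [th [hc [u Uu <-]]]] := hS Sg.
by exists U, (phi \o th); split; [exact: image_chart|exists u].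
Qed.

(** The image is the preimage of [B] under the inverse [G] of [phi]. In a transported chart the
    coordinates of [G] are those of the original chart, which are continuous, so [G] is Borel on the
    image surface. *)
Lemma image_measurable B : B `<=` S -> measurable B -> measurable (phi @` B).
Proof.
move=> BS mB.
have [A] := C2_surface_atlas hS.
have /choice[G GP] : forall h : heis R, exists g, (phi @` S) h -> S g /\ phi g = h.
  move=> h; have [[g Sg gh]|nh] := pselect ((phi @` S) h); first by exists g.
  by exists 0.
have Gphi g : S g -> G (phi g) = g.
  move=> Sg; have [|SG EG] := GP (phi g); first by exists g.
  exact: phi_inj.
have mS' := C2_surface_measurable image_C2_surface.
have mG (f : heis R -> R) : (forall U th, chart S U th -> Ck 0 U (f \o th)) ->
    measurable_fun (phi @` S) (f \o G).
  move=> Cf; have -> : phi @` S = \bigcup_n ((phi \o apar A n) @` adom A n).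
    apply/seteqP; split=> [_ [g Sg <-]|_ [n _ [u Uu <-]]].
      have [n _ gn] := acover A Sg; have [u Qu ug] := aopen_sub (conj Sg gn).
      by exists n => //; exists u; [exact: acomp_sub Qu|rewrite /= ug].
    by exists (apar A n u) => //; exact: (chart_in (achart A n)).
  apply/measurable_fun_bigcup => n; have hc := achart A n.
    apply: (chart_image_measurable (image_chart hc)) => //.
    exact: chart_open hc.
  apply: (chart_measurable_fun (image_chart hc)).
  apply: (Ck_eq (chart_open hc) _ (Cf _ _ hc)) => u Uu /=.
  by rewrite Gphi//; exact: (chart_in hc).
have C0 U th : chart S U th -> Ck 0 U th by move=> hc; exact: chart_continuous hc.
have m1 : measurable_fun (phi @` S) (fun h => (G h).1.1).
  by apply: (mG (fun g => g.1.1)) => U th hc; exact: Ck_fst1 (chart_open hc) (C0 _ _ hc).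
have m2 : measurable_fun (phi @` S) (fun h => (G h).1.2).
  by apply: (mG (fun g => g.1.2)) => U th hc; exact: Ck_snd1 (chart_open hc) (C0 _ _ hc).
have m3 : measurable_fun (phi @` S) (fun h => (G h).2).
  by apply: (mG (fun g => g.2)) => U th hc; exact: Ck_snd2 (chart_open hc) (C0 _ _ hc).
move: m1 m2 m3 => /(measurable_restrictT _ mS')m1 /(measurable_restrictT _ mS')m2.
move=> /(measurable_restrictT _ mS')m3.
have := measurable_fun_pair (measurable_fun_pair m1 m2) m3.
move=> /(_ measurableT B mB) mp; rewrite setTI in mp.
have := measurableI _ _ mS' mp.
congr measurable; apply/seteqP; split=> [h [hS' /=]|_ [g Bg <-]].
  rewrite !patchE mem_set//; have [Sg gh] := GP h hS'.
  by move=> Bg; exists (G h) => //; move: Bg; case: (G h) => -[].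
have Sg := BS _ Bg.
have hS' : (phi @` S) (phi g) by exists g.
split=> //=; rewrite !patchE mem_set// Gphi//.
by move: Bg; case: (g) => -[].
Qed.

Variables (N : heis R -> heis R) (sigma : {measure set (heis R) -> \bar R}).
Hypothesis hN : normal_field (phi @` S) N.
Hypothesis hsigma : riemannian_surface_measure (phi @` S) sigma.

Definition chart_piece (A : atlas S) (B : set (heis R)) n : set (R * R) :=
  adom A n `&` apar A n @^-1` (B `&` piece A n).

(** Injectivity of [phi] keeps the images of the pieces disjoint, and each lies in one transported
    chart with the same parameters as in the original one. *)
Lemma sigma_H_image A B : B `<=` S -> measurable B ->
  sigma_H sigma N (phi @` B) =
  (\sum_(0 <= n <oo) \int[(@lebesgue_measure R \x @lebesgue_measure R)%E]_(u in
     chart_piece A B n) (hor (phi \o apar A n) u)%:E)%E.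
Proof.
move=> BS mB.
have mBn n : measurable (B `&` piece A n) by apply: measurableI => //; exact: measurable_piece.
have BnS n : B `&` piece A n `<=` S by move=> g [/BS].
have EB : phi @` B = \bigcup_n (phi @` (B `&` piece A n)).
  by rewrite -image_bigcup -setI_bigcupr bigcup_piece setIidl.
rewrite /sigma_H /integral_H EB ge0_integral_bigcup.
- apply: eq_eseriesr => n _; have hc := achart A n.
  have Bsub : phi @` (B `&` piece A n) `<=` (phi \o apar A n) @` adom A n.
    move=> _ [g [_ /piece_sub[u Qu <-]] <-]; exists u => //; exact: acomp_sub Qu.
  have := @chart_integral_H _ _ _ hN _ hsigma _ _ (phi @` (B `&` piece A n)) (cst 1)
    (image_chart hc).
  rewrite /integral_H => ->//; last exact: image_measurable.
  rewrite (_ : adom A n `&` _ = chart_piece A B n).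
    by apply: eq_integral => u _; rewrite mul1r.
  apply/seteqP; split=> u [Uu] /=; last by move=> H; split=> //; exists (apar A n u).
  move=> [g [Bg gn] gu]; split=> //=.
  rewrite -(phi_inj _ _ gu)//; first exact: BS.
  exact: (chart_in hc).
- by move=> n; exact: image_measurable.
- rewrite -EB; apply: (@measurable_funS _ _ _ _ (phi @` S)).
  + exact: C2_surface_measurable image_C2_surface.
  + exact: image_subset.
  + apply/measurable_EFinP; apply: measurable_funM => //.
    exact: hdensity_measurable image_C2_surface.
- by move=> g _; rewrite lee_fin mul1r; exact: hdensity_ge0.
- apply/trivIsetP => i j _ _ ij; apply/seteqP; split=> // h [[g [Bg gi] <-] [g' [Bg' gj] E]].
  have gg' : g' = g by apply: phi_inj => //; exact: BS.
  move/trivIsetP : (@trivIset_piece _ _ A) => /(_ i j I I ij)/seteqP[+ _].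
  by move=> /(_ g); apply; split=> //; rewrite -gg'.
Qed.

End image_surface.

(** * Second derivative of the integral of the square root of a polynomial *)

Section derive_under_integral_twice.
Context {R : realType} d {Y : measurableType d} {mu : {measure set Y -> \bar R}}.
Variables (D : set Y) (h h1 : R -> Y -> R) (e M : R).
Hypothesis mD : measurable D.
Hypothesis muD : (mu D < +oo)%E.
Hypothesis M0 : 0 <= M.
Hypothesis dh : forall (l : R) y, `|l| < e -> D y -> is_derive l 1 (h ^~ y) (h1 l y).
Hypothesis mh : forall l, `|l| < e -> measurable_fun D (h l).
Hypothesis hM : forall l y, `|l| < e -> D y -> `|h l y| <= M.
Hypothesis h1M : forall l y, `|l| < e -> D y -> `|h1 l y| <= M.

Lemma bounded_integrable (f : Y -> R) : measurable_fun D f ->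
  (forall y, D y -> `|f y| <= M) -> mu.-integrable D (EFin \o f).
Proof.
move=> mf fM; apply: measurable_bounded_integrable => //.
exists M; split; first exact: num_real.
by move=> x Mx y Dy; apply: (le_trans (fM _ Dy)); exact: ltW.
Qed.

(** The constant [M] dominates, being integrable on a set of finite measure. The pair [h], [h1] is
    kept general because the lemma is used for the square root and again for its first
    derivative. *)
Lemma is_derive_under_integral (l : R) : `|l| < e ->
  is_derive l 1 (fun l : R => (\int[mu]_(y in D) h l y)%R) (\int[mu]_(y in D) h1 l y)%R.
Proof.
move=> le.
have il : `]-e, e[%classic l by rewrite /= in_itv/= -ltr_norml.
have I_e x : `]-e, e[%classic x -> `|x| < e by rewrite /= in_itv/= -ltr_norml.
have intf x : `]-e, e[%classic x -> mu.-integrable D (EFin \o h x).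
  by move=> /I_e xe; apply: bounded_integrable; [exact: mh|move=> y; exact: hM].
have df x y : `]-e, e[%classic x -> D y -> derivable (h ^~ y) x 1.
  by move=> /I_e xe Dy; have [] := dh xe Dy.
have E x y : `|x| < e -> D y -> partial1of2 h x y = h1 x y.
  by move=> xe Dy; rewrite partial1of2E; have [_] := dh xe Dy.
have intG : mu.-integrable D (EFin \o (cst M : Y -> R)).
  apply: bounded_integrable; first exact: measurable_cst.
  by move=> y _; rewrite ger0_norm.
have G x y : `]-e, e[%classic x -> D y -> `|partial1of2 h x y| <= cst M y.
  by move=> /I_e xe Dy; rewrite E//; exact: h1M.
split.
  exact: (derivable_under_integral mD il intf df (fun=> M0) intG G).
rewrite -derive1E (differentiation_under_integral mD il intf df (fun=> M0) intG G).
by apply: eq_Rintegral => y /[!inE] Dy; exact: E.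
Qed.

End derive_under_integral_twice.

Section polynomial_bounds.
Variable R : realType.

Lemma horner_bound (p : {poly R}) n M l : (size p <= n)%N ->
  (forall i, `|p`_i| <= M) -> `|l| <= 1 -> `|p.[l]| <= n%:R * M.
Proof.
move=> pn pM l1; rewrite (horner_coef_wide _ pn).
rewrite (le_trans (ler_norm_sum _ _ _))//.
rewrite mulr_natl -[in leRHS](card_ord n) -sumr_const ler_sum// => i _.
rewrite normrM normrX -[M]mulr1 ler_pM//.
by rewrite exprn_ile1.
Qed.

(** For [|l| <= 1] each of the [n] terms after the constant one is at most [|l| * M] in absolute
    value. *)
Lemma horner_lower_bound (p : {poly R}) n M c l : (size p <= n.+1)%N ->
  (forall i, `|p`_i| <= M) -> c <= p`_0 -> `|l| <= 1 ->
  c - `|l| * (n%:R * M) <= p.[l].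
Proof.
move=> pn pM pc l1; rewrite (horner_coef_wide _ pn) big_ord_recl expr0 mulr1.
suff : `|\sum_(i < n) p`_(bump 0 i) * l ^+ (bump 0 i)| <= `|l| * (n%:R * M).
  by rewrite ler_norml => /andP[+ _]; move: pc; lra.
rewrite (le_trans (ler_norm_sum _ _ _))//.
rewrite mulr_natl -[in leRHS](card_ord n) -sumr_const mulr_sumr.
rewrite ler_sum// => i _.
rewrite normrM normrX /bump/= add1n exprS mulrCA ler_wpM2l//.
rewrite -[M]mulr1 ler_pM//.
by rewrite exprn_ile1.
Qed.

End polynomial_bounds.

Section sqrt_poly.
Context {R : realType} d {Y : measurableType d} {mu : {measure set Y -> \bar R}}.
Variables (D : set Y) (P : Y -> {poly R}) (n : nat) (M c : R).
Hypothesis mD : measurable D.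
Hypothesis muD : (mu D < +oo)%E.
Hypothesis c0 : 0 < c.
Hypothesis sP : forall y, (size (P y) <= n.+1)%N.
Hypothesis mP : forall i, measurable_fun D (fun y => (P y)`_i).
Hypothesis PM : forall i y, D y -> `|(P y)`_i| <= M.
Hypothesis Pc : forall y, D y -> c <= (P y)`_0.

(** The second derivative at 0 of the root of P: P'' / (2 sqrt P) - P'^2 / (4 P sqrt P), where
    P''(0) is twice the coefficient of index 2. *)
Definition sqrt_poly_deriv2 (y : Y) : R :=
  (P y)`_2 / Num.sqrt (P y)`_0 - (P y)`_1 ^+ 2 / (4 * (P y)`_0 * Num.sqrt (P y)`_0).

Lemma measurable_horner (Q : Y -> {poly R}) m l : (forall y, (size (Q y) <= m)%N) ->
  (forall i, measurable_fun D (fun y => (Q y)`_i)) -> measurable_fun D (fun y => (Q y).[l]).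
Proof.
move=> sQ mQ.
rewrite (_ : (fun y => _) = (fun y => \sum_(i < m) (Q y)`_i * l ^+ i)); last first.
  by apply/funext => y; rewrite (horner_coef_wide _ (sQ y)).
by apply: measurable_sum => i; apply: measurable_funM.
Qed.

Lemma is_derive_horner (p : {poly R}) (x : R) : is_derive x 1 (horner p) p^`().[x].
Proof. by split; [exact: derivable_horner|rewrite -derive1E -derivE]. Qed.

Let s l y := Num.sqrt (P y).[l].
Let s1 l y := (P y)^`().[l] * (2 * Num.sqrt (P y).[l])^-1.
Let s2 l y := (P y)^`()^`().[l] / (2 * Num.sqrt (P y).[l]) -
  (P y)^`().[l] ^+ 2 / (4 * (P y).[l] * Num.sqrt (P y).[l]).

Lemma is_derive_s (l : R) y : 0 < (P y).[l] -> is_derive l 1 (s ^~ y) (s1 l y).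
Proof.
move=> p0; rewrite /s1 mulrC.
exact: (is_derive1_comp (is_derive1_sqrt p0) (is_derive_horner (P y) l)).
Qed.

Lemma is_derive_s1 (l : R) y : 0 < (P y).[l] -> is_derive l 1 (s1 ^~ y) (s2 l y).
Proof.
move=> p0.
have q0 : Num.sqrt (P y).[l] != 0 by rewrite gt_eqF// sqrtr_gt0.
have H1 := is_derive_horner (P y)^`() l.
have H2 : is_derive l 1 (fun l : R => 2 * Num.sqrt (P y).[l]) (2 * s1 l y).
  have := is_derive_s p0 => H.
  by have := is_deriveZ 2 H.
have q20 : 2 * Num.sqrt (P y).[l] != 0 by rewrite mulf_neq0.
have H3 := is_deriveM H1 (is_deriveV (f := fun l : R => 2 * Num.sqrt (P y).[l]) q20 H2).
apply: (is_derive_eq H3); rewrite /s2 /s1 /GRing.scale/=.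
have := sqr_sqrtr (ltW p0); move: q0 {H1 H2 H3 q20}.
move: (Num.sqrt _) => q q0 <-.
by field.
Qed.

Lemma measurable_invr_gt0 (f : Y -> R) : measurable_fun D f ->
  (forall y, D y -> 0 < f y) -> measurable_fun D (fun y => (f y)^-1).
Proof.
move=> mf f0.
have mV : measurable_fun (`]0, +oo[%classic : set R) (fun x : R => x^-1).
  apply: open_continuous_measurable_fun; first exact: interval_open.
  by move=> x; rewrite inE/= in_itv/= andbT => x0; apply: inv_continuous; rewrite gt_eqF.
apply: (measurable_comp _ _ mV mf) => //.
by move=> _ [y Dy <-]; rewrite /= in_itv/= andbT; exact: f0.
Qed.

Lemma size_deriv_le (p : {poly R}) m : (size p <= m)%N -> (size p^`() <= m)%N.
Proof.
move=> pm; have [->|p0] := eqVneq p 0; first by rewrite derivC size_poly0.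
exact: leq_trans (ltnW (lt_size_deriv p0)) pm.
Qed.

Lemma coef_deriv_bound (p : {poly R}) m B i : (size p <= m)%N -> 0 <= B ->
  (forall i, `|p`_i| <= B) -> `|p^`()`_i| <= m%:R * B.
Proof.
move=> pm B0 pB; rewrite coef_deriv.
have [im|mi] := ltnP i.+1 m; last first.
  by rewrite nth_default ?(leq_trans pm)// mul0rn normr0 mulr_ge0.
rewrite normrMn -[leLHS]mulr_natl ler_pM// ler_nat; exact: ltnW.
Qed.

Hypothesis M0 : 0 <= M.

Let F (l : R) := (\int[mu]_(y in D) Num.sqrt (P y).[l])%R.

(** For small [l] all the polynomials stay above [c / 2], so the root and its first two derivatives
    are bounded uniformly in [y], and [is_derive_under_integral] applies twice. *)
Lemma sqrt_poly_integral : exists2 e : R, 0 < e &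
  [/\ forall l : R, `|l| < e -> mu.-integrable D (fun y => (Num.sqrt (P y).[l])%:E),
      mu.-integrable D (fun y => (sqrt_poly_deriv2 y)%:E),
      forall l : R, `|l| < e -> derivable F l 1,
      derivable (derive1 F) 0 1 &
      derive1 (derive1 F) 0 = (\int[mu]_(y in D) sqrt_poly_deriv2 y)%R].
Proof.
set K : R := n.+1%:R.
have K0 : 0 <= K by [].
(* [B0] bounds the values of [P y] and the coefficients of its derivative, [B1] the values of that
   derivative and the coefficients of the second one, [B2] the values of the second one. *)
set B0 := K * M; set B1 := K * B0; set B2 := K * B1.
have B00 : 0 <= B0 by rewrite mulr_ge0.
have B10 : 0 <= B1 by rewrite mulr_ge0.
have B20 : 0 <= B2 by rewrite mulr_ge0.
(* For [|l| < e] the nonconstant terms take away at most [c / 2]; the added 1 keeps the denominator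
   positive. *)
pose e := Num.min 1 (c / 2 / (n%:R * M + 1)).
have nM0 : 0 < n%:R * M + 1 by rewrite ltr_wpDl// mulr_ge0.
have e0 : 0 < e by rewrite lt_min ltr01/= !divr_gt0.
have e1 (l : R) : `|l| < e -> `|l| <= 1 by rewrite lt_min => /andP[/ltW].
have Pl (l : R) y : `|l| < e -> D y -> c / 2 <= (P y).[l].
  move=> le Dy; have H := horner_lower_bound (sP y) (fun i => PM i Dy) (Pc Dy) (e1 _ le).
  apply: le_trans H.
  have : `|l| * (n%:R * M + 1) <= c / 2.
    by rewrite -ler_pdivlMr//; move: le; rewrite lt_min => /andP[_ /ltW].
  have := normr_ge0 l; lra.
have Pl0 (l : R) y : `|l| < e -> D y -> 0 < (P y).[l].
  by move=> le Dy; apply: lt_le_trans (Pl _ _ le Dy); rewrite divr_gt0.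
set q := Num.sqrt (c / 2).
have q0 : 0 < q by rewrite sqrtr_gt0 divr_gt0.
have ql (l : R) y : `|l| < e -> D y -> q <= Num.sqrt (P y).[l].
  by move=> le Dy; rewrite ler_wsqrtr// Pl.
have qlV (l : R) y : `|l| < e -> D y -> (Num.sqrt (P y).[l])^-1 <= q^-1.
  by move=> le Dy; rewrite lef_pV2 ?ql// posrE ?sqrtr_gt0 ?Pl0.
have b0 (l : R) y : `|l| < e -> D y -> `|(P y).[l]| <= B0.
  by move=> le Dy; apply: horner_bound => //; [by move=> i; exact: PM|exact: e1].
have c1 y i : D y -> `|(P y)^`()`_i| <= B0.
  by move=> Dy; apply: coef_deriv_bound => // j; exact: PM.
have b1 (l : R) y : `|l| < e -> D y -> `|(P y)^`().[l]| <= B1.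
  move=> le Dy; apply: horner_bound; [exact: size_deriv_le|by move=> i; exact: c1|exact: e1].
have c2 y i : D y -> `|(P y)^`()^`()`_i| <= B1.
  by move=> Dy; apply: coef_deriv_bound => //; [exact: size_deriv_le|move=> j; exact: c1].
have b2 (l : R) y : `|l| < e -> D y -> `|(P y)^`()^`().[l]| <= B2.
  move=> le Dy; apply: horner_bound; [|by move=> i; exact: c2|exact: e1].
  exact/size_deriv_le/size_deriv_le.
(* One bound for [s], [s1] and [s2] together. The root is bounded as P / sqrt P, and [2 * c] is the
   lower bound for [4 * (P y).[l]]. *)
pose Mx := B0 * q^-1 + B1 * q^-1 + (B2 * q^-1 + B1 ^+ 2 * (2 * c)^-1 * q^-1).
have qV0 : 0 <= q^-1 by rewrite invr_ge0 ltW.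
have Mx0 : 0 <= Mx by rewrite !addr_ge0// ?mulr_ge0 ?sqr_ge0// invr_ge0 mulr_ge0// ltW.
have aV (a A v : R) : `|a| <= A -> 0 <= v <= q^-1 -> `|a * v| <= A * q^-1.
  move=> aA /andP[v0 vq]; rewrite normrM ler_pM//.
  by rewrite ger0_norm.
have sV (l : R) y : `|l| < e -> D y -> 0 <= (Num.sqrt (P y).[l])^-1 <= q^-1.
  by move=> le Dy; rewrite qlV// invr_ge0 sqrtr_ge0.
have sV2 (l : R) y : `|l| < e -> D y -> 0 <= (2 * Num.sqrt (P y).[l])^-1 <= q^-1.
  move=> le Dy; have /andP[v0 vq] := sV _ _ le Dy.
  rewrite invfM mulr_ge0//= (le_trans _ vq)// ler_piMl// invf_le1//.
  by rewrite ler1n.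
have X0 : 0 <= B0 * q^-1 by rewrite mulr_ge0.
have X1 : 0 <= B1 * q^-1 by rewrite mulr_ge0.
have X2 : 0 <= B2 * q^-1 by rewrite mulr_ge0.
have X3 : 0 <= B1 ^+ 2 * (2 * c)^-1 * q^-1.
  by rewrite !mulr_ge0// ?sqr_ge0// invr_ge0 mulr_ge0// ltW.
have sM (l : R) y : `|l| < e -> D y -> `|s l y| <= Mx.
  move=> le Dy; apply: (@le_trans _ _ (B0 * q^-1)); last by rewrite /Mx; lra.
  have -> : s l y = (P y).[l] * (Num.sqrt (P y).[l])^-1.
    rewrite -[X in X * _](sqr_sqrtr (ltW (Pl0 _ _ le Dy))) expr2 mulfK//.
    by rewrite gt_eqF// sqrtr_gt0 Pl0.
  exact: aV (b0 _ _ le Dy) (sV _ _ le Dy).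
have s1M (l : R) y : `|l| < e -> D y -> `|s1 l y| <= Mx.
  move=> le Dy; apply: (@le_trans _ _ (B1 * q^-1)); last by rewrite /Mx; lra.
  exact: aV (b1 _ _ le Dy) (sV2 _ _ le Dy).
have s2M (l : R) y : `|l| < e -> D y -> `|s2 l y| <= Mx.
  move=> le Dy; rewrite (le_trans (ler_normB _ _))//.
  have H1 := aV _ _ _ (b2 _ _ le Dy) (sV2 _ _ le Dy).
  have H2 : `|(P y)^`().[l] ^+ 2 / (4 * (P y).[l] * Num.sqrt (P y).[l])| <=
      B1 ^+ 2 * (2 * c)^-1 * q^-1.
    rewrite invfM mulrA; apply: aV (sV _ _ le Dy).
    rewrite normrM normrX ler_pM//; first by rewrite lerXn2r ?nnegrE// b1.
    have p40 : 0 < 4 * (P y).[l] by rewrite mulr_gt0// Pl0.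
    rewrite ger0_norm; last by rewrite invr_ge0 ltW.
    rewrite lef_pV2 ?posrE ?mulr_gt0// ?(Pl0 _ _ le Dy)//.
    by have := Pl _ _ le Dy; lra.
  by rewrite /Mx; lra.
have ms (l : R) : `|l| < e -> measurable_fun D (s l).
  move=> le; apply: (measurableT_comp (f := @Num.sqrt R)); last exact: measurable_horner sP mP.
  by apply: continuous_measurable_fun; exact: sqrt_continuous.
have msV (l : R) : `|l| < e -> measurable_fun D (fun y => (Num.sqrt (P y).[l])^-1).
  move=> le; apply: measurable_invr_gt0; first exact: ms.
  by move=> y Dy; rewrite sqrtr_gt0 Pl0.
have mP1 i : measurable_fun D (fun y => (P y)^`()`_i).
  under eq_fun do rewrite coef_deriv -mulr_natr.
  by apply: measurable_funM.
have ms1 (l : R) : `|l| < e -> measurable_fun D (s1 l).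
  move=> le; apply: measurable_funM.
    by apply: measurable_horner mP1 => y; exact: size_deriv_le.
  under eq_fun do rewrite invfM; apply: measurable_funM => //; exact: msV.
have ms2 : measurable_fun D sqrt_poly_deriv2.
  have le : `|0 : R| < e by rewrite normr0.
  have m0 : measurable_fun D (fun y => (Num.sqrt (P y)`_0)^-1).
    by have := msV _ le; under eq_fun do rewrite horner_coef0.
  apply: measurable_funB; first exact: measurable_funM.
  apply: measurable_funM; first exact: measurable_funX.
  under eq_fun do rewrite invfM; apply: measurable_funM => //.
  apply: measurable_invr_gt0; first exact: measurable_funM.
  by move=> y Dy; rewrite mulr_gt0// (lt_le_trans c0)// Pc.
have s20 y : D y -> s2 0 y = sqrt_poly_deriv2 y.
  move=> Dy; rewrite /s2 /sqrt_poly_deriv2 !horner_coef0 !coef_deriv.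
  have p0 : 0 < (P y)`_0 by rewrite (lt_le_trans c0)// Pc.
  have r0 : 0 < Num.sqrt (P y)`_0 by rewrite sqrtr_gt0.
  by field; rewrite ?gt_eqF.
have dF (l : R) : `|l| < e -> is_derive l 1 F (\int[mu]_(y in D) s1 l y)%R.
  move=> le; apply: (is_derive_under_integral mD muD Mx0 _ ms sM s1M le) => x y xe Dy.
  exact/is_derive_s/Pl0.
have dF1 : is_derive (0 : R) 1 (fun l => \int[mu]_(y in D) s1 l y)%R
    (\int[mu]_(y in D) s2 0 y)%R.
  have le : `|0 : R| < e by rewrite normr0.
  apply: (is_derive_under_integral mD muD Mx0 _ ms1 s1M s2M le) => x y xe Dy.
  exact/is_derive_s1/Pl0.
(* To differentiate [derive1 F] at 0 its formula is needed in a whole neighbourhood. *)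
have near1 : \forall l \near (0 : R), (\int[mu]_(y in D) s1 l y)%R = derive1 F l.
  have : \forall l \near (0 : R), `|l| < e by exact: (@nbhs0_lt _ R^o).
  apply: filterS => l le; rewrite derive1E.
  by have [_ ->] := dF l le.
have dF1' := near_eq_is_derive near1 dF1.
exists e => //; split.
- by move=> l le; apply: (bounded_integrable mD muD (ms _ le)) => y; exact: sM.
- apply: (bounded_integrable mD muD ms2) => y Dy; rewrite -s20//.
  by apply: s2M => //; rewrite normr0.
- by move=> l le; have [] := dF l le.
- by have [] := dF1'.
- rewrite derive1E; have [_ ->] := dF1'.
  by apply: eq_Rintegral => y /[!inE]; exact: s20.
Qed.

End sqrt_poly.

(** * The density along the deformation *)

Section flow_coefficients.
Variable R : realType.

(** Coefficients of the powers of l in the first component of the cross product of two vectors of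
    the form (x + l a, y + l b, V + l m + l^2 n), with suffixes u and v for the two vectors;
    [cross_coefB] is the second component. *)
Definition cross_coefA (xu yu Vu au bu mu nu xv yv Vv av bv mv nv : R) : seq R :=
  [:: yu * Vv - Vu * yv;
      yu * mv + bu * Vv - Vu * bv - mu * yv;
      yu * nv + bu * mv - mu * bv - nu * yv;
      bu * nv - nu * bv].

Definition cross_coefB (xu yu Vu au bu mu nu xv yv Vv av bv mv nv : R) : seq R :=
  [:: Vu * xv - xu * Vv;
      Vu * av + mu * xv - xu * mv - au * Vv;
      mu * av + nu * xv - xu * nv - au * mv;
      nu * av - au * nv].

(** The square of a polynomial of degree at most 3, listed explicitly so that single coefficients
    compute. *)
Definition sq_coef (s : seq R) : seq R :=
  [:: s`_0 ^+ 2; 2 * s`_0 * s`_1; s`_1 ^+ 2 + 2 * s`_0 * s`_2;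
      2 * (s`_0 * s`_3 + s`_1 * s`_2); s`_2 ^+ 2 + 2 * s`_1 * s`_3;
      2 * s`_2 * s`_3; s`_3 ^+ 2].

Definition sumsq_poly (s t : seq R) : {poly R} :=
  Poly [seq x.1 + x.2 | x <- zip (sq_coef s) (sq_coef t)].

Lemma horner_sumsq_poly (s t : seq R) l : (sumsq_poly s t).[l] =
  (s`_0 + l * s`_1 + l ^+ 2 * s`_2 + l ^+ 3 * s`_3) ^+ 2 +
  (t`_0 + l * t`_1 + l ^+ 2 * t`_2 + l ^+ 3 * t`_3) ^+ 2.
Proof. by rewrite /sumsq_poly horner_Poly /=; ring. Qed.

Lemma coef_sumsq_poly (s t : seq R) i :
  (sumsq_poly s t)`_i = (sq_coef s)`_i + (sq_coef t)`_i.
Proof.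
rewrite /sumsq_poly coef_Poly.
by do 7 (case: i => [|i]; first by []); rewrite /= !nth_nil addr0.
Qed.

Lemma size_sumsq_poly (s t : seq R) : (size (sumsq_poly s t) <= 7)%N.
Proof. exact: leq_trans (size_Poly _) _. Qed.

(** The two tangent vectors are Z = (q, -p, 0) and T - w Y = (-w p, -w q, 1) in the frame [X1],
    [X2], [T], and [Ta], [Tb], [Tk] stand for derivatives along the second. As the constant
    coefficient is p^2 + q^2 = 1, the left side is the second derivative of the root at 0. *)
Lemma second_variation_identity (p q w a b Za Zb Zk Ta Tb Tk : R) :
  p ^+ 2 + q ^+ 2 = 1 ->
  let mu := Zk + b * q - a * - p in let nu := (b * Za - a * Zb) / 2 in
  let mv := Tk + b * (- w * p) - a * (- w * q) in
  let nv := (b * Ta - a * Tb) / 2 in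
  let s := cross_coefA q (- p) 0 Za Zb mu nu (- w * p) (- w * q) 1 Ta Tb mv nv in
  let t := cross_coefB q (- p) 0 Za Zb mu nu (- w * p) (- w * q) 1 Ta Tb mv nv in
  (sumsq_poly s t)`_2 - (sumsq_poly s t)`_1 ^+ 2 / 4 =
  2 * (q * Za - p * Zb) * Tk
        + Ta * (- 2 * q * Zk - q * (a * p + b * q) - p * (a * q - b * p))
        + Tb * (2 * p * Zk + p * (a * p + b * q) - q * (a * q - b * p))
        + 2 * (a * q - b * p) * (q * Za - p * Zb) * w
        + (Za + p * w * Zk) ^+ 2
        + (Zb + q * w * Zk) ^+ 2
        + (a ^+ 2 + b ^+ 2) * w ^+ 2
        + 2 * w * (a * Za + b * Zb)
        + 2 * w ^+ 2 * (a * p + b * q) * Zk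
        - (q * Za - p * Zb + (a * q - b * p) * w) ^+ 2.
Proof.
move=> pq /=; rewrite !coef_sumsq_poly /=; apply/eqP; rewrite -subr_eq0; apply/eqP.
(* The cofactor of [p ^+ 2 + q ^+ 2 - 1], found by polynomial division. *)
transitivity ((- p ^+ 4 * w ^+ 2 * b ^+ 2 + 2 * p ^+ 3 * q * w ^+ 2 * a * b + 2 * p ^+ 3 * w *
    b * Tk - p ^+ 2 * q ^+ 2 * w ^+ 2 * a ^+ 2 - p ^+ 2 * q ^+ 2 * w ^+ 2 * b ^+ 2 -
    2 * p ^+ 2 * q * w * a * Tk + p ^+ 2 * w ^+ 2 * a ^+ 2 - 2 * p ^+ 2 * w * b * Zb
    - p ^+ 2 * Tk ^+ 2 + 2 * p * q ^+ 3 * w ^+ 2 * a * b + 2 * p * q ^+ 2 * w * b *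
    Tk + 2 * p * q * w ^+ 2 * a * b + 2 * p * q * w * a * Zb + 2 * p * q * w * b *
    Za + 2 * p * w ^+ 2 * a * Zk + 2 * p * Zb * Tk - q ^+ 4 * w ^+ 2 * a ^+ 2 - 2 *
    q ^+ 3 * w * a * Tk + q ^+ 2 * w ^+ 2 * b ^+ 2 - 2 * q ^+ 2 * w * a * Za - q ^+
    2 * Tk ^+ 2 + 2 * q * w ^+ 2 * b * Zk - 2 * q * Za * Tk + w ^+ 2 * a ^+ 2 + w ^+
    2 * b ^+ 2 + 2 * w * a * Za + 2 * w * b * Zb) * (p ^+ 2 + q ^+ 2 - 1)).
  by field.
by rewrite pq subrr mulr0.
Qed.

End flow_coefficients.

Section flow_derivative.
Variable R : realType.
Implicit Types (a b k : heis R -> R) (th : R * R -> heis R) (u w : R * R).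

Lemma derive_pair (V W1 W2 : normedModType R) (f : V -> W1) (g : V -> W2) (x v : V) :
  differentiable f x -> differentiable g x ->
  'D_v (fun x => (f x, g x)) x = ('D_v f x, 'D_v g x).
Proof.
move=> df dg; rewrite !deriveE//; last exact: differentiable_pair.
by rewrite diff_pair.
Qed.

Lemma derive_fst (V W1 W2 : normedModType R) (f : V -> W1 * W2) (x v : V) :
  differentiable f x -> 'D_v (fun x => (f x).1) x = ('D_v f x).1.
Proof.
move=> df; have d1 : differentiable (fst : W1 * W2 -> W1) (f x).
  by apply: linear_differentiable => y; exact: cvg_fst.
rewrite !deriveE//; last exact: (differentiable_comp df d1).
rewrite (diff_comp df d1) /= diff_lin// => y; exact: cvg_fst.
Qed.

Lemma derive_snd (V W1 W2 : normedModType R) (f : V -> W1 * W2) (x v : V) :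
  differentiable f x -> 'D_v (fun x => (f x).2) x = ('D_v f x).2.
Proof.
move=> df; have d1 : differentiable (snd : W1 * W2 -> W2) (f x).
  by apply: linear_differentiable => y; exact: cvg_snd.
rewrite !deriveE//; last exact: (differentiable_comp df d1).
rewrite (diff_comp df d1) /= diff_lin// => y; exact: cvg_snd.
Qed.

Lemma differentiable_fst (V W1 W2 : normedModType R) (f : V -> W1 * W2) (x : V) :
  differentiable f x -> differentiable (fun x => (f x).1) x.
Proof.
move=> df; apply: (differentiable_comp df).
by apply: linear_differentiable => y; exact: cvg_fst.
Qed.

Lemma differentiable_snd (V W1 W2 : normedModType R) (f : V -> W1 * W2) (x : V) :
  differentiable f x -> differentiable (fun x => (f x).2) x.
Proof.
move=> df; apply: (differentiable_comp df).
by apply: linear_differentiable => y; exact: cvg_snd.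
Qed.

(* The coefficient of [l] in the [T]-component of the derivative of
   [flow (vfield a b k) l \o th]; that of [l ^+ 2] is [flow_nu]. *)
Definition flow_mu a b k th u w : R :=
  'D_w (k \o th) u + b (th u) * ('D_w th u).1.1 - a (th u) * ('D_w th u).1.2.
Definition flow_nu a b th u w : R :=
  (b (th u) * 'D_w (a \o th) u - a (th u) * 'D_w (b \o th) u) / 2.

Section at_point.
Variables (a b k : heis R -> R) (th : R * R -> heis R) (u : R * R).
Hypothesis dth : differentiable th u.
Hypothesis da : differentiable (a \o th) u.
Hypothesis db : differentiable (b \o th) u.
Hypothesis dk : differentiable (k \o th) u.

(** The Cartesian components of [D] are affine in [l]. The quadratic term comes from [vert], which
    is taken at the moved point and multiplies its coordinates, affine in [l] too, by the horizontal
    components of [D]. *)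
Lemma derive_flow l w : let D := 'D_w (flow (vfield a b k) l \o th) u in
  [/\ D.1.1 = ('D_w th u).1.1 + l * 'D_w (a \o th) u,
      D.1.2 = ('D_w th u).1.2 + l * 'D_w (b \o th) u &
      vert (flow (vfield a b k) l (th u)) D =
        vert (th u) ('D_w th u) + l * flow_mu a b k th u w + l ^+ 2 * flow_nu a b th u w].
Proof.
have dx := differentiable_fst (differentiable_fst dth).
have dy := differentiable_snd (differentiable_fst dth).
have dt := differentiable_snd dth.
have Dx : 'D_w (fun u => (th u).1.1) u = ('D_w th u).1.1.
  by rewrite (derive_fst _ (differentiable_fst dth)) derive_fst.
have Dy : 'D_w (fun u => (th u).1.2) u = ('D_w th u).1.2.
  by rewrite (derive_snd _ (differentiable_fst dth)) derive_fst.
have Dt : 'D_w (fun u => (th u).2) u = ('D_w th u).2 by rewrite derive_snd.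
pose f1 := (fun u => (th u).1.1) + (fun u => l * (a \o th) u).
pose f2 := (fun u => (th u).1.2) + (fun u => l * (b \o th) u).
pose g := (k \o th) + (fun u => 2^-1 * (((b \o th) * (fun u => (th u).1.1)
  - (a \o th) * (fun u => (th u).1.2)) u)).
pose f3 := (fun u => (th u).2) + (fun u => l * g u).
have E : flow (vfield a b k) l \o th = fun u => (f1 u, f2 u, f3 u).
  apply/funext => v; rewrite /= flowE /f1 /f2 /f3 /g !fctE /vfield3 /=.
  by rewrite [2^-1 * _]mulrC.
have dZ (c : R) (f : R * R -> R) : differentiable f u -> differentiable (fun u => c * f u) u.
  by move=> df; exact: (differentiableZ c df).
have DZ (c : R) (f : R * R -> R) : differentiable f u ->
    'D_w (fun u => c * f u) u = c * 'D_w f u.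
  by move=> df; exact: (deriveZ c (diff_derivable df)).
have d1 : differentiable f1 u := differentiableD dx (dZ l _ da).
have d2 : differentiable f2 u := differentiableD dy (dZ l _ db).
have dbx := differentiableM db dx; have day := differentiableM da dy.
have dba := differentiableB dbx day.
have dg : differentiable g u := differentiableD dk (dZ 2^-1 _ dba).
have d3 : differentiable f3 u := differentiableD dt (dZ l _ dg).
have D1 : 'D_w f1 u = ('D_w th u).1.1 + l * 'D_w (a \o th) u.
  by rewrite (deriveD (diff_derivable dx) (diff_derivable (dZ l _ da))) DZ// Dx.
have D2 : 'D_w f2 u = ('D_w th u).1.2 + l * 'D_w (b \o th) u.
  by rewrite (deriveD (diff_derivable dy) (diff_derivable (dZ l _ db))) DZ// Dy.
have Dg : 'D_w g u = 'D_w (k \o th) u + 2^-1 *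
    (b (th u) * ('D_w th u).1.1 + (th u).1.1 * 'D_w (b \o th) u
    - (a (th u) * ('D_w th u).1.2 + (th u).1.2 * 'D_w (a \o th) u)).
  rewrite (deriveD (diff_derivable dk) (diff_derivable (dZ 2^-1 _ dba))) DZ//.
  rewrite (deriveB (diff_derivable dbx) (diff_derivable day)).
  rewrite (deriveM (diff_derivable db) (diff_derivable dx)).
  by rewrite (deriveM (diff_derivable da) (diff_derivable dy)) Dx Dy.
have D3 : 'D_w f3 u = ('D_w th u).2 + l * 'D_w g u.
  by rewrite (deriveD (diff_derivable dt) (diff_derivable (dZ l _ dg))) DZ// Dt.
have d12 : differentiable (fun u => (f1 u, f2 u)) u by exact: differentiable_pair.
rewrite /= E (derive_pair _ d12 d3) (derive_pair _ d1 d2) D1 D2 D3 Dg.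
split=> //; rewrite flowE /vert /vfield3 /flow_mu /flow_nu /=.
by field.
Qed.

Definition flow_poly : {poly R} :=
  let e1 : R * R := (1, 0) in let e2 : R * R := (0, 1) in
  let xu := (du th u).1.1 in let yu := (du th u).1.2 in
  let Vu := vert (th u) (du th u) in
  let xv := (dv th u).1.1 in let yv := (dv th u).1.2 in
  let Vv := vert (th u) (dv th u) in
  let au := 'D_e1 (a \o th) u in let bu := 'D_e1 (b \o th) u in
  let av := 'D_e2 (a \o th) u in let bv := 'D_e2 (b \o th) u in
  let mu := flow_mu a b k th u e1 in let mv := flow_mu a b k th u e2 in
  let nu := flow_nu a b th u e1 in let nv := flow_nu a b th u e2 in
  sumsq_poly (cross_coefA xu yu Vu au bu mu nu xv yv Vv av bv mv nv)
    (cross_coefB xu yu Vu au bu mu nu xv yv Vv av bv mv nv).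

(** The algebra of [hor_flow], with the derivatives replaced by variables. *)
Lemma hor_components (l : R) (g x y : heis R)
    (xu yu Vu au bu mu nu xv yv Vv av bv mv nv : R) :
  x.1.1 = xu + l * au -> x.1.2 = yu + l * bu ->
  vert g x = Vu + l * mu + l ^+ 2 * nu ->
  y.1.1 = xv + l * av -> y.1.2 = yv + l * bv ->
  vert g y = Vv + l * mv + l ^+ 2 * nv ->
  let s := cross_coefA xu yu Vu au bu mu nu xv yv Vv av bv mv nv in
  let t := cross_coefB xu yu Vu au bu mu nu xv yv Vv av bv mv nv in
  Num.sqrt ((x.1.2 * vert g y - vert g x * y.1.2) ^+ 2 +
    (vert g x * y.1.1 - x.1.1 * vert g y) ^+ 2) =
  Num.sqrt ((s`_0 + l * s`_1 + l ^+ 2 * s`_2 + l ^+ 3 * s`_3) ^+ 2 +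
    (t`_0 + l * t`_1 + l ^+ 2 * t`_2 + l ^+ 3 * t`_3) ^+ 2).
Proof.
move=> u1 u2 u3 v1 v2 v3 /=; rewrite u1 u2 u3 v1 v2 v3.
by congr (Num.sqrt (_ ^+ 2 + _ ^+ 2)); ring.
Qed.

Lemma hor_flow l : hor (flow (vfield a b k) l \o th) u = Num.sqrt flow_poly.[l].
Proof.
have [u1 u2 u3] := derive_flow l (1, 0); have [v1 v2 v3] := derive_flow l (0, 1).
rewrite /flow_poly horner_sumsq_poly.
exact: (hor_components u1 u2 u3 v1 v2 v3).
Qed.

End at_point.

End flow_derivative.

(** * Change of tangent frame *)

Section scaling.
Variable R : realType.

Definition flow_seqA (a b x1 y1 V1 a1 b1 k1 x2 y2 V2 a2 b2 k2 : R) : seq R :=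
  cross_coefA x1 y1 V1 a1 b1 (k1 + b * x1 - a * y1) ((b * a1 - a * b1) / 2)
    x2 y2 V2 a2 b2 (k2 + b * x2 - a * y2) ((b * a2 - a * b2) / 2).
Definition flow_seqB (a b x1 y1 V1 a1 b1 k1 x2 y2 V2 a2 b2 k2 : R) : seq R :=
  cross_coefB x1 y1 V1 a1 b1 (k1 + b * x1 - a * y1) ((b * a1 - a * b1) / 2)
    x2 y2 V2 a2 b2 (k2 + b * x2 - a * y2) ((b * a2 - a * b2) / 2).

(* All coefficients are alternating bilinear in the two tangent vectors, hence
   they scale by the determinant [d] under a change of basis. *)
Lemma sumsq_poly_change_basis
    (a b p q w Za Zb Zk Ta Tb Tk al1 be1 al2 be2 : R)
    (x1 y1 a1 b1 k1 x2 y2 a2 b2 k2 : R) i : (i < 3)%N ->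
  x1 = q * al1 - w * p * be1 -> y1 = - p * al1 - w * q * be1 ->
  a1 = al1 * Za + be1 * Ta -> b1 = al1 * Zb + be1 * Tb ->
  k1 = al1 * Zk + be1 * Tk ->
  x2 = q * al2 - w * p * be2 -> y2 = - p * al2 - w * q * be2 ->
  a2 = al2 * Za + be2 * Ta -> b2 = al2 * Zb + be2 * Tb ->
  k2 = al2 * Zk + be2 * Tk ->
  (sumsq_poly (flow_seqA a b x1 y1 be1 a1 b1 k1 x2 y2 be2 a2 b2 k2)
     (flow_seqB a b x1 y1 be1 a1 b1 k1 x2 y2 be2 a2 b2 k2))`_i =
  (al1 * be2 - al2 * be1) ^+ 2 *
  (sumsq_poly (flow_seqA a b q (- p) 0 Za Zb Zk (- w * p) (- w * q) 1 Ta Tb Tk)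
     (flow_seqB a b q (- p) 0 Za Zb Zk (- w * p) (- w * q) 1 Ta Tb Tk))`_i.
Proof.
move=> i3 -> -> -> -> -> -> -> -> -> ->; rewrite !coef_sumsq_poly.
set d := al1 * be2 - al2 * be1.
set s := flow_seqA _ _ _ _ _ _ _ _ _ _ _ _ _ _.
set t := flow_seqB _ _ _ _ _ _ _ _ _ _ _ _ _ _.
set s' := flow_seqA _ _ _ _ _ _ _ _ _ _ _ _ _ _.
set t' := flow_seqB _ _ _ _ _ _ _ _ _ _ _ _ _ _.
have A0 : s`_0 = d * s'`_0 by rewrite /s /s' /= /d; ring.
have B0 : t`_0 = d * t'`_0 by rewrite /t /t' /= /d; ring.
have A1 : s`_1 = d * s'`_1 by rewrite /s /s' /= /d; ring.
have B1 : t`_1 = d * t'`_1 by rewrite /t /t' /= /d; ring.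
have A2 : s`_2 = d * s'`_2.
  by rewrite /s /s' /= /d; field.
have B2 : t`_2 = d * t'`_2.
  by rewrite /t /t' /= /d; field.
clearbody s t s' t'.
move: i3; do 3 (case: i => [_|i]; first by rewrite /sq_coef /= ?A0 ?B0 ?A1 ?B1 ?A2 ?B2; ring).
by [].
Qed.

Lemma coef0_sumsq_poly (a b p q w Za Zb Zk Ta Tb Tk : R) :
  (sumsq_poly (flow_seqA a b q (- p) 0 Za Zb Zk (- w * p) (- w * q) 1 Ta Tb Tk)
     (flow_seqB a b q (- p) 0 Za Zb Zk (- w * p) (- w * q) 1 Ta Tb Tk))`_0 =
  p ^+ 2 + q ^+ 2.
Proof. by rewrite coef_sumsq_poly /=; ring. Qed.

End scaling.

Section tangent.
Variable R : realType.

(** The vectors Z = q X1 - p X2 and T - w Y span the plane orthogonal to (p, q, w). Only the second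
    has a [T]-component, which gives [be]; Z is a unit vector orthogonal to it, so [al] is the
    product with Z. *)
Lemma tangent_decomposition (g X : heis R) (p q w : R) : p ^+ 2 + q ^+ 2 = 1 ->
  p * X.1.1 + q * X.1.2 + w * vert g X = 0 ->
  let al := X.1.1 * q - X.1.2 * p in let be := vert g X in
  [/\ X.1.1 = q * al - w * p * be, X.1.2 = - p * al - w * q * be &
   X = al *: (q *: X1 g - p *: X2 g) + be *: (T g - w *: (p *: X1 g + q *: X2 g))].
Proof.
move=> pq; set V := vert g X => H al be.
have E1 : X.1.1 = q * al - w * p * be.
  transitivity (X.1.1 * (p ^+ 2 + q ^+ 2)); first by rewrite pq mulr1.
  transitivity (q * al - w * p * be + p * (p * X.1.1 + q * X.1.2 + w * V)).
    by rewrite /al /be; ring.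
  by rewrite H mulr0 addr0.
have E2 : X.1.2 = - p * al - w * q * be.
  transitivity (X.1.2 * (p ^+ 2 + q ^+ 2)); first by rewrite pq mulr1.
  transitivity (- p * al - w * q * be + q * (p * X.1.1 + q * X.1.2 + w * V)).
    by rewrite /al /be; ring.
  by rewrite H mulr0 addr0.
split=> //.
rewrite [LHS](frame_expansion g X) -/V -/be {1}E1 {1}E2.
congr (_, _, _); rewrite /= /GRing.scale /=; ring.
Qed.

End tangent.

(** If the determinant vanishes, the combinations that eliminate [E] and [Z] are zero; independence
    then kills [be1] and [al1], so [X = 0], which contradicts independence once more. *)
Lemma independent_det (R : realType) (V : lmodType R) (X Y Z E : V) (al1 be1 al2 be2 : R) :
  X = al1 *: Z + be1 *: E -> Y = al2 *: Z + be2 *: E ->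
  (forall r s : R, r *: X + s *: Y = 0 -> r = 0 /\ s = 0) ->
  al1 * be2 - al2 * be1 != 0.
Proof.
move=> EX EY ind; apply/eqP => d0.
have H1 : be2 *: X + (- be1) *: Y = (al1 * be2 - al2 * be1) *: Z.
  rewrite EX EY !scalerDr !scalerA addrACA -!scalerDl.
  rewrite (_ : be2 * be1 + - be1 * be2 = 0) ?scale0r ?addr0; last by ring.
  by congr (_ *: _); ring.
have H2 : al2 *: X + (- al1) *: Y = - (al1 * be2 - al2 * be1) *: E.
  rewrite EX EY !scalerDr !scalerA addrACA -!scalerDl.
  rewrite (_ : al2 * al1 + - al1 * al2 = 0) ?scale0r ?add0r; last by ring.
  by congr (_ *: _); ring.
move: H1; rewrite d0 scale0r => /ind[_ /eqP]; rewrite oppr_eq0 => /eqP b10.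
move: H2; rewrite d0 oppr0 scale0r => /ind[_ /eqP]; rewrite oppr_eq0 => /eqP a10.
have X0 : X = 0 by rewrite EX a10 b10 !scale0r addr0.
have P0 : 1 *: X + 0 *: Y = 0 by rewrite X0 scaler0 scale0r addr0.
by have [/eqP + _] := ind _ _ P0; rewrite oner_eq0.
Qed.

Section second_variation_density.
Variables (R : realType) (S : set (heis R)) (N : heis R -> heis R).
Variables (a b k a' b' k' : heis R -> R).
Hypothesis hN : normal_field S N.
Hypothesis ea : C1_extension S a a'.
Hypothesis eb : C1_extension S b b'.
Hypothesis ek : C1_extension S k k'.
Variables (U : set (R * R)) (th : R * R -> heis R) (u : R * R).
Hypothesis hc : chart S U th.
Hypothesis Uu : U u.

Lemma C1_extension_differentiable f f' g : C1_extension S f f' -> S g ->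
  differentiable f' g.
Proof. by move=> [[Q [_ SQ [dQ _]]] _] Sg; apply: dQ; exact: SQ. Qed.

(** [f] is given on [S] only, but [f \o th] agrees near [u] with [f' \o th], to which the chain rule
    applies. *)
Lemma derive_extension f f' e : C1_extension S f f' ->
  'D_e (f \o th) u = 'D_('D_e th u) f' (th u).
Proof.
move=> ef.
have dth := chart_differentiable hc Uu.
have df := C1_extension_differentiable ef (chart_in hc Uu).
have E : \forall v \near u, (f \o th) v = (f' \o th) v.
  apply: filterS (open_nbhs_nbhs (conj (chart_open hc) Uu)) => v Uv /=.
  by case: ef => _ ->//; exact: (chart_in hc).
rewrite (near_eq_derive _ E) (deriveE _ (differentiable_comp dth df)).
by rewrite (diff_comp dth df) (deriveE _ df) (deriveE _ dth).
Qed.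

Lemma derive_tangent f f' e (al be w : R) (Zv Tv Yv : heis R) : C1_extension S f f' ->
  'D_e th u = al *: Zv + be *: (Tv - w *: Yv) ->
  'D_e (f \o th) u = al * 'D_Zv f' (th u) +
    be * ('D_Tv f' (th u) - w * 'D_Yv f' (th u)).
Proof.
move=> ef E; rewrite (derive_extension e ef) E.
have df := C1_extension_differentiable ef (chart_in hc Uu).
rewrite (deriveDZ _ _ _ _ df).
have -> : Tv - w *: Yv = 1 *: Tv + (- w) *: Yv by rewrite scale1r scaleNr.
by rewrite (deriveDZ _ _ _ _ df) scale1r scaleNr.
Qed.

Hypothesis W0 : W N (th u) != 0.

Let p := pbar N (th u).
Let q := qbar N (th u).
Let w := wbar N (th u).
Let Z' f := along (Z N) f (th u).
Let TY f := along T f (th u) - w * along (Y N) f (th u).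

Lemma pbar_qbar : p ^+ 2 + q ^+ 2 = 1.
Proof.
rewrite /p /q /pbar /qbar !expr_div_n -mulrDl.
have : W N (th u) ^+ 2 = nX1 N (th u) ^+ 2 + nX2 N (th u) ^+ 2.
  by rewrite /W sqr_sqrtr// addr_ge0 ?sqr_ge0.
by move=> <-; rewrite divff// expf_neq0.
Qed.

Lemma normal_tangent (v : heis R) : inner (th u) (N (th u)) v = 0 ->
  p * v.1.1 + q * v.1.2 + w * vert (th u) v = 0.
Proof.
rewrite /inner => H.
transitivity ((W N (th u))^-1 * 0); last by rewrite mulr0.
by rewrite -H /p /q /w /pbar /qbar /wbar nX1E nX2E nTE; ring.
Qed.

(** [d] is the determinant of the coordinate tangent vectors in the frame [Z], [T - wbar Y].
    Coefficients of index below 3 are all that a second derivative at 0 sees. *)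
Lemma flow_polyE : exists d : R, d != 0 /\ forall i, (i < 3)%N ->
  (flow_poly a b k th u)`_i = d ^+ 2 *
  (sumsq_poly
     (flow_seqA (a (th u)) (b (th u)) q (- p) 0 (Z' a') (Z' b') (Z' k')
        (- w * p) (- w * q) 1 (TY a') (TY b') (TY k'))
     (flow_seqB (a (th u)) (b (th u)) q (- p) 0 (Z' a') (Z' b') (Z' k')
        (- w * p) (- w * q) 1 (TY a') (TY b') (TY k')))`_i.
Proof.
have [_ _ /(_ U th hc u Uu)[Nu Nv]] := hN.
have [E11 E12 E1] := tangent_decomposition pbar_qbar (normal_tangent Nu).
have [E21 E22 E2] := tangent_decomposition pbar_qbar (normal_tangent Nv).
set al1 := (du th u).1.1 * q - (du th u).1.2 * p in E11 E12 E1.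
set al2 := (dv th u).1.1 * q - (dv th u).1.2 * p in E21 E22 E2.
set be1 := vert (th u) (du th u) in E11 E12 E1.
set be2 := vert (th u) (dv th u) in E21 E22 E2.
have [_ _ _ ind _] := hc.
eexists; split; first exact: (independent_det E1 E2 (ind _ Uu)).
move=> i i3.
have Ha1 : 'D_(1, 0) (a \o th) u = al1 * Z' a' + be1 * TY a' := derive_tangent ea E1.
have Hb1 : 'D_(1, 0) (b \o th) u = al1 * Z' b' + be1 * TY b' := derive_tangent eb E1.
have Hk1 : 'D_(1, 0) (k \o th) u = al1 * Z' k' + be1 * TY k' := derive_tangent ek E1.
have Ha2 : 'D_(0, 1) (a \o th) u = al2 * Z' a' + be2 * TY a' := derive_tangent ea E2.
have Hb2 : 'D_(0, 1) (b \o th) u = al2 * Z' b' + be2 * TY b' := derive_tangent eb E2.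
have Hk2 : 'D_(0, 1) (k \o th) u = al2 * Z' k' + be2 * TY k' := derive_tangent ek E2.
have H := sumsq_poly_change_basis (a (th u)) (b (th u)) i3 E11 E12 Ha1 Hb1 Hk1
  E21 E22 Ha2 Hb2 Hk2.
exact H.
Qed.

Lemma flow_poly0_gt0 : 0 < (flow_poly a b k th u)`_0.
Proof.
have [d [d0 E]] := flow_polyE; rewrite E//.
by rewrite coef0_sumsq_poly pbar_qbar mulr1 exprn_even_gt0.
Qed.

Lemma hor_flow_poly : hor th u = Num.sqrt (flow_poly a b k th u)`_0.
Proof.
by rewrite coef_sumsq_poly /hor /=.
Qed.

(** Write P_i = d^2 Q_i with Q_0 = 1. Then [hor th u] is the root of P_0, that is |d|, and the
    second derivative is |d| (Q_2 - Q_1^2 / 4), to which [second_variation_identity] applies. *)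
Lemma second_variation_density :
  let g := th u in
  sqrt_poly_deriv2 (flow_poly a b k th) u =
  (2 * (q * Z' a' - p * Z' b') * TY k'
        + TY a' * (- 2 * q * Z' k' - q * (a g * p + b g * q)
                   - p * (a g * q - b g * p))
        + TY b' * (2 * p * Z' k' + p * (a g * p + b g * q)
                   - q * (a g * q - b g * p))
        + 2 * (a g * q - b g * p) * (q * Z' a' - p * Z' b') * w
        + (Z' a' + p * w * Z' k') ^+ 2
        + (Z' b' + q * w * Z' k') ^+ 2
        + (a g ^+ 2 + b g ^+ 2) * w ^+ 2
        + 2 * w * (a g * Z' a' + b g * Z' b')
        + 2 * w ^+ 2 * (a g * p + b g * q) * Z' k'
        - (q * Z' a' - p * Z' b' + (a g * q - b g * p) * w) ^+ 2) * hor th u.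
Proof.
move=> g; rewrite /sqrt_poly_deriv2 hor_flow_poly.
have [d [d0 E]] := flow_polyE.
have pq := pbar_qbar.
have := second_variation_identity w (a g) (b g) (Z' a') (Z' b') (Z' k') (TY a') (TY b') (TY k') pq.
move=> /= <-.
have E0 : (flow_poly a b k th u)`_0 = d ^+ 2.
  by rewrite E// coef0_sumsq_poly pq mulr1.
rewrite E0 (E 1) // (E 2) // sqrtr_sqr.
have n0 : `|d| != 0 by rewrite normr_eq0.
have n2 : d ^+ 2 = `|d| ^+ 2 by rewrite real_normK// num_real.
rewrite n2 -/(flow_seqA _ _ _ _ _ _ _ _ _ _ _ _ _ _ ).
set c1 := (sumsq_poly _ _)`_1; set c2 := (sumsq_poly _ _)`_2.
move: n0; set D := `|d|; clearbody D c1 c2 => n0.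
by field.
Qed.

End second_variation_density.

(** * Continuity of the coefficients and bounds on compact sets *)

Section flow_poly_continuous.
Variables (R : realType) (S : set (heis R)) (a b k : heis R -> R).
Variables (U : set (R * R)) (th : R * R -> heis R).
Hypothesis hc : chart S U th.
Hypothesis Ca : Ck 2 U (a \o th).
Hypothesis Cb : Ck 2 U (b \o th).
Hypothesis Cc : Ck 2 U (k \o th).

Lemma Ck0_derive (W : normedModType R) (f : R * R -> W) (e : R * R) : Ck 2 U f -> Ck 0 U ('D_e f).
Proof. by move=> Cf; apply: CkW; case: Cf => _ /(_ e). Qed.

Lemma Ck0_sq_coef (s0 s1 s2 s3 : R * R -> R) i :
  Ck 0 U s0 -> Ck 0 U s1 -> Ck 0 U s2 -> Ck 0 U s3 ->
  Ck 0 U (fun u => (sq_coef [:: s0 u; s1 u; s2 u; s3 u])`_i).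
Proof.
have oU := chart_open hc; move=> h0 h1 h2 h3.
have M2 (f g : R * R -> R) : Ck 0 U f -> Ck 0 U g -> Ck 0 U (fun u => 2 * f u * g u).
  by move=> Cf Cg; exact: (CkM oU (CkZ 2 oU Cf) Cg).
case: i => [|[|[|[|[|[|[|i]]]]]]].
- exact: (CkX2 oU h0).
- exact: (M2 _ _ h0 h1).
- exact: (CkD oU (CkX2 oU h1) (M2 _ _ h0 h2)).
- exact: (CkZ 2 oU (CkD oU (CkM oU h0 h3) (CkM oU h1 h2))).
- exact: (CkD oU (CkX2 oU h2) (M2 _ _ h1 h3)).
- exact: (M2 _ _ h2 h3).
- exact: (CkX2 oU h3).
- apply: (Ck_eq oU _ (@Ck_cst _ _ U _ 0 (0 : R))) => u _ /=.
  by rewrite nth_nil.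
Qed.

Lemma Ck0_cross_coef (x1 y1 V1 a1 b1 m1 n1 x2 y2 V2 a2 b2 m2 n2 : R * R -> R) i :
  Ck 0 U x1 -> Ck 0 U y1 -> Ck 0 U V1 -> Ck 0 U a1 -> Ck 0 U b1 -> Ck 0 U m1 -> Ck 0 U n1 ->
  Ck 0 U x2 -> Ck 0 U y2 -> Ck 0 U V2 -> Ck 0 U a2 -> Ck 0 U b2 -> Ck 0 U m2 -> Ck 0 U n2 ->
  Ck 0 U (fun u => (sumsq_poly
    (cross_coefA (x1 u) (y1 u) (V1 u) (a1 u) (b1 u) (m1 u) (n1 u)
       (x2 u) (y2 u) (V2 u) (a2 u) (b2 u) (m2 u) (n2 u))
    (cross_coefB (x1 u) (y1 u) (V1 u) (a1 u) (b1 u) (m1 u) (n1 u)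
       (x2 u) (y2 u) (V2 u) (a2 u) (b2 u) (m2 u) (n2 u)))`_i).
Proof.
have oU := chart_open hc.
move=> hx1 hy1 hV1 ha1 hb1 hm1 hn1 hx2 hy2 hV2 ha2 hb2 hm2 hn2.
have P (f g : R * R -> R) : Ck 0 U f -> Ck 0 U g -> Ck 0 U (fun u => f u * g u).
  exact: CkM.
have A0 := CkB oU (P _ _ hy1 hV2) (P _ _ hV1 hy2).
have A1 := CkB oU (CkB oU (CkD oU (P _ _ hy1 hm2) (P _ _ hb1 hV2)) (P _ _ hV1 hb2)) (P _ _ hm1 hy2).
have A2 := CkB oU (CkB oU (CkD oU (P _ _ hy1 hn2) (P _ _ hb1 hm2)) (P _ _ hm1 hb2)) (P _ _ hn1 hy2).
have A3 := CkB oU (P _ _ hb1 hn2) (P _ _ hn1 hb2).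
have B0 := CkB oU (P _ _ hV1 hx2) (P _ _ hx1 hV2).
have B1 := CkB oU (CkB oU (CkD oU (P _ _ hV1 ha2) (P _ _ hm1 hx2)) (P _ _ hx1 hm2)) (P _ _ ha1 hV2).
have B2 := CkB oU (CkB oU (CkD oU (P _ _ hm1 ha2) (P _ _ hn1 hx2)) (P _ _ hx1 hn2)) (P _ _ ha1 hm2).
have B3 := CkB oU (P _ _ hn1 ha2) (P _ _ ha1 hn2).
have H := CkD oU (Ck0_sq_coef (i := i) A0 A1 A2 A3) (Ck0_sq_coef (i := i) B0 B1 B2 B3).
refine (Ck_eq oU _ H) => u _.
by rewrite coef_sumsq_poly.
Qed.

Lemma Ck0_flow_poly i : Ck 0 U (fun u => (flow_poly a b k th u)`_i).
Proof.
have oU := chart_open hc.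
have Cth : Ck 2 U th by case: hc.
have C0 (W : normedModType R) (f : R * R -> W) : Ck 2 U f -> Ck 0 U f by move=> Cf; do 2 apply: CkW.
have Cth0 := C0 _ _ Cth; have Ca0 := C0 _ _ Ca; have Cb0 := C0 _ _ Cb.
have Cmu e : Ck 0 U (fun u => flow_mu a b k th u e).
  have C1 := CkM oU Cb0 (Ck_fst1 oU (Ck0_derive (e := e) Cth)).
  have C2 := CkM oU Ca0 (Ck_snd1 oU (Ck0_derive (e := e) Cth)).
  exact: (CkB oU (CkD oU (Ck0_derive (e := e) Cc) C1) C2).
have Cnu e : Ck 0 U (fun u => flow_nu a b th u e).
  have C1 := CkM oU Cb0 (Ck0_derive (e := e) Ca); have C2 := CkM oU Ca0 (Ck0_derive (e := e) Cb).
  apply: (Ck_eq oU _ (CkZ 2^-1 oU (CkB oU C1 C2))) => u Uu.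
  by rewrite /flow_nu mulrC.
apply: Ck0_cross_coef.
- exact: Ck_fst1 oU (Ck0_derive (e := (1, 0)) Cth).
- exact: Ck_snd1 oU (Ck0_derive (e := (1, 0)) Cth).
- exact: Ck_vert oU Cth0 (Ck0_derive (e := (1, 0)) Cth).
- exact: Ck0_derive Ca.
- exact: Ck0_derive Cb.
- exact: Cmu.
- exact: Cnu.
- exact: Ck_fst1 oU (Ck0_derive (e := (0, 1)) Cth).
- exact: Ck_snd1 oU (Ck0_derive (e := (0, 1)) Cth).
- exact: Ck_vert oU Cth0 (Ck0_derive (e := (0, 1)) Cth).
- exact: Ck0_derive Ca.
- exact: Ck0_derive Cb.
- exact: Cmu.
- exact: Cnu.
Qed.

End flow_poly_continuous.

Section compact_bounds.
Variable R : realType.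

Lemma Ck0_within (U C : set (R * R)) (f : R * R -> R) : Ck 0 U f -> C `<=` U ->
  {within C, continuous f}.
Proof.
move=> cf CU; apply: continuous_in_subspaceT => u /set_mem Cu.
by apply: cf; exact: CU.
Qed.

Lemma compact_upper_bound (U C : set (R * R)) (f : R * R -> R) : Ck 0 U f -> C `<=` U ->
  compact C -> exists2 M : R, 0 <= M & forall u, C u -> `|f u| <= M.
Proof.
move=> cf CU cC.
have := compact_bounded (continuous_compact (Ck0_within cf CU) cC).
move=> /pinfty_ex_gt0[M M0 HM]; exists M; first exact: ltW.
by move=> u Cu; apply: HM; exists u.
Qed.

Lemma compact_lower_bound (U C : set (R * R)) (f : R * R -> R) : Ck 0 U f -> C `<=` U ->
  compact C -> (forall u, C u -> 0 < f u) -> exists2 c : R, 0 < c & forall u, C u -> c <= f u.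
Proof.
move=> cf CU cC f0.
have [[u0 Cu0]|nC] := pselect (exists u, C u); last first.
  by exists 1 => // u Cu; exfalso; apply: nC; exists u.
have [] := @compact_EVT_min _ _ f C _ cC (Ck0_within cf CU); first by exists u0.
move=> c /set_mem Cc H; exists (f c); first exact: f0.
by move=> u Cu; apply: H; exact: mem_set.
Qed.

Lemma compact_preimage (U Q : set (R * R)) (V : normedModType R) (f : R * R -> V) (K : set V) :
  Ck 0 U f -> Q `<=` U -> compact Q -> closed K -> compact (Q `&` f @^-1` K).
Proof.
move=> cf QU cQ cK.
have clQ : closed Q by apply: compact_closed => //; exact: norm_hausdorff.
apply: (subclosed_compact _ cQ); last by move=> u [].
move=> u clu; have Qu : Q u.
  by apply: clQ => B Bu; have [v [[Qv _] Bv]] := clu B Bu; exists v.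
split=> //; apply: cK => B Bfu.
have [v [[Qv Kv] Bv]] := clu _ (cf u (QU _ Qu) _ Bfu).
by exists (f v).
Qed.

Lemma lebesgue2_compact (C : set (R * R)) : compact C ->
  ((@lebesgue_measure R \x @lebesgue_measure R)%E C < +oo)%E.
Proof.
move=> cC; have /pinfty_ex_gt0[M M0 HM] := compact_bounded cC.
have mI : measurable (`[- M, M]%classic : set R) by exact: measurable_itv.
have CB : C `<=` `[- M, M]%classic `*` `[- M, M]%classic.
  move=> u Cu; have : `|u| <= M := HM u Cu; rewrite prod_normE ge_max => /andP[u1 u2].
  by split; rewrite /= in_itv/= -ler_norml.
have mC : measurable C.
  rewrite -(setCK C); apply: measurableC; apply: open_measurable2; apply: closed_openC.
  by apply: compact_closed => //; exact: norm_hausdorff.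
have L := le_measure (@lebesgue_measure R \x @lebesgue_measure R)%E (mem_set mC)
  (mem_set (measurableX mI mI)) CB.
apply: (le_lt_trans L).
apply: (@le_lt_trans _ _ (@lebesgue_measure R `[(- M)%R, M] * @lebesgue_measure R `[(- M)%R, M])%E).
  by rewrite -product_measure1E.
have I : (@lebesgue_measure R `[(- M)%R, M] < +oo)%E.
  by rewrite lebesgue_measure_itv/=; case: ifP; rewrite -?EFinB ?ltry.
by rewrite lte_mul_pinfty// ge0_fin_numE.
Qed.

End compact_bounds.

(** * Variation of the perimeter *)

Section variation.
Variables (R : realType) (S : set (heis R)) (N : heis R -> heis R).
Variables (a b k a' b' k' : heis R -> R).
Hypothesis hS : C2_surface S.
Hypothesis hN : normal_field S N.
Hypothesis ha : C2_0 S (char_set S N) a.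
Hypothesis hb : C2_0 S (char_set S N) b.
Hypothesis hk : C2_0 S (char_set S N) k.
Hypothesis ea : C1_extension S a a'.
Hypothesis eb : C1_extension S b b'.
Hypothesis ek : C1_extension S k k'.

(** The hypotheses give compactness and distance from the characteristic set for the support of each
    component separately; the union inherits both. *)
Definition support3 : set (heis R) :=
  support_on S a `|` support_on S b `|` support_on S k.

Local Notation K := support3.
Local Notation X := (vfield a b k).

Lemma support3_compact : compact K.
Proof.
by case: ha => _ ? _; case: hb => _ ? _; case: hk => _ ? _; do 2 (apply: compactU => //).
Qed.

Lemma support3_closed : closed K.
Proof. by apply: compact_closed support3_compact; exact: norm_hausdorff. Qed.

Lemma support3_sub : K `<=` S `\` char_set S N.
Proof.
by case: ha => _ _ sa; case: hb => _ _ sb; case: hk => _ _ sk g [[/sa|/sb]|/sk].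
Qed.

Lemma support3_subS : K `<=` S.
Proof. by move=> g /support3_sub[]. Qed.

Lemma support3_W g : K g -> W N g != 0.
Proof. by move=> /support3_sub[Sg nc]; apply/eqP => W0; apply: nc. Qed.

Lemma support3_out g : S g -> ~ K g -> [/\ a g = 0, b g = 0 & k g = 0].
Proof.
move=> Sg nK; split; apply: contrapT => n0; apply: nK.
- by left; left; apply: subset_closure.
- by left; right; apply: subset_closure.
- by right; apply: subset_closure.
Qed.

Lemma flow_C2 l U th : chart S U th -> Ck 2 U (flow X l \o th).
Proof.
move=> hc; have oU := chart_open hc; have Cth : Ck 2 U th by case: hc.
by case: ha => Ca _ _; case: hb => Cb _ _; case: hk => Cc _ _;
  apply: (Ck_flow l oU Cth (Ca _ _ hc) (Cb _ _ hc) (Cc _ _ hc)).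
Qed.

Lemma flow0 g l : S g -> ~ K g -> flow X l g = g.
Proof.
move=> Sg nK; have [a0 b0 k0] := support3_out Sg nK.
by rewrite flowE /vfield3 a0 b0 k0 !mul0r subr0 mul0r addr0 mulr0 !addr0; case: g {Sg nK a0 b0 k0} => -[].
Qed.

Lemma near_outside U th u : chart S U th -> U u -> ~ K (th u) ->
  \forall v \near u, U v /\ ~ K (th v).
Proof.
move=> hc Uu nK; have oU := chart_open hc.
apply: filterI; first exact: open_nbhs_nbhs.
have nKu : nbhs (th u) (~` K).
  by apply: open_nbhs_nbhs; split=> //; exact: closed_openC support3_closed.
have H := chart_continuous hc Uu nKu.
exact: H.
Qed.

(** As [K] is closed, the deformation is the identity on [S] near the point, so the derivatives in
    the chart are unchanged too. *)
Lemma hor_outside l U th u : chart S U th -> U u -> ~ K (th u) ->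
  hor (flow X l \o th) u = hor th u.
Proof.
move=> hc Uu nK.
have E : \forall v \near u, (flow X l \o th) v = th v.
  apply: filterS (near_outside hc Uu nK) => v [Uv nKv] /=.
  by rewrite flow0//; exact: (chart_in hc).
have Eu : du (flow X l \o th) u = du th u by exact: near_eq_derive.
have Ev : dv (flow X l \o th) u = dv th u by exact: near_eq_derive.
by rewrite /hor /horA /horB Eu Ev /= flow0//; exact: (chart_in hc).
Qed.

Variable A : atlas S.

Local Notation lam2 := (@lebesgue_measure R \x @lebesgue_measure R)%E.

Lemma chart_piece_measurable B n : measurable B -> measurable (chart_piece A B n).
Proof.
move=> mB; apply: (chart_preimage_measurable (achart A n)).
by apply: measurableI => //; exact: measurable_piece.
Qed.

Lemma chart_piece_acomp B n : chart_piece A B n `<=` acomp A n.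
Proof.
move=> u [Uu [_ /piece_sub[v Qv uv]]].
by rewrite -(chart_inj (achart A n) _ _ uv)//; exact: acomp_sub Qv.
Qed.

Lemma chart_piece_finite B n : measurable B -> (lam2 (chart_piece A B n) < +oo)%E.
Proof.
move=> mB; have mQ : measurable (acomp A n).
  rewrite -(setCK (acomp A n)); apply: measurableC; apply: open_measurable2.
  by apply: closed_openC; apply: compact_closed; [exact: norm_hausdorff|exact: acompP].
have L := le_measure lam2 (mem_set (chart_piece_measurable n mB)) (mem_set mQ)
  (@chart_piece_acomp B n).
have L2 := lebesgue2_compact (@acompP _ _ A n).
apply: (le_lt_trans L). exact L2.
Qed.

Local Notation I_ n := (fun l : R =>
  (\int[lam2]_(u in chart_piece A K n) Num.sqrt (flow_poly a b k (apar A n) u).[l])%R).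

(** The parameters in [acomp A n] of points of [K] form a compact set. There the coefficients are
    bounded, and the constant one has a positive lower bound because [K] has no characteristic
    point. *)
Lemma piece_variation n : exists2 e : R, 0 < e &
  [/\ forall l : R, `|l| < e -> lam2.-integrable (chart_piece A K n)
        (fun u => (Num.sqrt (flow_poly a b k (apar A n) u).[l])%:E),
      lam2.-integrable (chart_piece A K n)
        (fun u => (sqrt_poly_deriv2 (flow_poly a b k (apar A n)) u)%:E),
      forall l : R, `|l| < e -> derivable (I_ n) l 1,
      derivable (derive1 (I_ n)) 0 1 &
      derive1 (derive1 (I_ n)) 0 = (\int[lam2]_(u in chart_piece A K n)
         sqrt_poly_deriv2 (flow_poly a b k (apar A n)) u)%R].
Proof.
have hc := achart A n; have oU := chart_open hc.
have [Ca _ _] := ha; have [Cb _ _] := hb; have [Cc _ _] := hk.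
have CP i := Ck0_flow_poly hc (Ca _ _ hc) (Cb _ _ hc) (Cc _ _ hc) (i := i).
have mK := compact_measurable3 support3_compact.
have mD := chart_piece_measurable n mK.
set C := acomp A n `&` apar A n @^-1` K.
have DC : chart_piece A K n `<=` C.
  by move=> u Du; split; [exact: chart_piece_acomp Du|case: Du => _ []].
have CU : C `<=` adom A n by move=> u [/acomp_sub].
have cC : compact C.
  apply: compact_preimage support3_closed; [|exact: acomp_sub|exact: acompP].
  exact: (chart_continuous hc).
have /choice[M MP] : forall i, exists M : R, 0 <= M /\
    forall u, C u -> `|(flow_poly a b k (apar A n) u)`_i| <= M.
  by move=> i; have [M M0 HM] := compact_upper_bound (CP i) CU cC; exists M.
(* The polynomials have degree at most 6; the sum bounds all 7 coefficients at once. *)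
pose B := \sum_(i < 7) M i.
have B0 : 0 <= B by apply: sumr_ge0 => i _; have [] := MP i.
have PB i u : chart_piece A K n u -> `|(flow_poly a b k (apar A n) u)`_i| <= B.
  move=> Du; have [i7|i7] := ltnP i 7; last first.
    by rewrite nth_default ?normr0// (leq_trans (size_sumsq_poly _ _)).
  apply: le_trans ((MP i).2 _ (DC _ Du)) _.
  rewrite /B (bigD1 (Ordinal i7))//= lerDl; apply: sumr_ge0 => j _.
  by have [] := MP j.
have [c c0 Hc] : exists2 c : R, 0 < c & forall u, C u -> c <= (flow_poly a b k (apar A n) u)`_0.
  apply: (compact_lower_bound (CP 0) CU cC) => u Cu.
  apply: (flow_poly0_gt0 hN ea eb ek hc (CU _ Cu)).
  by apply: support3_W; case: Cu.
have sP u : (size (flow_poly a b k (apar A n) u) <= 7)%N by exact: size_sumsq_poly.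
have mP i : measurable_fun (chart_piece A K n) (fun u => (flow_poly a b k (apar A n) u)`_i).
  apply: measurable_funS (continuous_measurable2 oU (CP i)); first exact: open_measurable2.
  by move=> u [].
have Pc u : chart_piece A K n u -> c <= (flow_poly a b k (apar A n) u)`_0.
  by move=> /DC; exact: Hc.
exact: (sqrt_poly_integral (mu := lam2) mD (chart_piece_finite n mK) c0 sP mP PB Pc B0).
Qed.

End variation.

(** * Perimeter of the deformed surface *)

Section perimeter.
Variables (R : realType) (S : set (heis R)) (N : heis R -> heis R).
Variables (a b k a' b' k' : heis R -> R).
Hypothesis hS : C2_surface S.
Hypothesis hN : normal_field S N.
Hypothesis ha : C2_0 S (char_set S N) a.
Hypothesis hb : C2_0 S (char_set S N) b.
Hypothesis hk : C2_0 S (char_set S N) k.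
Hypothesis ea : C1_extension S a a'.
Hypothesis eb : C1_extension S b b'.
Hypothesis ek : C1_extension S k k'.

Local Notation K := (support3 S a b k).
Local Notation X := (vfield a b k).
Local Notation lam2 := (@lebesgue_measure R \x @lebesgue_measure R)%E.

Variable A : atlas S.

(** The H-perimeter of [B] before the deformation, written in charts only: without measure or normal
    it can be shared by all [l]. *)
Definition hmass (B : set (heis R)) : \bar R :=
  (\sum_(0 <= n <oo) \int[lam2]_(u in chart_piece A B n) (hor (apar A n) u)%:E)%E.

Section fixed_time.
Variables (l : R) (Nl : heis R -> heis R) (sigmal : {measure set (heis R) -> \bar R}).
Hypothesis expl : forall h1 h2, S h1 -> S h2 ->
  `|h1 - h2| <= 2 * `|flow X l h1 - flow X l h2|.
Hypothesis hNl : normal_field (deform X l S) Nl.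
Hypothesis hsigmal : riemannian_surface_measure (deform X l S) sigmal.

Let C2l U th (hc : chart S U th) : Ck 2 U (flow X l \o th) := flow_C2 ha hb hk l hc.

Lemma sigma_H_flow B : B `<=` S -> measurable B ->
  sigma_H sigmal Nl (deform X l B) =
  (\sum_(0 <= n <oo) \int[lam2]_(u in chart_piece A B n)
     (hor (flow X l \o apar A n) u)%:E)%E.
Proof. exact: (sigma_H_image hS expl C2l hNl hsigmal). Qed.

Lemma sigma_H_outside B : B `<=` S `\` K -> measurable B ->
  sigma_H sigmal Nl (deform X l B) = hmass B.
Proof.
move=> BSK mB; have BS : B `<=` S by move=> g /BSK[].
rewrite (sigma_H_flow BS mB).
apply: eq_eseriesr => n _; apply: eq_integral => u /[!inE] -[Uu [Bu _]].
by rewrite (hor_outside ha hb hk l (achart A n) Uu (BSK _ Bu).2).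
Qed.

(** Meant for [S] and for [S0], the two sets between which [perimeter] chooses: only the last term
    depends on [l]. *)
Lemma sigma_H_setD B : K `<=` B -> B `<=` S -> measurable B ->
  sigma_H sigmal Nl (deform X l B) =
  (hmass (B `\` K) + sigma_H sigmal Nl (deform X l K))%E.
Proof.
move=> KB BS mB; have mK := compact_measurable3 (support3_compact ha hb hk).
have mBK : measurable (B `\` K) by exact: measurableD.
have KS := subset_trans KB BS.
have BKS : B `\` K `<=` S by move=> g [/BS].
have mi C : C `<=` S -> measurable C -> measurable (deform X l C).
  exact: (image_measurable hS expl C2l).
have BKSK : B `\` K `<=` S `\` K by move=> g [/BS].
rewrite -(sigma_H_outside BKSK mBK).
have E : deform X l B = deform X l (B `\` K) `|` deform X l K.
  by rewrite /deform -image_setU setUC setDUK.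
rewrite {1}E /sigma_H /integral_H ge0_integral_setU//; try exact: mi.
- rewrite -E; apply: (@measurable_funS _ _ _ _ (deform X l S)).
  + exact: mi (C2_surface_measurable hS).
  + exact: image_subset.
  + apply/measurable_EFinP; apply: measurable_funM => //.
    exact: (hdensity_measurable hNl (image_C2_surface hS expl C2l)).
- by move=> g _; rewrite lee_fin mul1r; exact: hdensity_ge0.
- apply/disj_setPS => _ [[g [Bg nKg] <-] [g' Kg' E']]; apply: nKg.
  by rewrite -(phi_inj expl _ _ E')//; [exact: KS|exact: BS].
Qed.

(** Pieces from index [n0] on miss the support, so the series is a finite sum of real integrals,
    which can be differentiated term by term. *)
Lemma sigma_H_support n0 :
  (forall n, (n0 <= n)%N -> K `&` piece A n = set0) ->
  (forall n, (n < n0)%N -> lam2.-integrable (chart_piece A K n)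
        (fun u => (Num.sqrt (flow_poly a b k (apar A n) u).[l])%:E)) ->
  sigma_H sigmal Nl (deform X l K) =
  (\sum_(n < n0) \int[lam2]_(u in chart_piece A K n)
    Num.sqrt (flow_poly a b k (apar A n) u).[l])%:E.
Proof.
move=> K0 intP; have mK := compact_measurable3 (support3_compact ha hb hk).
have KS := support3_subS ha hb hk.
rewrite (sigma_H_flow KS mK).
rewrite (nneseries_split 0 n0); last first.
  by move=> n _; apply: integral_ge0 => u _; rewrite lee_fin sqrtr_ge0.
rewrite add0n [X in (_ + X)%E](_ : _ = 0%E) ?adde0; last first.
  apply: eseries0 => n n0n _.
  by rewrite /chart_piece K0// preimage_set0 setI0 integral_set0.
rewrite big_mkord -sumEFin; apply: eq_bigr => i _.
rewrite /Rintegral fineK; last first.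
  by apply: integrable_fin_num (intP _ (ltn_ord i)); exact: (chart_piece_measurable hS).
apply: eq_integral => u /[!inE] -[Uu _]; congr _%:E.
have hc := achart A i.
have [Ca _ _] := ha; have [Cb _ _] := hb; have [Cc _ _] := hk.
apply: hor_flow; first exact: (chart_differentiable hc Uu).
- by have [+ _] := Ca _ _ hc; exact.
- by have [+ _] := Cb _ _ hc; exact.
- by have [+ _] := Cc _ _ hc; exact.
Qed.

End fixed_time.

Lemma hmass_compact (B C : set (heis R)) : measurable B -> B `<=` C -> compact C -> C `<=` S ->
  (hmass B < +oo)%E.
Proof.
move=> mB BC cC CS; have [n0 Hn0] := piece_compact A cC CS.
have h0 n u : (0 <= (hor (apar A n) u)%:E)%E by rewrite lee_fin sqrtr_ge0.
rewrite /hmass (nneseries_split 0 n0); last first.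
  by move=> n _; apply: integral_ge0 => u _.
rewrite add0n [X in (_ + X)%E](_ : _ = 0%E) ?adde0; last first.
  apply: eseries0 => n n0n _.
  rewrite /chart_piece (_ : B `&` _ = set0) ?preimage_set0 ?setI0 ?integral_set0//.
  by apply/seteqP; split=> // g [Bg gn]; rewrite -(Hn0 _ n0n); split=> //; exact: BC.
apply: lte_sum_pinfty => n _.
have hc := achart A n; have oU := chart_open hc.
have Ch : Ck 0 (adom A n) (hor (apar A n)).
  by apply: Ck0_hor => //; apply: CkW; case: hc.
have mD := chart_piece_measurable hS A n mB.
have [M M0 HM] := compact_upper_bound Ch (@acomp_sub _ _ A n) (@acompP _ _ A n).
have mh : measurable_fun (chart_piece A B n) (hor (apar A n)).
  apply: measurable_funS (continuous_measurable2 oU Ch); first exact: open_measurable2.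
  by move=> u [].
have hM u : chart_piece A B n u -> `|hor (apar A n) u| <= M.
  by move=> /chart_piece_acomp; exact: HM.
exact: (integrable_lty (mu := lam2) mD
  (bounded_integrable (mu := lam2) mD (chart_piece_finite hS A n mB) mh hM)).
Qed.

End perimeter.

(** * The second variation as an integral over the surface *)

Section second_variation_integral.
Variables (R : realType) (S : set (heis R)) (N : heis R -> heis R).
Variables (a b k a' b' k' : heis R -> R).
Hypothesis hS : C2_surface S.
Hypothesis hN : normal_field S N.
Hypothesis ha : C2_0 S (char_set S N) a.
Hypothesis hb : C2_0 S (char_set S N) b.
Hypothesis hk : C2_0 S (char_set S N) k.
Hypothesis ea : C1_extension S a a'.
Hypothesis eb : C1_extension S b b'.
Hypothesis ek : C1_extension S k k'.

Local Notation K := (support3 S a b k).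
Local Notation lam2 := (@lebesgue_measure R \x @lebesgue_measure R)%E.

Variable A : atlas S.

Definition second_variation_integrand (g : heis R) : R :=
  let p := pbar N g in let q := qbar N g in let w := wbar N g in
  let Za := along (Z N) a' g in let Zb := along (Z N) b' g in
  let Zk := along (Z N) k' g in
  let TYa := along T a' g - w * along (Y N) a' g in
  let TYb := along T b' g - w * along (Y N) b' g in
  let TYk := along T k' g - w * along (Y N) k' g in
  2 * (q * Za - p * Zb) * TYk
  + TYa * (- 2 * q * Zk - q * (a g * p + b g * q) - p * (a g * q - b g * p))
  + TYb * (2 * p * Zk + p * (a g * p + b g * q) - q * (a g * q - b g * p))
  + 2 * (a g * q - b g * p) * (q * Za - p * Zb) * w
  + (Za + p * w * Zk) ^+ 2 + (Zb + q * w * Zk) ^+ 2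
  + (a g ^+ 2 + b g ^+ 2) * w ^+ 2
  + 2 * w * (a g * Za + b g * Zb)
  + 2 * w ^+ 2 * (a g * p + b g * q) * Zk
  - (q * Za - p * Zb + (a g * q - b g * p) * w) ^+ 2.

Local Notation F := second_variation_integrand.

Lemma integrand_chart U th u : chart S U th -> U u -> W N (th u) != 0 ->
  sqrt_poly_deriv2 (flow_poly a b k th) u = F (th u) * hor th u.
Proof. by move=> hc Uu W0; exact: (second_variation_density hN ea eb ek hc Uu W0). Qed.

Lemma sumsq_poly_zero (x1 y1 V1 a1 b1 m1 n1 x2 y2 V2 a2 b2 m2 n2 : R) :
  a1 = 0 -> b1 = 0 -> m1 = 0 -> n1 = 0 -> a2 = 0 -> b2 = 0 -> m2 = 0 -> n2 = 0 ->
  let P := sumsq_poly (cross_coefA x1 y1 V1 a1 b1 m1 n1 x2 y2 V2 a2 b2 m2 n2)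
    (cross_coefB x1 y1 V1 a1 b1 m1 n1 x2 y2 V2 a2 b2 m2 n2) in
  P`_1 = 0 /\ P`_2 = 0.
Proof.
move=> -> -> -> -> -> -> -> -> P; rewrite /P !coef_sumsq_poly /=.
by split; ring.
Qed.

(** At a characteristic point the weight vanishes. Elsewhere [F] is formed with extensions whose
    behaviour off [S] is unknown, so one passes to a chart: [a], [b], [k] vanish near the point on
    [S], hence so does [F] times the positive density. *)
Lemma integrand_outside g : S g -> ~ K g -> F g * hdensity N g = 0.
Proof.
move=> Sg nK; have [W0|W0] := eqVneq (W N g) 0.
  by rewrite /hdensity W0 mul0r mulr0.
have [U [th [hc [u Uu ug]]]] := hS Sg; move: Sg nK W0; rewrite -ug => Sg nK W0.
have near0 (f : heis R -> R) : (forall g, S g -> ~ K g -> f g = 0) -> forall e : R * R, 'D_e (f \o th) u = 0.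
  move=> f0 e; rewrite -(derive_cst (0 : R) u e).
  apply: near_eq_derive; apply: filterS (near_outside ha hb hk hc Uu nK) => v [Uv nKv] /=.
  by apply: f0 => //; exact: (chart_in hc).
have Da := near0 a (fun g Sg nK => let: And3 h _ _ := support3_out Sg nK in h).
have Db := near0 b (fun g Sg nK => let: And3 _ h _ := support3_out Sg nK in h).
have Dk := near0 k (fun g Sg nK => let: And3 _ _ h := support3_out Sg nK in h).
have [a0 b0 _] := support3_out Sg nK.
have mu0 e : flow_mu a b k th u e = 0.
  by rewrite /flow_mu Dk a0 b0 !mul0r subr0 addr0.
have nu0 e : flow_nu a b th u e = 0.
  by rewrite /flow_nu a0 b0 !mul0r subr0 mul0r.
have [P1 P2] : (flow_poly a b k th u)`_1 = 0 /\ (flow_poly a b k th u)`_2 = 0.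
  exact: (@sumsq_poly_zero (du th u).1.1 (du th u).1.2 (vert (th u) (du th u)) _ _ _ _
    (dv th u).1.1 (dv th u).1.2 (vert (th u) (dv th u)) _ _ _ _
    (Da (1, 0)) (Db (1, 0)) (mu0 (1, 0)) (nu0 (1, 0))
    (Da (0, 1)) (Db (0, 1)) (mu0 (0, 1)) (nu0 (0, 1))).
have := integrand_chart hc Uu W0; rewrite /sqrt_poly_deriv2 P1 P2.
rewrite expr0n/= !mul0r subr0 => /esym/eqP; rewrite mulf_eq0 => /orP[/eqP ->|].
  by rewrite mul0r.
rewrite (hor_flow_poly a b k th u) gt_eqF//.
by rewrite sqrtr_gt0; exact: (flow_poly0_gt0 hN ea eb ek hc Uu W0).
Qed.

Lemma Ck0_inv (U : set (R * R)) (f : R * R -> R) : Ck 0 U f ->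
  (forall u, U u -> f u != 0) -> Ck 0 U (fun u => (f u)^-1).
Proof. by move=> cf f0 u Uu; apply: cvgV; [exact: f0|exact: cf]. Qed.

(** In a chart, [F] is the second derivative of the density divided by the density, and both are
    continuous. *)
Lemma integrand_measurable n : measurable_fun (K `&` piece A n) F.
Proof.
have hc := achart A n; have oU := chart_open hc.
have [Ca _ _] := ha; have [Cb _ _] := hb; have [Cc _ _] := hk.
have CP i := Ck0_flow_poly hc (Ca _ _ hc) (Cb _ _ hc) (Cc _ _ hc) (i := i).
pose P i u := (flow_poly a b k (apar A n) u)`_i.
(* The part of the chart where the density is positive: it is open and free of characteristic
   points, and contains the parameters of [K] in the piece. *)
pose V := adom A n `&` [set u | 0 < P 0%N u].
have oV : open V.
  rewrite openE => u [Uu Pu]; apply: filterI; first exact: open_nbhs_nbhs.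
  have : nbhs (P 0%N u) (`]0, +oo[%classic : set R).
    by apply: open_nbhs_nbhs; split; [exact: interval_open|rewrite /= in_itv/= Pu].
  move=> /(CP 0%N u Uu) H.
  have H' : nbhs u [set v | `]0, +oo[%classic (P 0%N v)] by exact: H.
  by apply: filterS H' => v /=; rewrite in_itv/= andbT.
have VU : V `<=` adom A n by move=> u [].
have hV := chart_sub oV VU hc.
have P0 u : V u -> P 0%N u != 0 by move=> [_ /= Pu]; rewrite gt_eqF.
have S0 u : V u -> Num.sqrt (P 0%N u) != 0 by move=> [_ /= Pu]; rewrite gt_eqF// sqrtr_gt0.
have WV u : V u -> W N (apar A n u) != 0.
  move=> [Uu Pu]; apply/eqP => W0; have [_ N0 /(_ _ _ hc u Uu)[Nu Nv]] := hN.
  have := hor_density (N0 _ (chart_in hc Uu)) Nu Nv.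
  rewrite W0 !mul0r (hor_flow_poly a b k) => /esym/eqP.
  by rewrite gt_eqF// sqrtr_gt0.
have CPV i := Ck_subset VU (CP i).
have CS : Ck 0 V (fun u => Num.sqrt (P 0%N u)) := Ck0_sqrt (CPV 0%N).
have CSV := Ck0_inv CS S0; have CPI := Ck0_inv (CPV 0%N) P0.
have C1 := CkM oV (CPV 2) CSV.
have C2 := CkM oV (CkM oV (CkX2 oV (CPV 1)) (CkZ 4^-1 oV CPI)) CSV.
have C3 := CkM oV (CkB oV C1 C2) CSV.
have CF : Ck 0 V (F \o apar A n).
  apply: (Ck_eq oV _ C3) => u Vu /=.
  have E := integrand_chart hc (VU _ Vu) (WV _ Vu).
  rewrite (hor_flow_poly a b k) in E.
  rewrite -[RHS](mulfK (S0 _ Vu)) -E /sqrt_poly_deriv2; congr (_ * _).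
  by rewrite -/(P 0%N u) !invfM !mulrA.
have mF := chart_measurable_fun hV CF.
apply: (measurable_funS _ _ mF).
  by apply: (chart_image_measurable hV).
move=> g [Kg gn]; have [u Qu ug] := piece_sub gn.
exists u => //; split; first exact: acomp_sub Qu.
apply: (flow_poly0_gt0 hN ea eb ek hc (acomp_sub Qu)).
by rewrite ug; exact: support3_W Kg.
Qed.

Variable sigma : {measure set (heis R) -> \bar R}.
Hypothesis hsigma : riemannian_surface_measure S sigma.

Lemma support_integral_H n0 (f : heis R -> R) :
  (forall n, (n0 <= n)%N -> K `&` piece A n = set0) ->
  (forall n, measurable_fun (K `&` piece A n) f) -> (forall g, K g -> 0 <= f g) ->
  integral_H sigma N K f =
  (\sum_(n < n0) \int[lam2]_(u in chart_piece A K n) (f (apar A n u) * hor (apar A n) u)%:E)%E.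
Proof.
move=> K0 mf f0.
have mK := compact_measurable3 (support3_compact ha hb hk).
have KS := support3_subS ha hb hk.
have mKn n : measurable (K `&` piece A n) by apply: measurableI => //; exact: measurable_piece.
have EK : K = \bigcup_n (K `&` piece A n).
  by rewrite -setI_bigcupr bigcup_piece setIidl.
have fh0 g : K g -> (0 <= (f g * hdensity N g)%:E)%E.
  by move=> Kg; rewrite lee_fin mulr_ge0 ?f0// hdensity_ge0.
transitivity (\sum_(0 <= n <oo) integral_H sigma N (K `&` piece A n) f)%E.
  rewrite /integral_H {1}EK ge0_integral_bigcup//.
  - apply/measurable_fun_bigcup => // n; apply/measurable_EFinP.
    apply: measurable_funM; first exact: mf.
    apply: (measurable_funS (C2_surface_measurable hS) _ (hdensity_measurable hN hS)).
    by move=> g [/KS].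
  - by rewrite -EK; exact: fh0.
  - apply: trivIset_setIl; exact: trivIset_piece.
rewrite (nneseries_split 0 n0); last first.
  by move=> n _; apply: integral_ge0 => g [Kg _]; exact: fh0.
rewrite add0n [X in (_ + X)%E](_ : _ = 0%E) ?adde0; last first.
  by apply: eseries0 => n n0n _; rewrite K0// /integral_H integral_set0.
rewrite big_mkord; apply: eq_bigr => i _.
have hc := achart A i.
have sub : K `&` piece A i `<=` apar A i @` adom A i.
  by move=> g [_ /piece_sub[u Qu <-]]; exists u => //; exact: acomp_sub Qu.
exact: (chart_integral_H hN hsigma hc (mKn i) sub (mf i) (fun g Kg => f0 g Kg.1)).
Qed.

Lemma second_variation_integral n0 :
  (forall n, (n0 <= n)%N -> K `&` piece A n = set0) ->
  (forall n, (n < n0)%N -> lam2.-integrable (chart_piece A K n)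
        (fun u => (sqrt_poly_deriv2 (flow_poly a b k (apar A n)) u)%:E)) ->
  integral_H sigma N S F = (\sum_(n < n0) \int[lam2]_(u in chart_piece A K n)
         sqrt_poly_deriv2 (flow_poly a b k (apar A n)) u)%:E.
Proof.
move=> K0 int2.
have KS := support3_subS ha hb hk.
(* The passage to charts holds for nonnegative functions, so the two parts of [F] are treated
   separately. *)
pose Fp g := Num.max (F g) 0; pose Fm g := Num.max (- F g) 0.
have mFp n : measurable_fun (K `&` piece A n) Fp.
  by apply: measurable_maxr; [exact: integrand_measurable|exact: measurable_cst].
have mFm n : measurable_fun (K `&` piece A n) Fm.
  apply: measurable_maxr; last exact: measurable_cst.
  by apply: measurableT_comp => //; exact: integrand_measurable.
have Fp0 g : K g -> 0 <= Fp g by rewrite le_max lexx orbT.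
have Fm0 g : K g -> 0 <= Fm g by rewrite le_max lexx orbT.
have -> : integral_H sigma N S F = (integral_H sigma N K Fp - integral_H sigma N K Fm)%E.
  rewrite /integral_H.
  transitivity (\int[sigma]_(g in K) (F g * hdensity N g)%:E)%E.
    rewrite -[in RHS](setIidr KS) integral_mkcondr.
    apply: eq_integral => g /[!inE] Sg; rewrite patchE; case: ifPn => // /negP nK.
    by rewrite integrand_outside// => Kg; apply: nK; rewrite inE.
  rewrite integralE; congr (_ - _)%E; apply: eq_integral => g _.
  - rewrite funeposE -EFin_max /Fp; congr _%:E.
    by rewrite maxr_pMl ?hdensity_ge0// mul0r.
  - rewrite funenegE -EFinN -EFin_max /Fm; congr _%:E.
    by rewrite maxr_pMl ?hdensity_ge0// mul0r mulNr.
rewrite (support_integral_H K0 mFp Fp0) (support_integral_H K0 mFm Fm0).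
pose s n u := sqrt_poly_deriv2 (flow_poly a b k (apar A n)) u.
have sE n u : chart_piece A K n u -> s n u = F (apar A n u) * hor (apar A n) u.
  by move=> [Uu [Ku _]]; exact: (integrand_chart (achart A n) Uu (support3_W ha hb hk Ku)).
have mD n : measurable (chart_piece A K n).
  exact: (chart_piece_measurable hS A n (compact_measurable3 (support3_compact ha hb hk))).
have Ep n : (\int[lam2]_(u in chart_piece A K n) (Fp (apar A n u) * hor (apar A n) u)%:E =
    \int[lam2]_(u in chart_piece A K n) (fun u => (s n u)%:E)^\+ u)%E.
  apply: eq_integral => u /[!inE] Du; rewrite funeposE -EFin_max sE//; congr _%:E.
  by rewrite maxr_pMl ?sqrtr_ge0// mul0r.
have Em n : (\int[lam2]_(u in chart_piece A K n) (Fm (apar A n u) * hor (apar A n) u)%:E =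
    \int[lam2]_(u in chart_piece A K n) (fun u => (s n u)%:E)^\- u)%E.
  apply: eq_integral => u /[!inE] Du; rewrite funenegE -EFinN -EFin_max sE//; congr _%:E.
  by rewrite maxr_pMl ?sqrtr_ge0// mul0r mulNr.
(* Integrability of [s] makes both parts finite on each piece, so the difference of the two sums can
   be taken termwise. *)
pose p n := fine (\int[lam2]_(u in chart_piece A K n) (fun u => (s n u)%:E)^\+ u)%E.
pose m n := fine (\int[lam2]_(u in chart_piece A K n) (fun u => (s n u)%:E)^\- u)%E.
have pE : forall i : 'I_n0, (\int[lam2]_(u in chart_piece A K i) (fun u => (s i u)%:E)^\+ u)%E = (p i)%:E.
  by move=> i; have H := integrable_pos_fin_num (mu := lam2) (mD i) (int2 _ (ltn_ord i)); rewrite /p fineK.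
have mE : forall i : 'I_n0, (\int[lam2]_(u in chart_piece A K i) (fun u => (s i u)%:E)^\- u)%E = (m i)%:E.
  by move=> i; have H := integrable_neg_fin_num (mu := lam2) (mD i) (int2 _ (ltn_ord i)); rewrite /m fineK.
rewrite (eq_bigr (fun i : 'I_n0 => (p i)%:E)); last by move=> i _; rewrite Ep pE.
rewrite [X in (_ - X)%E](eq_bigr (fun i : 'I_n0 => (m i)%:E)); last first.
  by move=> i _; rewrite Em mE.
rewrite !sumEFin -EFinB -sumrB; congr _%:E; apply: eq_bigr => i _.
by rewrite /Rintegral integralE pE mE.
Qed.

End second_variation_integral.

(** The formula for [P] is known only near 0, so every derivative is transported along equality near
    a point; the first one is needed on the whole neighbourhood to differentiate again at 0. *)
Lemma second_derivative_sum (R : realType) (n : nat) (J : 'I_n -> R -> R) (P : R -> R)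
    (C r : R) (v : 'I_n -> R) : 0 < r ->
  (forall l, `|l| < r -> P l = C + \sum_(i < n) J i l) ->
  (forall i (l : R), `|l| < r -> derivable (J i) l 1) ->
  (forall i, derivable (derive1 (J i)) 0 1) ->
  (forall i, derive1 (derive1 (J i)) 0 = v i) ->
  [/\ \forall l \near (0 : R), derivable P l 1, derivable (derive1 P) 0 1
    & derive1n 2 P 0 = \sum_(i < n) v i].
Proof.
move=> r0 PE dJ dJ1 J2.
have near_r (l : R) : `|l| < r -> \forall x \near l, `|x| < r.
  have H : `|x| @[x --> l] --> `|l| by exact: (@norm_continuous _ R^o).
  by move=> lr; exact: (cvgr_lt _ H _ lr).
have dP (l : R) : `|l| < r -> is_derive l 1 P (\sum_(i < n) derive1 (J i) l).
  move=> lr.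
  have dS : is_derive l 1 (cst C + \sum_(i < n) J i) (0 + \sum_(i < n) derive1 (J i) l).
    apply: is_deriveD; apply: is_derive_sum => i.
    by apply: DeriveDef; [exact: dJ|rewrite derive1E].
  rewrite add0r in dS; apply: near_eq_is_derive dS.
  apply: filterS (near_r _ lr) => x xr.
  by rewrite PE// !fctE fct_sumE.
have near0 : \forall l \near (0 : R), `|l| < r by apply: near_r; rewrite normr0.
have dP1 : is_derive (0 : R) 1 (derive1 P) (\sum_(i < n) v i).
  have dS : is_derive (0 : R) 1 (\sum_(i < n) derive1 (J i)) (\sum_(i < n) v i).
    by apply: is_derive_sum => i; apply: DeriveDef => //; rewrite -derive1E J2.
  apply: near_eq_is_derive dS; apply: filterS near0 => l lr.
  by rewrite derive1E; have [_ ->] := dP l lr; rewrite fct_sumE.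
split.
- by apply: filterS near0 => l lr; have [] := dP l lr.
- by have [] := dP1.
- by rewrite /derive1n /= derive1E; have [] := dP1.
Qed.

(** The frame is a basis at each point, so all components vanish where the field does. This places
    [K] inside [S0]. *)
Lemma support3_support_vfield (R : realType) (S : set (heis R)) (a b k : heis R -> R) :
  support3 S a b k `<=` support_on S (vfield a b k).
Proof.
have v0 g : vfield a b k g = 0 -> [/\ a g = 0, b g = 0 & k g = 0].
  case: g => -[x y] t; rewrite vfieldE => -[a0 b0]; rewrite a0 b0 !mul0r subr0 mul0r addr0.
  by [].
have sub (f : heis R -> R) : (forall g, vfield a b k g = 0 -> f g = 0) ->
    support_on S f `<=` support_on S (vfield a b k).
  move=> f0; apply: closureS => h [Sh h0]; split=> // vh.
  by apply: h0; exact: f0.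
by move=> g [[]|]; apply: sub => h /v0[].
Qed.

Theorem theorem14p5 (R : realType) (S : set (heis R))
  (N : heis R -> heis R) (sigma : {measure set (heis R) -> \bar R})
  (a b k a' b' k' : heis R -> R)
  (S0 : set (heis R))
  (Nd : R -> heis R -> heis R)
  (sigmad : R -> {measure set (heis R) -> \bar R})
  (hS : C2_surface S) (hN : normal_field S N)
  (hsigma : riemannian_surface_measure S sigma)
  (ha : C2_0 S (char_set S N) a)
  (hb : C2_0 S (char_set S N) b)
  (hk : C2_0 S (char_set S N) k)
  (ha' : C1_extension S a a') (hb' : C1_extension S b b')
  (hk' : C1_extension S k k')
  (hS0 : rel_compact_open S S0)
  (hsupp : support_on S (vfield a b k) `<=` S0)
  (hNd : \forall l \near (0 : R),
     normal_field (deform (vfield a b k) l S) (Nd l))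
  (hsigmad : \forall l \near (0 : R),
     riemannian_surface_measure (deform (vfield a b k) l S) (sigmad l)) :
  let P := perimeter sigmad Nd S S0 (vfield a b k) in
  let p := pbar N in let q := qbar N in let w := wbar N in
  let Za := along (Z N) a' in
  let Zb := along (Z N) b' in
  let Zk := along (Z N) k' in
  let TYa g := along T a' g - w g * along (Y N) a' g in
  let TYb g := along T b' g - w g * along (Y N) b' g in
  let TYk g := along T k' g - w g * along (Y N) k' g in
  [/\ \forall l \near (0 : R), derivable P l 1,
      derivable (derive1 P) 0 1
    & (derive1n 2 P 0)%:E = integral_H sigma N S (fun g =>
          2 * (q g * Za g - p g * Zb g) * TYk g
        + TYa g * (- 2 * q g * Zk g - q g * (a g * p g + b g * q g)
                   - p g * (a g * q g - b g * p g))
        + TYb g * (2 * p g * Zk g + p g * (a g * p g + b g * q g)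
                   - q g * (a g * q g - b g * p g))
        + 2 * (a g * q g - b g * p g) * (q g * Za g - p g * Zb g) * w g
        + (Za g + p g * w g * Zk g) ^+ 2
        + (Zb g + q g * w g * Zk g) ^+ 2
        + (a g ^+ 2 + b g ^+ 2) * w g ^+ 2
        + 2 * w g * (a g * Za g + b g * Zb g)
        + 2 * w g ^+ 2 * (a g * p g + b g * q g) * Zk g
        - (q g * Za g - p g * Zb g + (a g * q g - b g * p g) * w g) ^+ 2)].
Proof.
move=> P p q w Za Zb Zk TYa TYb TYk.
have [A] := C2_surface_atlas hS.
set K := support3 S a b k; set X := vfield a b k in P hsupp hNd hsigmad *.
have cK : compact K := support3_compact ha hb hk.
have KS : K `<=` S := support3_subS ha hb hk.
have mK := compact_measurable3 cK.
have mS := C2_surface_measurable hS.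
have [n0 Hn0] := piece_compact A cK KS.
have /choice[e He] := fun n =>
  iffLR (exists2P _ _) (piece_variation hS hN ha hb hk ha' hb' hk' A n).
pose J n (l : R) := (\int[(@lebesgue_measure R \x @lebesgue_measure R)%E]_(u in
  chart_piece A K n) Num.sqrt (flow_poly a b k (apar A n) u).[l])%R.
have [[Q oQ ES0] cS0 S0S] := hS0.
have S0S' : S0 `<=` S := subset_trans (@subset_closure _ S0) S0S.
have mS0 : measurable S0.
  by rewrite ES0; apply: measurableI => //; exact: open_measurable3.
have KS0 : K `<=` S0 := subset_trans (@support3_support_vfield _ S a b k) hsupp.
(* The support contributes a finite amount, so finiteness of the perimeter is decided by the part
   outside [K], which does not depend on [l]: [perimeter] takes the same branch for all small
   [l]. *)
pose C := fine (if (hmass A (S `\` K) < +oo)%E then hmass A (S `\` K)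
  else hmass A (S0 `\` K)).
have hmass0 B : (0 <= hmass A B)%E.
  apply: nneseries_ge0 => n _ _; apply: integral_ge0 => u _.
  by rewrite lee_fin sqrtr_ge0.
(* The closure of [S0] is a compact subset of [S], so it meets finitely many pieces. *)
have fin0 : (hmass A (S0 `\` K) < +oo)%E.
  apply: (hmass_compact hS A _ _ cS0 S0S); first exact: measurableD.
  by move=> g [/subset_closure].
have : \forall l \near (0 : R), P l = C + \sum_(i < n0) J i l /\ forall i : 'I_n0, `|l| < e i.
  (* The radii [e i] have no common lower bound over all pieces, but only those below [n0]
     matter. *)
  have ne : \forall l \near (0 : R), forall i : 'I_n0, `|l| < e i.
    have H (i : 'I_n0) : \forall l \near (0 : R), `|l| < e i.
      by apply: (@nbhs0_lt _ R^o); have [] := He i.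
    exact: (@filter_forall R 'I_n0 _ (nbhs (0 : R)) _ H).
  apply: filterS (filterI (flow_expansive ha' hb' hk' cK KS (@support3_out _ S a b k))
    (filterI hNd (filterI hsigmad ne))) => l [ex_l [Nl [sl el]]].
  split=> //.
  have EK : sigma_H (sigmad l) (Nd l) (deform X l K) = (\sum_(i < n0) J i l)%:E.
    apply: (sigma_H_support hS ha hb hk ex_l Nl sl Hn0) => n nn0.
    by have [_ [H _ _ _ _]] := He n; apply: H; exact: (el (Ordinal nn0)).
  have ES := sigma_H_setD hS ha hb hk A ex_l Nl sl KS (@subset_refl _ S) mS.
  have ES0' := sigma_H_setD hS ha hb hk A ex_l Nl sl KS0 S0S' mS0.
  rewrite /P /perimeter ES ES0' EK /C.
  have fD x : (0 <= x)%E -> (x < +oo)%E ->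
      fine (x + (\sum_(i < n0) J i l)%:E)%E = fine x + \sum_(i < n0) J i l.
    by move=> x0 xoo; rewrite fineD// ge0_fin_numE.
  have [Sfin|Sinf] := ltP (hmass A (S `\` K)) +oo%E.
    rewrite ifT ?fD// -(fineK (x := hmass A (S `\` K))) ?ge0_fin_numE//.
    by rewrite -EFinD ltry.
  rewrite ifF ?fD//; move: Sinf; rewrite leye_eq => /eqP ->.
  by rewrite addye// ltxx.
move=> /nbhs_ballP[r /= r0 Hr].
have {}Hr (l : R) : `|l| < r -> P l = C + \sum_(i < n0) J i l /\ forall i : 'I_n0, `|l| < e i.
  by move=> lr; apply: Hr; rewrite -ball_normE/= sub0r normrN.
have dJ (i : 'I_n0) (l : R) : `|l| < r -> derivable (J i) l 1.
  by move=> lr; have [_ [_ _ H _ _]] := He i; apply: H; exact: (Hr l lr).2.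
have dJ1 (i : 'I_n0) : derivable (derive1 (J i)) 0 1 by have [_ []] := He i.
have J2 (i : 'I_n0) : derive1 (derive1 (J i)) 0 =
    (\int[(@lebesgue_measure R \x @lebesgue_measure R)%E]_(u in chart_piece A K i)
      sqrt_poly_deriv2 (flow_poly a b k (apar A i)) u)%R.
  by have [_ [_ _ _ _ H]] := He i; exact: H.
have [D1 D2 D3] := second_derivative_sum (J := fun i : 'I_n0 => J i) r0
  (fun l lr => (Hr l lr).1) dJ dJ1 J2.
split; [exact: D1|exact: D2|].
refine (etrans (f_equal EFin D3) _); apply/esym.
apply: (second_variation_integral hS hN ha hb hk ha' hb' hk' hsigma Hn0).
by move=> n _; have [_ []] := He n.
Qed.
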